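(* Let $I\subseteq\mathbb{R}$ be an open interval, let $m,w$ be positive continuous functions on $I$ with $\frac{dw}{dx}$ locally bounded, let $\nu$ be a signed Radon measure on $I$, and set $L^{(0)}=\frac{1}{m(x)}\frac{d}{dx}\left(\frac{1}{w(x)}\frac{d}{dx}\right)$ and $L=L^{(0)}+\nu$. The following two conditions are equivalent: (i) There is a positive continuous function $u$ on $I$ satisfying $Lu=0$. (ii) For any smooth function $f$ compactly supported in $I$, $$\int_{I}(L^{(0)}f)(x)f(x)\,m(x)\,dx+\int_{I}f(x)^{2}m(x)\,\nu(dx)\leq 0 .$$
   Context: By a signed (Radon) measure on $I$ we mean $\nu(dx)=\epsilon(x)|\nu|(dx)$ where $|\nu|$ is a positive Radon measure on $I$ (not necessarily finite) and $\epsilon$ takes values in $\{-1,1\}$. The equation $Lu=0$ for a continuous function $u$ is understood in the sense of measures on $I$: the distributional derivative of $\frac{1}{w}\frac{du}{dx}$ is a signed measure, and $\frac{1}{m}\,d\!\left(\frac{1}{w}\frac{du}{dx}\right)+u\,\nu=0$. *)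

(* Defs.v *)
From HB Require Import structures.
From mathcomp Require Import all_boot all_order all_algebra.
From mathcomp Require Import all_classical all_reals all_analysis.

Set Implicit Arguments.
Unset Strict Implicit.
Unset Printing Implicit Defensive.

Import Order.TTheory GRing.Theory Num.Theory.
Import numFieldNormedType.Exports.

Local Open Scope ring_scope.
Local Open Scope classical_set_scope.

(* Throughout, functions and measures "on [I]" are represented by functions and
   Borel measures on the whole line of which only the restriction to [I] is
   ever constrained or used. *)

Definition test_function (R : realType) (I : set R) (f : R -> R) : Prop :=
  [/\ forall (n : nat) (x : R), derivable (derive1n n f) x 1,
      compact (closure [set x | f x != 0])
    & closure [set x | f x != 0] `<=` I].

(* [nu(dx) = sgn x * tv(dx)]; [tv] need not be finite, so the library's
   (everywhere finite) signed measures, i.e. charges, do not apply. *)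
Record signed_radon (R : realType) (I : set R) := SignedRadon {
  tv : {measure set (measurableTypeR R) -> \bar R} ;
  sgn : R -> R ;
  tv_finite : forall K : set R, compact K -> K `<=` I -> (tv K < +oo)%E ;
  sgn_measurable : measurable_fun I (sgn : measurableTypeR R -> R) ;
  sgn_pm1 : forall x, I x -> sgn x = 1 \/ sgn x = -1 }.

Definition signed_integral (R : realType) (I : set R) (nu : signed_radon I)
    (D : set R) (f : R -> R) : R :=
  \int[tv nu]_(x in D) (f x * sgn nu x).

(* The distributional derivative of [g] on [I] is the function [dg]. *)
Definition weak_derivative (R : realType) (I : set R) (g dg : R -> R) : Prop :=
  [/\ locally_integrable I g, locally_integrable I dg
    & forall phi, test_function I phi ->
      \int[lebesgue_measure]_(x in I) (g x * derive1 phi x) =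
      - \int[lebesgue_measure]_(x in I) (dg x * phi x)].

(* The distributional derivative of [g] on [I] is the signed measure [mu]. *)
Definition measure_derivative (R : realType) (I : set R) (g : R -> R)
    (mu : signed_radon I) : Prop :=
  locally_integrable I g /\
  forall phi, test_function I phi ->
    \int[lebesgue_measure]_(x in I) (g x * derive1 phi x) =
    - signed_integral mu I phi.

(* [dw/dx] exists (in the sense of distributions, [w] being only assumed
   continuous) and is locally bounded. This holds in particular when [w] is
   differentiable on [I] with locally bounded derivative. *)
Definition locally_bounded_derivative (R : realType) (I : set R) (w : R -> R)
    : Prop :=
  exists2 dw, weak_derivative I w dw &
    forall K : set R, compact K -> K `<=` I ->
      exists M : R, forall x, K x -> `|dw x| <= M.

(* For smooth [f] and [w] positive with locally bounded derivative, [f' / w] is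
   locally Lipschitz, so the outer derivative exists almost everywhere; the
   default value of [derive1] elsewhere does not affect integrals. *)
Definition L0 (R : realType) (m w f : R -> R) (x : R) : R :=
  (m x)^-1 * derive1 (fun y => (w y)^-1 * derive1 f y) x.

(* [L u = 0] in the sense of measures on [I]. A distribution whose derivative
   is a measure is a function, hence so is [du/dx]. The measure
   [(1/m) d((1/w) du/dx) + u nu] is well defined on the relatively compact Borel
   subsets of [I], on which it has to vanish. *)
Definition L_null (R : realType) (I : set R) (m w : R -> R)
    (nu : signed_radon I) (u : R -> R) : Prop :=
  exists (du : R -> R) (mu : signed_radon I),
    [/\ weak_derivative I u du,
        measure_derivative (fun x => (w x)^-1 * du x) mu
      & forall A K : set R, measurable (A : set (measurableTypeR R)) ->
          compact K -> A `<=` K -> K `<=` I ->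
          signed_integral mu A (fun x => (m x)^-1) + signed_integral nu A u
          = 0].

(* Main.v *)
Require Import Defs.
From HB Require Import structures.
From mathcomp Require Import all_boot all_order all_algebra.
From mathcomp Require Import all_classical all_reals all_analysis.
From mathcomp Require Import measurable_realfun.
From mathcomp Require Import ring lra.

Set Implicit Arguments.
Unset Strict Implicit.
Unset Printing Implicit Defensive.

Import Order.TTheory GRing.Theory Num.Theory.
Import numFieldNormedType.Exports.

Local Open Scope classical_set_scope.
Local Open Scope ring_scope.

(** Let [N] be the distribution function of the measure m nu, based at a point x0 of I ([massN]).
    Integrating by parts against dx and against nu, the left-hand side of (ii) becomes - Q(f), where
    Q(f) is the integral of f'^2 / w + 2 f f' N ([quad], [energyE]). Only locally bounded functions
    occur in Q, and (ii) says that Q >= 0 on test functions.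

    From (i) to (ii): let u > 0 solve L u = 0 and let v be a locally bounded version of u' / w, so
    that dv = - u m nu. Integrating f^2 / u against dv shows that the integral of f^2 m against nu
    is that of (f^2 / u)' v against dx. Since (f^2 / u)' v - f'^2 / w = - (f' - f u' / u)^2 / w, the
    form is nonpositive ([positive_solution_form]).

    From (ii) to (i): with z = u' / w + N u, the equation L u = 0 becomes the linear system u' = w
    (z - N u), z' = N u', whose coefficients are locally bounded; a Volterra series solves it for
    any data at x0 ([quasi_solution_exists]). By mollification Q >= 0 extends to compactly supported
    Lipschitz functions ([quad_ge0]). If a solution u vanishes at a < b, its truncation to [a, b]
    has zero energy and so minimizes Q; the first variation then forces z b = 0 ([zeros_conormal]),
    and constancy of Wronskians makes u trivial ([disconjugate]). Thus a nontrivial solution has at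
    most one zero. Consider the solutions p + t q with value 1 at x0, where q vanishes at x0. The
    parameters t for which positivity fails to the right of x0 form an open half-line unbounded
    below, those for which it fails to the left an open half-line unbounded above, and the two are
    disjoint; so some t belongs to neither and gives a positive solution
    ([positive_quasi_solution]). The measure - u m nu then witnesses L u = 0
    ([quasi_solution_L_null]).

    The passage between distributional derivatives and genuine primitives rests on
    [du_Bois_Reymond], through [weak_derivative_primI] and [measure_derivative_ae]. *)

(** * Bounded measurable functions on a segment *)

Section bounded_measurable.
Context {R : realType}.
Implicit Types (a b x y : R) (f g : R -> R).

(** The working class of integrands: unlike integrability, it is stable under products, and all
    coefficients of the problem belong to it locally. For b < a the condition is vacuous, so
    endpoints may come in any order. *)
Definition bmf a b f : Prop :=
  measurable_fun `[a, b] f /\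
  exists M : R, forall x, x \in `[a, b] -> `|f x| <= M.

Lemma bmf_itv a b f i j : bmf a b f -> a <= i -> j <= b -> bmf i j f.
Proof.
move=> [mf [M fM]] ai jb.
have sub : `[i, j]%classic `<=` `[a, b]%classic.
  by apply: subset_itvScc; rewrite bnd_simp.
split; first exact: measurable_funS mf.
by exists M => x xij; apply: fM; exact: (sub x xij).
Qed.

Lemma bmf_bound a b f : bmf a b f ->
  exists2 M : R, 0 <= M & forall x, x \in `[a, b] -> `|f x| <= M.
Proof.
move=> [_ [M fM]]; exists (Num.max 0 M); first by rewrite le_max lexx.
by move=> x /fM h; rewrite le_max h orbT.
Qed.

Lemma eq_bmf a b f g : {in `[a, b], f =1 g} -> bmf a b f -> bmf a b g.
Proof.
move=> fg [mf [M fM]]; split.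
  apply: eq_measurable_fun mf => x; rewrite inE => xab; exact: fg.
by exists M => x xab; rewrite -fg// fM.
Qed.

Lemma bmf_cst a b k : bmf a b (cst k).
Proof. by split; [exact: measurable_cst|exists `|k|]. Qed.

Lemma bmfD a b f g : bmf a b f -> bmf a b g -> bmf a b (fun x => f x + g x).
Proof.
move=> [mf [M fM]] [mg [N gN]]; split; first exact: measurable_funD.
exists (M + N) => x xab; rewrite (le_trans (ler_normD _ _))// lerD//.
  exact: fM.
exact: gN.
Qed.

Lemma bmfM a b f g : bmf a b f -> bmf a b g -> bmf a b (fun x => f x * g x).
Proof.
move=> [mf [M fM]] [mg [N gN]]; split; first exact: measurable_funM.
by exists (M * N) => x xab; rewrite normrM ler_pM// ?fM ?gN.
Qed.

Lemma bmfN a b f : bmf a b f -> bmf a b (fun x => - f x).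
Proof.
move=> bf; apply: eq_bmf (bmfM (bmf_cst a b (-1)) bf) => x _ /=.
by rewrite mulN1r.
Qed.

Lemma bmfB a b f g : bmf a b f -> bmf a b g -> bmf a b (fun x => f x - g x).
Proof. by move=> bf bg; apply: bmfD => //; exact: bmfN. Qed.

Lemma bmf_norm a b f : bmf a b f -> bmf a b (fun x => `|f x|).
Proof.
move=> [mf [M fM]]; split; first exact: measurableT_comp.
by exists M => x xab; rewrite normr_id fM.
Qed.

Lemma within_continuous_bmf a b f : {within `[a, b], continuous f} -> bmf a b f.
Proof.
move=> cf; split.
  exact: subspace_continuous_measurable_fun.
have : compact (f @` `[a, b]) by apply: continuous_compact => //; exact: segment_compact.
move/compact_bounded => [M [_ /(_ (M + 1))]].
rewrite ltrDl ltr01 => /(_ isT) H; exists (M + 1) => x xab.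
by apply: H => /=; exists x.
Qed.

Lemma bmf_integrable a b f : bmf a b f ->
  (@lebesgue_measure R).-integrable `[a, b] (EFin \o f).
Proof.
move=> [mf [M fM]]; apply: measurable_bounded_integrable => //.
  by rewrite /= lebesgue_measure_itv/=; case: ifP => _ //; rewrite -EFinB ltry.
exists M; split; first exact: num_real.
by move=> N MN x /= xab; rewrite (le_trans (fM _ xab))// ltW.
Qed.

End bounded_measurable.

(** * Almost-everywhere statements for Lebesgue measure *)

Section ae_lebesgue.
Context {R : realType}.
Notation mu := (@lebesgue_measure R).

Lemma ae_imp (P Q : R -> Prop) : (forall x, P x -> Q x) ->
  {ae mu, forall x, P x} -> {ae mu, forall x, Q x}.
Proof. by move=> PQ; exact: (@filterS _ _ (ae_filter_ringOfSetsType mu)). Qed.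

Lemma ae_and (P Q : R -> Prop) : {ae mu, forall x, P x} ->
  {ae mu, forall x, Q x} -> {ae mu, forall x, P x /\ Q x}.
Proof. exact: (@filterI _ _ (ae_filter_ringOfSetsType mu)). Qed.

End ae_lebesgue.

(** * Lebesgue integrals over segments *)

Section segment_integral.
Context {R : realType}.
Implicit Types (a b x y : R) (f g F G : R -> R).
Notation mu := (@lebesgue_measure R).

Lemma segI_chasles f a x b : a <= x -> x <= b -> bmf a b f ->
  \int[mu]_(t in `[a, b]) f t =
  \int[mu]_(t in `[a, x]) f t + \int[mu]_(t in `[x, b]) f t.
Proof.
move=> ax xb bf.
have intf := bmf_integrable bf.
have := @Rintegral_itvB R f (BLeft a) (BRight b) x intf.
rewrite !bnd_simp => /(_ ax xb) /eqP; rewrite subr_eq => /eqP ->.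
rewrite addrC Rintegral_itv_obnd_cbnd//.
apply: integrableS intf => //; apply: subset_itvScc; rewrite bnd_simp//.
Qed.

Lemma segI_ge0 f a b : (forall x, x \in `[a, b] -> 0 <= f x) ->
  0 <= \int[mu]_(t in `[a, b]) f t.
Proof. by move=> f0; apply: Rintegral_ge0 => x /= xab; apply: f0. Qed.

Lemma segI_cst a b k : a <= b -> \int[mu]_(t in `[a, b]) k = k * (b - a).
Proof.
move=> ab; rewrite Rintegral_cst//= lebesgue_measure_itv/= lte_fin.
move: ab; rewrite le_eqVlt => /predU1P[->|ab]; first by rewrite ltxx/= subrr.
by rewrite ab.
Qed.

Lemma segI_le f g a b : bmf a b f -> bmf a b g ->
  (forall x, x \in `[a, b] -> f x <= g x) ->
  \int[mu]_(t in `[a, b]) f t <= \int[mu]_(t in `[a, b]) g t.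
Proof.
by move=> bf bg fg; apply: le_Rintegral => //; try exact: bmf_integrable.
Qed.

Lemma segI_norm f a b : bmf a b f ->
  `|\int[mu]_(t in `[a, b]) f t| <= \int[mu]_(t in `[a, b]) `|f t|.
Proof.
by move=> bf; apply: le_normr_Rintegral => //; exact: bmf_integrable.
Qed.

Lemma segI_norm_le f a b M : a <= b -> bmf a b f ->
  (forall x, x \in `[a, b] -> `|f x| <= M) ->
  `|\int[mu]_(t in `[a, b]) f t| <= M * (b - a).
Proof.
move=> ab bf fM; rewrite (le_trans (segI_norm bf))// -segI_cst//.
apply: segI_le => //; [exact: bmf_norm|exact: bmf_cst].
Qed.

Lemma segID f g a b : bmf a b f -> bmf a b g ->
  \int[mu]_(t in `[a, b]) (f t + g t) =
  \int[mu]_(t in `[a, b]) f t + \int[mu]_(t in `[a, b]) g t.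
Proof. by move=> bf bg; rewrite RintegralD//; exact: bmf_integrable. Qed.

Lemma segIB f g a b : bmf a b f -> bmf a b g ->
  \int[mu]_(t in `[a, b]) (f t - g t) =
  \int[mu]_(t in `[a, b]) f t - \int[mu]_(t in `[a, b]) g t.
Proof. by move=> bf bg; rewrite RintegralB//; exact: bmf_integrable. Qed.

Lemma segIZ f a b k : bmf a b f ->
  \int[mu]_(t in `[a, b]) (k * f t) = k * \int[mu]_(t in `[a, b]) f t.
Proof. by move=> bf; rewrite RintegralZl//; exact: bmf_integrable. Qed.

Lemma segIN f a b : bmf a b f ->
  \int[mu]_(t in `[a, b]) - f t = - \int[mu]_(t in `[a, b]) f t.
Proof.
move=> bf; rewrite -mulN1r -segIZ//; apply: eq_Rintegral => x _.
by rewrite mulN1r.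
Qed.

Lemma eq_segI f g a b : {in `[a, b], f =1 g} ->
  \int[mu]_(t in `[a, b]) f t = \int[mu]_(t in `[a, b]) g t.
Proof. by move=> fg; apply: eq_Rintegral => x; rewrite inE => /fg. Qed.

Lemma ae_eq_segI f g a b : bmf a b f -> bmf a b g ->
  {ae mu, forall x, a < x < b -> f x = g x} ->
  \int[mu]_(t in `[a, b]) f t = \int[mu]_(t in `[a, b]) g t.
Proof.
move=> bf bg fg; rewrite /Rintegral; congr fine.
have mf : measurable_fun `[a, b] f by case: bf.
have mg : measurable_fun `[a, b] g by case: bg.
have sub : `]a, b[%classic `<=` `[a, b]%classic by exact: subset_itv_oo_cc.
rewrite integral_itv_bndoo; last first.
  by apply/measurable_EFinP; exact: measurable_funS mf.
rewrite [RHS]integral_itv_bndoo; last first.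
  by apply/measurable_EFinP; exact: measurable_funS mg.
apply: ae_eq_integral => //.
- by apply/measurable_EFinP; exact: measurable_funS mf.
- by apply/measurable_EFinP; exact: measurable_funS mg.
- apply: ae_imp fg => x fg; rewrite /= in_itv/= => xab.
  by rewrite fg.
Qed.

Lemma segI_dominated (fn : nat -> R -> R) f a b (M : R) : bmf a b f ->
  (forall n, measurable_fun `[a, b] (fn n)) ->
  (forall n x, x \in `[a, b] -> `|fn n x| <= M) ->
  {ae mu, forall x, a < x < b -> fn n x @[n --> \oo] --> f x} ->
  \int[mu]_(t in `[a, b]) fn n t @[n --> \oo] --> \int[mu]_(t in `[a, b]) f t.
Proof.
move=> bf mfn fnM cvfn.
have cv : {ae mu, forall x, `[a, b]%classic x -> fn n x @[n --> \oo] --> f x}.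
  have nea : {ae mu, forall x, x != a}.
    exists [set a]; split => //; first exact: lebesgue_measure_set1.
    by move=> x /= /negP; rewrite negbK => /eqP.
  have neb : {ae mu, forall x, x != b}.
    exists [set b]; split => //; first exact: lebesgue_measure_set1.
    by move=> x /= /negP; rewrite negbK => /eqP.
  apply: (ae_imp _ (ae_and nea (ae_and neb cvfn))) => x [xa [xb H]].
  rewrite /= in_itv/= => /andP[ax bx]; apply: H.
  by rewrite !lt_neqAle ax bx !andbT eq_sym xa.
apply: fine_cvg; rewrite fineK; last first.
  by apply: integrable_fin_num => //; exact: bmf_integrable.
have h1 n : measurable_fun `[a, b] (fun x => (fn n x)%:E).
  exact/measurable_EFinP.
have h2 : measurable_fun `[a, b] (EFin \o f).
  by apply/measurable_EFinP; case: bf.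
have h3 : {ae mu, forall x, `[a, b]%classic x ->
    (fn n x)%:E @[n --> \oo] --> (EFin \o f) x}.
  apply: ae_imp cv => x H xab; apply: cvg_EFin; first exact: nearW.
  exact: H.
have h4 : mu.-integrable `[a, b] (cst M%:E) := bmf_integrable (bmf_cst a b M).
have h5 : {ae mu, forall x n, `[a, b]%classic x -> (`|(fn n x)%:E| <= cst M%:E x)%E}.
  by apply: aeW => x n xab; rewrite lee_fin; apply: fnM.
by have [] := @dominated_convergence _ _ _ mu _ (measurable_itv _) _ _ _ h1 h2 h3 h4 h5.
Qed.

End segment_integral.

(** * Pointwise derivatives *)

Section derivative_rules.
Context {R : realType}.
Implicit Types (x a b : R) (F G : R -> R).

Lemma is_deriveM1 F G x a b : is_derive x 1 F a -> is_derive x 1 G b ->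
  is_derive x 1 (fun t => F t * G t) (a * G x + F x * b).
Proof.
move=> dF dG; apply: is_derive_eq (is_deriveM dF dG) _.
by rewrite /GRing.scale/= addrC (mulrC (G x)).
Qed.

Lemma is_deriveD1 F G x a b : is_derive x 1 F a -> is_derive x 1 G b ->
  is_derive x 1 (fun t => F t + G t) (a + b).
Proof. exact: is_deriveD. Qed.

Lemma is_deriveV1 F x a : F x != 0 -> is_derive x 1 F a ->
  is_derive x 1 (fun t => (F t)^-1) (- a / F x ^+ 2).
Proof.
move=> Fx0 dF; apply: is_derive_eq (is_deriveV Fx0 dF) _.
by rewrite /GRing.scale/= mulNr mulrC mulNr.
Qed.

Lemma is_derive_cont F x a : is_derive x 1 F a -> {for x, continuous F}.
Proof.
by case=> dF _; apply: differentiable_continuous; exact/derivable1_diffP.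
Qed.

Lemma is_derive1E F x a : is_derive x 1 F a -> derive1 F x = a.
Proof. by move=> [_ <-]; rewrite derive1E. Qed.

Lemma derivable_is_derive F x : derivable F x 1 -> is_derive x 1 F (derive1 F x).
Proof. by move=> dF; rewrite derive1E; apply: DeriveDef. Qed.

Lemma is_derive_cvg F x a : is_derive x 1 F a ->
  h^-1 * (F (h + x) - F x) @[h --> 0^'] --> a.
Proof.
move=> [dF <-].
rewrite /derive; move: dF; rewrite /derivable.
have -> : (fun h => h^-1 *: ((F \o shift x) (h *: 1) - F x)) =
          (fun h => h^-1 * (F (h + x) - F x)).
  by apply/funext => h; rewrite /= /GRing.scale/= mulr1.
by [].
Qed.

Lemma is_derive_seq F x a : is_derive x 1 F a ->
  n.+1%:R * (F (x + n.+1%:R^-1) - F x) @[n --> \oo] --> a.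
Proof.
move=> /is_derive_cvg/cvgr_dnbhsP /(_ (fun n => n.+1%:R^-1)).
have H : (forall n, (n.+1%:R^-1 : R) != 0) /\ (n.+1%:R^-1 : R) @[n --> \oo] --> 0.
  by split => [n|]; [rewrite invr_eq0 pnatr_eq0|exact: cvg_harmonic].
move=> /(_ H); apply: cvg_trans; apply: near_eq_cvg; near=> n.
by rewrite invrK [x + _]addrC.
Unshelve. all: by end_near. Qed.

End derivative_rules.

(** * Lipschitz functions as primitives of bounded functions *)

Section primitives.
Context {R : realType}.
Implicit Types (a b c x y : R) (f g F G : R -> R).
Notation mu := (@lebesgue_measure R).

(** This describes a Lipschitz function together with a chosen version of its almost-everywhere
    derivative. It plays the role of the Sobolev space of functions with bounded weak derivative. *)
Definition prim a b F f : Prop := bmf a b f /\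
  forall x y, a <= x -> x <= y -> y <= b ->
    F y - F x = \int[mu]_(t in `[x, y]) f t.

Lemma prim_bmf_deriv a b F f : prim a b F f -> bmf a b f.
Proof. by case. Qed.

Lemma prim_sub a b F f i j : prim a b F f -> a <= i -> j <= b -> prim i j F f.
Proof.
move=> [bf Ff] ai jb; split; first exact: bmf_itv bf ai jb.
by move=> x y ix xy yj; rewrite Ff// (le_trans _ ix, le_trans yj).
Qed.

Lemma eq_prim a b F f G g : {in `[a, b], F =1 G} -> {in `[a, b], f =1 g} ->
  prim a b F f -> prim a b G g.
Proof.
move=> FG fg [bf Ff]; split; first exact: eq_bmf bf.
move=> x y ax xy yb; rewrite -!FG ?in_itv/= ?ax ?yb ?(le_trans xy) ?(le_trans ax)//.
rewrite Ff//; apply: eq_segI => t; rewrite in_itv/= => /andP[xt ty].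
by rewrite fg// in_itv/= (le_trans ax)//= (le_trans ty).
Qed.

Lemma prim_lipschitz a b F f : prim a b F f ->
  exists2 L : R, 0 <= L &
    forall x y, x \in `[a, b] -> y \in `[a, b] -> `|F y - F x| <= L * `|y - x|.
Proof.
move=> [bf Ff]; have [M M0 fM] := bmf_bound bf; exists M => // x y.
wlog xy : x y / x <= y.
  move=> H xab yab; have [xy|/ltW yx] := leP x y; first exact: H.
  by rewrite distrC (distrC y); exact: H.
rewrite !in_itv/= => /andP[ax xb] /andP[ay yb].
rewrite Ff// (ger0_norm (x := y - x)) ?subr_ge0//; apply: segI_norm_le => //.
  exact: bmf_itv bf ax yb.
move=> t; rewrite in_itv/= => /andP[xt ty]; apply: fM.
by rewrite in_itv/= (le_trans ax)//= (le_trans ty).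
Qed.

Lemma lipschitz_within_continuous a b F (L : R) :
  (forall x y, x \in `[a, b] -> y \in `[a, b] -> `|F y - F x| <= L * `|y - x|) ->
  {within `[a, b], continuous F}.
Proof.
move=> FL; apply/subspace_continuousP => x /= xab.
apply/cvgrPdist_le => e e0; rewrite near_withinE.
have L0 : 0 < `|L| + 1 by rewrite ltr_wpDl.
apply/nbhs_ballP; exists (e / (`|L| + 1)); first by rewrite /= divr_gt0.
move=> t /=; rewrite /ball/= => xt tab.
rewrite distrC (le_trans (FL _ _ xab tab))//.
apply: (@le_trans _ _ ((`|L| + 1) * `|t - x|)).
  by rewrite ler_wpM2r// (le_trans (ler_norm L))// lerDl.
by rewrite -ler_pdivlMl// mulrC distrC ltW.
Qed.

Lemma prim_continuous a b F f : prim a b F f -> {within `[a, b], continuous F}.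
Proof. by move=> /prim_lipschitz[L _]; exact: lipschitz_within_continuous. Qed.

Lemma prim_bmf a b F f : prim a b F f -> bmf a b F.
Proof. by move=> /prim_continuous; exact: within_continuous_bmf. Qed.

(** Near an interior point [F] is [F a] plus the integral of [f] from [a], so this is Lebesgue's
    differentiation theorem at the Lebesgue points of [f]. *)
Lemma prim_ae_derive a b F f : prim a b F f ->
  {ae mu, forall x, a < x < b -> is_derive x 1 F (f x)}.
Proof.
move=> [bf Ff]; have intf := bmf_integrable bf.
have := lebesgue_differentiation (integrable_locally (measurable_itv _) intf).
apply: ae_imp => x lx /andP[ax xb].
pose G y := \int[mu]_(t in `[a, y]) (f \_ `[a, b]) t.
have intr : mu.-integrable `[a, b] (EFin \o (f \_ `[a, b])).
  apply: eq_integrable intf => // t tab /=.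
  by rewrite patchT.
have [dG G'] := @FTC1_lebesgue_pt R (f \_ `[a, b]) (BLeft a) x b xb intr ax lx.
have {}dG : is_derive x 1 G (f x).
  have := derivable_is_derive dG; rewrite G' patchT// inE/= in_itv/=.
  by rewrite !ltW.
have : is_derive x 1 (fun y => G y + F a) (f x).
  rewrite -[f x]addr0; apply: is_deriveD1 => //; exact: is_derive_cst.
apply: near_eq_is_derive; near=> y.
have ay : a < y by near: y; exact: lt_nbhsr.
have yb : y < b by near: y; exact: lt_nbhsl.
apply/eqP; rewrite eq_sym -subr_eq; apply/eqP.
rewrite /G (Ff a y (lexx _) (ltW ay) (ltW yb)); apply: eq_Rintegral => t; rewrite inE/= in_itv/= => /andP[at_ ty].
by rewrite patchT// inE/= in_itv/= at_ (le_trans ty)// ltW.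
Unshelve. all: by end_near. Qed.

Lemma prim_C1 a b F f : (forall x, x \in `[a, b] -> is_derive x 1 F (f x)) ->
  {within `[a, b], continuous f} -> prim a b F f.
Proof.
move=> dF cf; split; first exact: within_continuous_bmf.
move=> x y ax xy yb; move: xy; rewrite le_eqVlt => /predU1P[->|xy].
  by rewrite subrr set_itv1 Rintegral_set1.
have sub t : t \in `[x, y] -> t \in `[a, b].
  by rewrite !in_itv/= => /andP[xt ty]; rewrite (le_trans ax)//= (le_trans ty).
rewrite /Rintegral (@continuous_FTC2 R f F)//.
- apply: continuous_subspaceW cf => t; exact: sub.
- have cF t : t \in `[x, y] -> {for t, continuous F}.
    by move=> /sub/dF; exact: is_derive_cont.
  split.
  + by move=> t /subset_itv_oo_cc/sub/dF[].
  + by apply: cvg_at_right_filter; apply: cF; rewrite in_itv/= lexx ltW.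
  + by apply: cvg_at_left_filter; apply: cF; rewrite in_itv/= lexx ltW.
- by move=> t /subset_itv_oo_cc/sub/dF; exact: is_derive1E.
Qed.

End primitives.

(** * Projection of the line onto a segment *)

Section clamp.
Context {R : realType}.
Implicit Types (a b x y : R).

(** Composing with this 1-Lipschitz retraction extends a function from [a, b] by its end values. It
    makes Lipschitz functions global, and it truncates solutions between two zeros. *)
Definition clamp a b x := Num.max a (Num.min x b).

Lemma clamp_in a b x : a <= b -> clamp a b x \in `[a, b].
Proof.
by move=> ab; rewrite in_itv/= /clamp le_max lexx/= ge_max ab/= ge_min lexx orbT.
Qed.

Lemma clamp_id a b x : x \in `[a, b] -> clamp a b x = x.
Proof.
rewrite in_itv/= => /andP[ax xb]; rewrite /clamp.
by rewrite min_l// max_r.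
Qed.

Lemma clamp_le a b x : a <= b -> x <= a -> clamp a b x = a.
Proof. by move=> ab xa; rewrite /clamp min_l ?(le_trans xa)// max_l. Qed.

Lemma clamp_ge a b x : a <= b -> b <= x -> clamp a b x = b.
Proof. by move=> ab bx; rewrite /clamp min_r// max_r. Qed.

Lemma clamp_homo a b x y : a <= b -> x <= y -> clamp a b x <= clamp a b y.
Proof.
move=> ab xy; rewrite /clamp ge_max le_max lexx/= le_max; apply/orP; right.
by rewrite le_min !ge_min xy lexx !orbT.
Qed.

Lemma clamp_lipschitz a b x y : a <= b ->
  `|clamp a b y - clamp a b x| <= `|y - x|.
Proof.
move=> ab; wlog xy : x y / x <= y.
  move=> H; have [xy|/ltW yx] := leP x y; first exact: H.
  by rewrite distrC (distrC y); exact: H.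
rewrite !ger0_norm ?subr_ge0 ?clamp_homo//.
have [xa|ax] := leP x a; have [yb|yb] := leP b y.
- by rewrite (clamp_le ab xa) (clamp_ge ab yb) lerB.
- rewrite (clamp_le ab xa); have [ya|ay] := leP y a.
    by rewrite (clamp_le ab ya) subrr subr_ge0.
  by rewrite clamp_id ?lerB// in_itv/= (ltW ay) ltW.
- rewrite (clamp_ge ab yb); have [bx|xb] := leP b x.
    by rewrite (clamp_ge ab bx) subrr subr_ge0.
  by rewrite clamp_id ?lerB// in_itv/= (ltW ax) ltW.
- rewrite !clamp_id// in_itv/=.
    by rewrite (ltW ax)/= (le_trans xy)// ltW.
  by rewrite (le_trans (ltW ax) xy) ltW.
Qed.

End clamp.

(** * The fundamental theorem for Lipschitz functions, and the calculus of primitives *)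

Section primitive_calculus.
Context {R : realType}.
Implicit Types (a b c x y : R) (f g F G : R -> R).
Notation mu := (@lebesgue_measure R).

Lemma lipschitz_continuous F (L : R) :
  (forall x y, `|F y - F x| <= L * `|y - x|) -> continuous F.
Proof.
move=> FL x; apply: (@within_continuous_continuous _ _ _ (x - 1) (x + 1)).
- by rewrite ltrD2l gtrN.
- by apply: (@lipschitz_within_continuous _ _ _ _ L) => *; exact: FL.
- by rewrite in_itv/= ltrBlDr ltrDl ltr01.
Qed.

(* The difference quotients of an antiderivative [Phi] of a Lipschitz [F] are
   the means of those of [F], to which dominated convergence applies. *)
Lemma lipschitz_ae_FTC a b F f (L : R) : a < b -> bmf a b f ->
  (forall x y, x \in `[a, b] -> y \in `[a, b] -> `|F y - F x| <= L * `|y - x|) ->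
  {ae mu, forall x, a < x < b -> is_derive x 1 F (f x)} ->
  F b - F a = \int[mu]_(t in `[a, b]) f t.
Proof.
move=> ab bf FL dF; have ab' := ltW ab.
have L0 : 0 <= L.
  have := FL a b; rewrite !in_itv/= !lexx ab' => /(_ isT isT) /(le_trans (normr_ge0 _)).
  by rewrite pmulr_lge0// normr_gt0 subr_eq0 gt_eqF.
pose G := F \o clamp a b.
have GL x y : `|G y - G x| <= L * `|y - x|.
  rewrite (le_trans (FL _ _ (clamp_in _ _) (clamp_in _ _)))//.
  by rewrite ler_wpM2l// clamp_lipschitz.
have cG : continuous G := lipschitz_continuous GL.
(* The integration starts at [a - 1] so that [Phi] is differentiable at [a] itself. *)
pose Phi y := \int[mu]_(t in `[a - 1, y]) G t.
have dPhi s : a - 1 < s -> is_derive s 1 Phi (G s).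
  move=> as_; have intG : mu.-integrable `[a - 1, s + 1] (EFin \o G).
    apply/bmf_integrable/within_continuous_bmf.
    exact: continuous_subspaceT.
  have ss : s < s + 1 by rewrite ltrDl.
  have [d d'] := @continuous_FTC1_closed R G (a - 1) s (s + 1) ss intG as_ (cG s).
  by rewrite -d'; exact: derivable_is_derive.
pose h n : R := n.+1%:R^-1.
have h0 n : 0 < h n by rewrite /h invr_gt0.
pose q n x := n.+1%:R * (G (x + h n) - G x).
pose Psi n x := n.+1%:R * (Phi (x + h n) - Phi x).
have cq n : continuous (q n).
  move=> x; apply: cvgM; first exact: cvg_cst.
  apply: cvgB; last exact: cG.
  apply: (@cvg_comp _ _ _ (fun x => x + h n) G _ (nbhs (x + h n))); last exact: cG.
  by apply: cvgD; [exact: cvg_id|exact: cvg_cst].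
have PP n : prim a b (Psi n) (q n).
  apply: prim_C1; last by exact: continuous_subspaceT.
  move=> x; rewrite in_itv/= => /andP[ax xb].
  have d1 : is_derive x 1 (fun t => Phi (t + h n)) (G (x + h n)).
    have ds : is_derive x 1 (fun t => t + h n) (1 : R) by exact: is_derive_shift.
    have dp : is_derive (x + h n) 1 Phi (G (x + h n)).
      by apply: dPhi; rewrite (lt_le_trans _ (lerD ax (ltW (h0 n))))// ltrD2l ltrN10 || rewrite ltrD2l; have := h0 n; lra.
    have := @is_derive1_comp R Phi (fun t => t + h n) x _ _ dp ds.
    by rewrite mulr1.
  have d2 : is_derive x 1 Phi (G x) by apply: dPhi; lra.
  have := is_deriveZ n.+1%:R (is_deriveB d1 d2).
  by [].
have cvI : \int[mu]_(t in `[a, b]) q n t @[n --> \oo] -->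
           \int[mu]_(t in `[a, b]) f t.
  apply: (@segI_dominated _ _ _ _ _ L) => //.
  - by move=> n; case: (PP n) => -[].
  - move=> n x _; rewrite normrM ger0_norm//.
    rewrite -ler_pdivlMl ?ltr0n// (le_trans (GL _ _))//.
    by rewrite addrC addKr ger0_norm ?(ltW (h0 n))// mulrC.
  - apply: ae_imp dF => x H axb; apply: is_derive_seq.
    apply: near_eq_is_derive (H axb); case/andP: axb => ax xb.
    near=> y; rewrite /G/= clamp_id// in_itv/=; apply/andP; split; apply: ltW.
      by near: y; exact: lt_nbhsr.
    by near: y; exact: lt_nbhsl.
have cvE : \int[mu]_(t in `[a, b]) q n t @[n --> \oo] --> F b - F a.
  have -> : (fun n => \int[mu]_(t in `[a, b]) q n t) = (fun n => Psi n b - Psi n a).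
    apply/funext => n; have [_ H] := PP n.
    exact/esym/(H a b (lexx _) ab' (lexx _)).
  have -> : F b - F a = G b - G a.
    by rewrite /G/= !clamp_id// in_itv/= lexx ab'.
  apply: cvgB; apply: is_derive_seq; apply: dPhi; lra.
exact: (cvg_unique _ cvE cvI).
Unshelve. all: by end_near. Qed.

(** Converse of [prim_lipschitz] and [prim_ae_derive] together. It reduces the product, quotient and
    truncation rules to a Lipschitz estimate and a pointwise derivative off a null set. *)
Lemma prim_lipschitz_ae a b F f (L : R) : bmf a b f ->
  (forall x y, x \in `[a, b] -> y \in `[a, b] -> `|F y - F x| <= L * `|y - x|) ->
  {ae mu, forall x, a < x < b -> is_derive x 1 F (f x)} -> prim a b F f.
Proof.
move=> bf FL dF; split => // x y ax; rewrite le_eqVlt => /predU1P[-> _|xy yb].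
  by rewrite subrr set_itv1 Rintegral_set1.
have sub t : t \in `[x, y] -> t \in `[a, b].
  by rewrite !in_itv/= => /andP[xt ty]; rewrite (le_trans ax)//= (le_trans ty).
apply: (@lipschitz_ae_FTC _ _ _ _ L) => //.
- exact: bmf_itv bf ax yb.
- by move=> s t /sub ? /sub; exact: FL.
- apply: ae_imp dF => t H /andP[xt ty]; apply: H.
  by rewrite (le_lt_trans ax)//= (lt_le_trans ty).
Qed.

Lemma prim_cst a b k : prim a b (cst k) (cst 0).
Proof.
split; first exact: bmf_cst.
by move=> x y _ xy _; rewrite subrr segI_cst// mul0r.
Qed.

Lemma primD a b F f G g : prim a b F f -> prim a b G g ->
  prim a b (fun x => F x + G x) (fun x => f x + g x).
Proof.
move=> [bf Ff] [bg Gg]; split; first exact: bmfD.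
move=> x y ax xy yb; rewrite segID; [|exact: bmf_itv bf ax yb|exact: bmf_itv bg ax yb].
by rewrite -Ff// -Gg//; ring.
Qed.

Lemma primM a b F f G g : prim a b F f -> prim a b G g ->
  prim a b (fun x => F x * G x) (fun x => f x * G x + F x * g x).
Proof.
move=> PF PG.
have [L L0 FL] := prim_lipschitz PF; have [K K0 GK] := prim_lipschitz PG.
have [M M0 FM] := bmf_bound (prim_bmf PF); have [N N0 GN] := bmf_bound (prim_bmf PG).
have bf := prim_bmf_deriv PF; have bg := prim_bmf_deriv PG.
apply: (@prim_lipschitz_ae _ _ _ _ (L * N + M * K)).
- by apply: bmfD; apply: bmfM => //; [exact: (prim_bmf PG)|exact: (prim_bmf PF)].
- move=> x y xab yab.
  have -> : F y * G y - F x * G x = (F y - F x) * G y + F x * (G y - G x) by ring.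
  rewrite (le_trans (ler_normD _ _))// !normrM mulrDl lerD//.
    by rewrite mulrAC ler_pM// ?FL ?GN.
  by rewrite -mulrA ler_pM// ?FM ?GK.
- apply: ae_imp (ae_and (prim_ae_derive PF) (prim_ae_derive PG)) => x [dF dG] axb.
  exact: is_deriveM1 (dF axb) (dG axb).
Qed.

Lemma primZ a b F f k : prim a b F f -> prim a b (fun x => k * F x) (fun x => k * f x).
Proof.
move=> PF; apply: eq_prim (primM (prim_cst a b k) PF) => // x _.
by rewrite mul0r add0r.
Qed.

Lemma primN a b F f : prim a b F f -> prim a b (fun x => - F x) (fun x => - f x).
Proof. by move=> /(primZ (-1)); apply: eq_prim => x _; rewrite mulN1r. Qed.

Lemma primB a b F f G g : prim a b F f -> prim a b G g ->
  prim a b (fun x => F x - G x) (fun x => f x - g x).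
Proof. by move=> PF /primN; exact: primD. Qed.

Lemma prim_gt0_lb a b F : {within `[a, b], continuous F} ->
  (forall x, x \in `[a, b] -> 0 < F x) ->
  exists2 d : R, 0 < d & forall x, x \in `[a, b] -> d <= F x.
Proof.
move=> cF F0; have [ab|ba] := leP a b; last first.
  by exists 1 => // x; rewrite in_itv/= => /andP[ax /(le_trans ax)]; rewrite leNgt ba.
have [c cab Fc] := EVT_min ab cF.
by exists (F c); [exact: F0|move=> x xab; exact: Fc].
Qed.

Lemma bmfV a b F : {within `[a, b], continuous F} ->
  (forall x, x \in `[a, b] -> 0 < F x) -> bmf a b (fun x => (F x)^-1).
Proof.
move=> cF F0; apply: within_continuous_bmf => x.
have [d d0 Fd] := prim_gt0_lb cF F0.
move: x; apply/subspace_continuousP => x xab.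
apply: cvgV; first by rewrite gt_eqF// F0.
by move/subspace_continuousP : cF; apply.
Qed.

Lemma primV a b F f : prim a b F f -> (forall x, x \in `[a, b] -> 0 < F x) ->
  prim a b (fun x => (F x)^-1) (fun x => - f x / F x ^+ 2).
Proof.
move=> PF F0; have [L L0 FL] := prim_lipschitz PF.
have cF := prim_continuous PF.
have [d d0 Fd] := prim_gt0_lb cF F0.
have bV := bmfV cF F0.
apply: (@prim_lipschitz_ae _ _ _ _ (L / d ^+ 2)).
- have := bmfM (bmfN (prim_bmf_deriv PF)) (bmfM bV bV).
  by apply: eq_bmf => x _; rewrite expr2 invfM.
- move=> x y xab yab; have Fx := F0 _ xab; have Fy := F0 _ yab.
  have -> : (F y)^-1 - (F x)^-1 = (F x - F y) * ((F x)^-1 * (F y)^-1).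
    by field; rewrite !gt_eqF.
  rewrite normrM distrC mulrAC ler_pM// ?FL//.
  rewrite ger0_norm ?mulr_ge0 ?invr_ge0 ?(ltW Fx) ?(ltW Fy)//.
  by rewrite expr2 invfM ler_pM// ?invr_ge0 ?(ltW Fx) ?(ltW Fy)// lef_pV2// Fd.
- apply: ae_imp (prim_ae_derive PF) => x dF /andP[ax xb].
  apply: is_deriveV1; last by apply: dF; rewrite ax.
  by rewrite gt_eqF// F0// in_itv/= !ltW.
Qed.

Lemma prim_clamp a b F f i j : a <= b -> i <= a -> b <= j -> prim a b F f ->
  prim i j (F \o clamp a b) (f \_ `[a, b]).
Proof.
move=> ab ia bj PF; have [L L0 FL] := prim_lipschitz PF.
have [mf [M fM]] := prim_bmf_deriv PF.
have nea k : {ae mu, forall x, x != k}.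
  exists [set k]; split => //; first exact: lebesgue_measure_set1.
  by move=> x /= /negP; rewrite negbK => /eqP.
apply: (@prim_lipschitz_ae _ _ _ _ L).
- split.
    apply: (measurable_funS measurableT (@subsetT _ _)).
    exact/(measurable_restrictT _ _).1.
  exists `|M| => x _; rewrite patchE; case: ifPn => [|_]; last by rewrite normr0.
  by rewrite inE/= => /fM H; rewrite (le_trans H)// ler_norm.
- move=> x y _ _; rewrite /= (le_trans (FL _ _ (clamp_in _ _) (clamp_in _ _)))//.
  by rewrite ler_wpM2l// clamp_lipschitz.
(* The possible corners of the truncation, at [a] and [b], are put into the null set. *)
- apply: ae_imp (ae_and (ae_and (nea a) (nea b)) (prim_ae_derive PF)) => x [[xa xb] dF] ixj.
  have cstd k : (\forall y \near x, k = (F \o clamp a b) y) ->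
      x \notin `[a, b] -> is_derive x 1 (F \o clamp a b) ((f \_ `[a, b]) x).
    move=> H xab; rewrite patchE ifF; last by apply/negbTE; rewrite notin_setE/=; apply/negP.
    by apply: near_eq_is_derive H _; exact: is_derive_cst.
  have [xa'|ax|/eqP] := ltgtP x a; last by rewrite (negbTE xa).
    apply: (cstd (F a)); last by rewrite in_itv/= leNgt xa'.
    near=> y; rewrite /= clamp_le// ltW//; near: y; exact: lt_nbhsl.
  have [xb'|bx|/eqP] := ltgtP x b; last by rewrite (negbTE xb).
    rewrite patchT; last by rewrite inE/= in_itv/= !ltW.
    apply: near_eq_is_derive (dF _); last by rewrite ax.
    near=> y; rewrite /= clamp_id// in_itv/=; apply/andP; split; apply: ltW.
      by near: y; exact: lt_nbhsr.
    by near: y; exact: lt_nbhsl.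
  apply: (cstd (F b)); last by rewrite in_itv/= (leNgt x) bx andbF.
  near=> y; rewrite /= clamp_ge// ltW//; near: y; exact: lt_nbhsr.
Unshelve. all: by end_near. Qed.

Lemma prim_id a b : prim a b (fun x => x) (cst 1).
Proof.
by apply: prim_C1; apply: continuous_subspaceT => x; exact: cvg_cst.
Qed.

Lemma prim_ftc a b F f : a <= b -> prim a b F f ->
  \int[mu]_(t in `[a, b]) f t = F b - F a.
Proof. by move=> ab [_ ->]. Qed.

End primitive_calculus.

(** * Smooth functions and bump functions *)

Section smooth_functions.
Context {R : realType}.
Implicit Types (f g : R -> R) (x : R).

Definition smooth f := forall n x, derivable (derive1n n f) x 1.

(* A form of smoothness suited to induction: the outer derivative is peeled off
   first, contrary to [derive1n]. *)
Fixpoint Ck k f : Prop :=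
  if k is k'.+1 then (forall x, derivable f x 1) /\ Ck k' (derive1 f) else True.

Lemma smoothP f : smooth f <-> forall k, Ck k f.
Proof.
split=> [sf k|Cf n].
  elim: k f sf => [//|k ih] f sf /=; split; first exact: (sf 0%N).
  by apply: ih => n x; have := sf n.+1 x; rewrite /derive1n iterSr.
elim: n f Cf => [f Cf x|n ih f Cf x]; first by have [] := Cf 1%N.
rewrite /derive1n iterSr; apply: ih => k.
by have [] := Cf k.+1.
Qed.

Lemma CkW k f : Ck k.+1 f -> Ck k f.
Proof. by elim: k f => [//|k ih] f [df Cf]; split => //; exact: ih. Qed.

Lemma Ck_cst k (c : R) : Ck k (cst c).
Proof.
elim: k c => [//|k ih] c /=; split=> [x|]; first exact: derivable_cst.
suff -> : derive1 (cst c : R -> R) = cst 0 by exact: ih.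
by apply/funext => x; rewrite derive1_cst.
Qed.

Lemma CkD k f g : Ck k f -> Ck k g -> Ck k (fun x => f x + g x).
Proof.
elim: k f g => [//|k ih] f g /= [df Cf] [dg Cg].
have d x : is_derive x 1 (fun x => f x + g x) (derive1 f x + derive1 g x).
  by apply: is_deriveD1; exact: derivable_is_derive.
split=> [x|]; first by have [] := d x.
suff -> : derive1 (fun x => f x + g x) = fun x => derive1 f x + derive1 g x.
  exact: ih.
by apply/funext => x; exact: is_derive1E.
Qed.

Lemma CkM k f g : Ck k f -> Ck k g -> Ck k (fun x => f x * g x).
Proof.
elim: k f g => [//|k ih] f g Cf Cg.
have CfW := CkW Cf; have CgW := CkW Cg.
case: Cf Cg => [df Cf] [dg Cg].
have d x : is_derive x 1 (fun x => f x * g x) (derive1 f x * g x + f x * derive1 g x).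
  by apply: is_deriveM1; exact: derivable_is_derive.
split=> [x|]; first by have [] := d x.
suff -> : derive1 (fun x => f x * g x) =
    fun x => derive1 f x * g x + f x * derive1 g x.
  by apply: CkD; exact: ih.
by apply/funext => x; exact: is_derive1E.
Qed.

Lemma CkZ k (c : R) f : Ck k f -> Ck k (fun x => c * f x).
Proof. by move=> Cf; apply: CkM => //; exact: Ck_cst. Qed.

Lemma is_derive_affine f (c d x : R) : derivable f (c * x + d) 1 ->
  is_derive x 1 (fun t => f (c * t + d)) (c * derive1 f (c * x + d)).
Proof.
move=> df; have d1 : is_derive x 1 (fun t => c * t + d) (c : R).
  have h := is_deriveD1 (is_deriveM1 (is_derive_cst c x (1:R)) (is_derive_id x (1:R)))
    (is_derive_cst d x (1:R)).
  by apply: is_derive_eq h _; rewrite mul0r add0r mulr1 addr0.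
rewrite [X in is_derive _ _ _ X]mulrC.
exact: (@is_derive1_comp R f (fun t => c * t + d) x _ _ (derivable_is_derive df) d1).
Qed.

Lemma Ck_affine k f (c d : R) : Ck k f -> Ck k (fun x => f (c * x + d)).
Proof.
elim: k f => [//|k ih] f [df Cf].
have D x := is_derive_affine (df (c * x + d)).
split=> [x|]; first by have [] := D x.
have -> : derive1 (fun x => f (c * x + d)) = fun x => c * derive1 f (c * x + d).
  by apply/funext => x; exact: is_derive1E.
by apply/CkZ/ih.
Qed.

Lemma smoothD f g : smooth f -> smooth g -> smooth (fun x => f x + g x).
Proof. by move=> /smoothP sf /smoothP sg; apply/smoothP => k; exact: CkD. Qed.

Lemma smoothM f g : smooth f -> smooth g -> smooth (fun x => f x * g x).
Proof. by move=> /smoothP sf /smoothP sg; apply/smoothP => k; exact: CkM. Qed.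

Lemma smoothZ (c : R) f : smooth f -> smooth (fun x => c * f x).
Proof. by move=> /smoothP sf; apply/smoothP => k; exact: CkZ. Qed.

Lemma smooth_affine f (c d : R) : smooth f -> smooth (fun x => f (c * x + d)).
Proof. by move=> /smoothP sf; apply/smoothP => k; exact: Ck_affine. Qed.

Lemma smooth_derive1 f : smooth f -> smooth (derive1 f).
Proof. by move=> /smoothP sf; apply/smoothP => k; have [] := sf k.+1. Qed.

Lemma smooth_is_derive f x : smooth f -> is_derive x 1 f (derive1 f x).
Proof. by move=> sf; apply: derivable_is_derive; exact: (sf 0%N). Qed.

Lemma smooth_continuous f : smooth f -> continuous f.
Proof. by move=> sf x; exact: is_derive_cont (smooth_is_derive x sf). Qed.

Lemma smooth_antiderive f g : smooth g -> (forall x, is_derive x 1 f (g x)) ->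
  smooth f.
Proof.
move=> /smoothP sg df; apply/smoothP => -[//|k]; split=> [x|].
  by have [] := df x.
suff -> : derive1 f = g by exact: sg.
by apply/funext => x; exact: is_derive1E.
Qed.

Lemma smooth_bmf f a b : smooth f -> bmf a b f.
Proof.
move=> sf; apply: within_continuous_bmf; apply: continuous_subspaceT.
exact: smooth_continuous.
Qed.

Lemma smooth_prim f a b : smooth f -> prim a b f (derive1 f).
Proof.
move=> sf; apply: prim_C1 => [x _|]; first exact: smooth_is_derive.
by apply: continuous_subspaceT; apply: smooth_continuous; exact: smooth_derive1.
Qed.

Lemma is_deriveX1 f x a k : is_derive x 1 f a ->
  is_derive x 1 (fun t => f t ^+ k) (k%:R * f x ^+ k.-1 * a).
Proof.
move=> df; have := is_deriveX k df.
have -> : f ^+ k = (fun t => f t ^+ k) by apply/funext => t; rewrite exprfctE.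
by [].
Qed.

(** The exponent [k] is carried along because the linear span of these functions is closed under
    differentiation ([is_derive_flat]), which yields smoothness of all of them by induction. *)
Definition flat k x : R := if 0 < x then (x^-1) ^+ k * expR (- x^-1) else 0.

Lemma flat_ge0 k x : 0 <= flat k x.
Proof.
rewrite /flat; case: ifPn => // x0.
by rewrite mulr_ge0 ?expR_ge0// exprn_ge0// invr_ge0 ltW.
Qed.

(** With s = 1 / x, the exponential series gives s^(k+2) / (k+2)! <= exp s. The quadratic bound is
    what makes the derivative at 0 exist and vanish. *)
Lemma flat_le_sqr k x : `|flat k x| <= (k.+2)`!%:R * x ^+ 2.
Proof.
rewrite ger0_norm ?flat_ge0// /flat; case: ifPn => x0; last first.
  by rewrite mulr_ge0 ?sqr_ge0.
have s0 : 0 < x^-1 by rewrite invr_gt0.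
have H : x^-1 ^+ k.+2 / (k.+2)`!%:R <= expR x^-1.
  by rewrite (le_trans _ (expR_ge1Dxn k.+1 (ltW s0)))// lerDr.
rewrite expRN ler_pdivrMr ?expR_gt0//.
rewrite ler_pdivrMr ?ltr0n ?fact_gt0// in H.
apply: (@le_trans _ _ (x ^+ 2 * x^-1 ^+ k.+2)).
  have -> // : x ^+ 2 * x^-1 ^+ k.+2 = x^-1 ^+ k.
  by rewrite !exprS; set e := x^-1 ^+ k; field; rewrite gt_eqF.
have -> : (k.+2)`!%:R * x ^+ 2 * expR x^-1 = x ^+ 2 * (expR x^-1 * (k.+2)`!%:R) by ring.
by rewrite ler_wpM2l ?sqr_ge0.
Qed.

Lemma is_derive_flat k x : is_derive x 1 (flat k) (flat k.+2 x - k%:R * flat k.+1 x).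
Proof.
have [x0|x0|->] := ltgtP x 0.
- rewrite /flat ltNge (ltW x0)/= mulr0 subrr.
  apply: near_eq_is_derive (is_derive_cst (0 : R) x (1 : R)).
  near=> y; rewrite ltNge ifF//; apply/negbTE; rewrite negbK ltW//.
  by near: y; exact: lt_nbhsl.
- pose g t : R := (t^-1) ^+ k * expR (- t^-1).
  apply: (@near_eq_is_derive _ _ _ g).
    near=> y; rewrite /flat ifT//.
    by near: y; exact: lt_nbhsr.
  have dV : is_derive x 1 (fun t : R => t^-1) (- x^-1 ^+ 2).
    have xn0 : x != 0 by rewrite gt_eqF.
    apply: is_derive_eq (@is_deriveV1 R (fun t => t) x 1 xn0 (is_derive_id x (1:R))) _.
    by rewrite mulN1r exprVn.
  have dX := is_deriveX1 k dV.
  have dE : is_derive x 1 (fun t : R => expR (- t^-1)) (expR (- x^-1) * (x^-1 ^+ 2)).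
    have dN : is_derive x 1 (fun t : R => - t^-1) (x^-1 ^+ 2).
      by apply: is_derive_eq (is_deriveN dV) _; rewrite opprK.
    exact: (@is_derive1_comp R expR (fun t => - t^-1) x _ _ (is_derive_expR (- x^-1)) dN).
  apply: is_derive_eq (is_deriveM1 dX dE) _.
  rewrite /flat x0 /GRing.scale/=.
  case: (k) => [|j]; first by rewrite !mul0r expr0; ring.
  by rewrite /= !exprS; ring.
- have -> : flat k.+2 0 - k%:R * flat k.+1 0 = 0 by rewrite /flat ltxx mulr0 subrr.
  have F0 : flat k 0 = 0 by rewrite /flat ltxx.
  apply/is_derive1_caratheodory; exists (fun z => flat k z / z); split.
  + move=> z; rewrite F0 !subr0; have [->|z0] := eqVneq z 0.
      by rewrite F0 mulr0.
    by rewrite divfK.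
  + rewrite /prop_for /continuous_at /= F0 mul0r; apply/cvgr0Pnorm_le => e e0.
    have C0 : 0 < (k.+2)`!%:R :> R by rewrite ltr0n fact_gt0.
    apply/nbhs_ballP; exists (e / (k.+2)`!%:R); first by rewrite /= divr_gt0.
    move=> z /=; rewrite /ball/= sub0r normrN => ze.
    have [->|z0] := eqVneq z 0; first by rewrite F0 mul0r normr0 ltW.
    rewrite normrM normfV ler_pdivrMr ?normr_gt0//.
    rewrite (le_trans (flat_le_sqr _ _))// expr2 -[z * z]ger0_norm -?expr2 ?sqr_ge0//.
    rewrite normrX expr2 mulrA ler_wpM2r// -ler_pdivlMl// mulrC ltW//.
  + by rewrite F0 mul0r.
Unshelve. all: by end_near. Qed.

Lemma Ck_flat n k : Ck n (flat k).
Proof.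
elim: n k => [//|n ih] k /=; split=> [x|]; first by have [] := is_derive_flat k x.
have -> : derive1 (flat k) = fun x => flat k.+2 x + - k%:R * flat k.+1 x.
  apply/funext => x; rewrite mulNr; exact/is_derive1E/is_derive_flat.
by apply: CkD => //; exact: CkZ.
Qed.

Lemma flat0_le1 x : flat 0 x <= 1.
Proof.
rewrite /flat; case: ifPn => [x0|_]; last exact: ler01.
by rewrite expr0 mul1r expR_le1 oppr_le0 invr_ge0 ltW.
Qed.

(** The scale [n] only steepens the edges: the support stays in [a, b] while the values approach 1
    inside, so indicators of open intervals are bounded limits of test functions. *)
Definition bump n a b x : R := flat 0 (n * (x - a)) * flat 0 (n * (b - x)).

Lemma smooth_bump n a b : smooth (bump n a b).
Proof.
rewrite /bump; apply: smoothM.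
  have -> : (fun x => flat 0 (n * (x - a))) = fun x => flat 0 (n * x + n * - a).
    by apply/funext => x; rewrite mulrDr.
  by apply: (@smooth_affine (flat 0)); apply/smoothP => k; exact: Ck_flat.
have -> : (fun x => flat 0 (n * (b - x))) = fun x => flat 0 (- n * x + n * b).
  by apply/funext => x; congr flat; ring.
by apply: (@smooth_affine (flat 0)); apply/smoothP => k; exact: Ck_flat.
Qed.

Lemma bump_ge0 n a b x : 0 <= bump n a b x.
Proof. by rewrite mulr_ge0 ?flat_ge0. Qed.

Lemma bump_le1 n a b x : bump n a b x <= 1.
Proof. by rewrite /bump mulr_ile1 ?flat_ge0 ?flat0_le1. Qed.

Lemma bump_out n a b x : 0 <= n -> x \notin `]a, b[ -> bump n a b x = 0.
Proof.
move=> n0; rewrite in_itv/= negb_and -!leNgt => /orP[xa|bx].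
  by rewrite /bump /flat ifF ?mul0r//; apply/negbTE; rewrite -leNgt mulr_ge0_le0// subr_le0.
by rewrite /bump mulrC /flat ifF ?mul0r//; apply/negbTE; rewrite -leNgt mulr_ge0_le0// subr_le0.
Qed.

Lemma bump_gt0 n a b x : 0 < n -> x \in `]a, b[ -> 0 < bump n a b x.
Proof.
rewrite in_itv/= => n0 /andP[ax xb]; rewrite /bump /flat.
by rewrite !ifT ?mulr_gt0 ?subr_gt0 ?expR_gt0.
Qed.

Lemma bump_cvg a b x :
  bump n.+1%:R a b x @[n --> \oo] --> (\1_`]a, b[ x : R).
Proof.
rewrite indicE; case: (boolP (x \in `]a, b[%classic)) => [|xab]; last first.
  apply: cvg_near_cst; near=> n; rewrite bump_out//.
  by apply/negP => h; move/negP : xab; apply; exact: mem_set.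
rewrite inE/= in_itv/= => /andP[ax xb].
have flat1 y : 0 < y -> flat 0 (n.+1%:R * y) @[n --> \oo] --> (1 : R).
  move=> y0.
  have -> : (fun n => flat 0 (n.+1%:R * y)) = fun n => expR (- (y^-1 * n.+1%:R^-1)).
    by apply/funext => n; rewrite /flat ifT ?mulr_gt0// expr0 mul1r invfM mulrC.
  have h : - (y^-1 * n.+1%:R^-1) @[n --> \oo] --> (0 : R).
    rewrite -[X in _ --> X]oppr0 -[X in - X](mulr0 y^-1).
    by apply: cvgN; apply: cvgM; [exact: cvg_cst|exact: cvg_harmonic].
  by have := cvg_comp _ _ h (@continuous_expR R 0); rewrite expR0.
have -> : true%:R = 1 * 1 :> R by rewrite mulr1.
by apply: cvgM; apply: flat1; rewrite subr_gt0.
Unshelve. all: by end_near. Qed.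

End smooth_functions.

(** * Test functions: supports, antiderivatives, and bumps of unit mass *)

Section test_functions.
Context {R : realType}.
Implicit Types (I : set R) (f g h phi psi : R -> R) (a b x : R).
Notation mu := (@lebesgue_measure R).

Lemma supported_test_function I f a b : smooth f ->
  (forall x, x \notin `[a, b] -> f x = 0) -> `[a, b]%classic `<=` I ->
  test_function I f.
Proof.
move=> sf f0 abI.
have sub : closure [set x | f x != 0] `<=` `[a, b]%classic.
  have cl : closed (`[a, b]%classic : set R) by exact: itv_closed.
  rewrite (closure_id `[a, b]%classic).1//; apply: closureS => x /=.
  by apply: contraNT => xab; rewrite f0.
split=> //; last by apply: subset_trans sub abI.
apply: (subclosed_compact _ (@segment_compact R a b) sub).
exact: closed_closure.
Qed.

Lemma open_itv_around I x : open I -> I x -> exists2 e : R, 0 < e &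
  `[x - e, x + e]%classic `<=` I.
Proof.
move=> oI Ix; have /nbhs_ballP[e /= e0 eI] : nbhs x I by exact: open_nbhs_nbhs.
exists (e / 2); first by rewrite divr_gt0.
move=> y; rewrite /= in_itv/= => /andP[y1 y2]; apply: eI; rewrite /ball/=.
by rewrite ltr_norml; apply/andP; split; lra.
Qed.

Lemma itv_subset I x y : is_interval I -> I x -> I y -> `[x, y]%classic `<=` I.
Proof. by move=> iI Ix Iy z; rewrite /= in_itv/=; exact: (iI x y). Qed.

Lemma compact_subset_segment I (K : set R) x : open I -> is_interval I ->
  compact K -> K `<=` I -> I x ->
  exists a b, [/\ a < x < b, `[a, b]%classic `<=` I & K `<=` `]a, b[%classic].
Proof.
(* Adjoining [x] makes the compact set nonempty, so that its extrema exist, and places [x] strictly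
   between the endpoints obtained by moving those extrema outwards inside I. *)
move=> oI iI cK KI Ix; pose K' := K `|` [set x].
have cK' : compact K' by apply: compactU => //; exact: compact_set1.
have K'0 : K' !=set0 by exists x; right.
have cid : {within K', continuous (@idfun R)}.
  by apply: continuous_subspaceT => y; exact: cvg_id.
have K'I : K' `<=` I by move=> y [/KI//|->].
have [c /set_mem cK1 cmax] := compact_EVT_max K'0 cK' cid.
have [d /set_mem dK1 dmin] := compact_EVT_min K'0 cK' cid.
have [e e0 eI] := open_itv_around oI (K'I _ cK1).
have [e' e'0 e'I] := open_itv_around oI (K'I _ dK1).
have Kcd y : K' y -> d - e' < y < c + e.
  move=> K'y; have := cmax y (mem_set K'y); have := dmin y (mem_set K'y).
  by rewrite /= => dy yc; lra.
exists (d - e'), (c + e); split.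
- by apply: Kcd; right.
- apply: itv_subset => //; [apply: e'I|apply: eI]; rewrite /= in_itv/=; lra.
- by move=> y Ky; rewrite /= in_itv/=; apply: Kcd; left.
Qed.

Lemma test_function_support I f x : open I -> is_interval I -> I x ->
  test_function I f -> exists a b, [/\ a < x < b, `[a, b]%classic `<=` I &
    forall y, y \notin `]a, b[ -> f y = 0 /\ derive1 f y = 0].
Proof.
move=> oI iI Ix [sf cf cI].
have [a [b [axb abI Kab]]] := compact_subset_segment oI iI cf cI Ix.
exists a, b; split=> // y yab.
have ycl : ~ closure [set x | f x != 0] y by move=> /Kab; exact/negP.
have nf : \forall z \near y, 0 = f z.
  have : open (~` closure [set x | f x != 0]) by apply: closed_openC; exact: closed_closure.
  move=> op; have : nbhs y (~` closure [set x | f x != 0]) by exact: open_nbhs_nbhs.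
  apply: filterS => z /= zcl; apply: contra_notP zcl => /eqP fz.
  by apply: subset_closure; rewrite /= eq_sym.
split; first by rewrite -(nbhs_singleton nf).
apply: is_derive1E; apply: near_eq_is_derive nf _; exact: is_derive_cst.
Qed.

Lemma Rintegral_support d (T : measurableType d) (m : {measure set T -> \bar R})
    (D E : set T) (f : T -> R) : D `<=` E -> (forall y : T, E y -> ~ D y -> f y = 0) ->
  \int[m]_(y in E) f y = \int[m]_(y in D) f y.
Proof.
move=> DE f0; rewrite Rintegral_mkcond [RHS]Rintegral_mkcond.
congr (Rintegral _ _ _); apply/funext => x; rewrite !patchE.
have [xD|xD] := boolP (x \in D).
  by rewrite ifT//; apply/mem_set/DE/set_mem.
by case: ifPn => // /set_mem xE; rewrite f0// => xD'; move/negP : xD; apply; exact: mem_set.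
Qed.

Lemma Rintegral_segment (m : {measure set (measurableTypeR R) -> \bar R}) I a b f :
  `[a, b]%classic `<=` I -> (forall x, x \notin `[a, b] -> f x = 0) ->
  \int[m]_(x in I) f x = \int[m]_(x in `[a, b]) f x.
Proof.
by move=> abI f0; apply: Rintegral_support => // x _ xab; apply: f0; exact/negP.
Qed.

Lemma smooth_primitive psi a b : a <= b -> smooth psi ->
  (forall x, x \notin `[a, b] -> psi x = 0) ->
  exists phi, [/\ smooth phi, derive1 phi = psi, forall x, x < a -> phi x = 0 &
    forall x, b < x -> phi x = \int[mu]_(t in `[a, b]) psi t].
Proof.
move=> ab sp p0.
(* Starting at [a - 1] rather than [a] makes the fundamental theorem available at [a]. *)
pose phi x := \int[mu]_(t in `[a - 1, x]) psi t.
have ph0 x : x < a -> phi x = 0.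
  move=> xa; rewrite /phi; transitivity (\int[mu]_(t in `[a - 1, x]) (0 : R)).
    apply: eq_segI => t; rewrite in_itv/= => /andP[_ tx]; apply: p0.
    by rewrite in_itv/= (leNgt a) (le_lt_trans tx).
  have [ax|xa1] := leP (a - 1) x; first by rewrite segI_cst// mul0r.
  by rewrite set_itv_ge ?Rintegral_set0// bnd_simp -ltNge.
have dphi x : is_derive x 1 phi (psi x).
  have [xa|ax] := ltP x a.
    rewrite p0; last by rewrite in_itv/= (leNgt a) xa.
    apply: near_eq_is_derive (is_derive_cst (0 : R) x (1 : R)).
    near=> y; rewrite ph0//; near: y; exact: lt_nbhsl.
  have xx : x < x + 1 by rewrite ltrDl.
  have a1 : a - 1 < x by lra.
  have [d <-] := @continuous_FTC1_closed R psi (a - 1) x (x + 1) xx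
    (bmf_integrable (smooth_bmf _ _ sp)) a1 (smooth_continuous sp (x:=x)).
  exact: derivable_is_derive.
exists phi; split => //.
- exact: smooth_antiderive sp dphi.
- by apply/funext => x; exact: is_derive1E.
move=> x bx; apply: (Rintegral_segment mu).
  by apply: subset_itvScc; rewrite bnd_simp; lra.
exact: p0.
Unshelve. all: by end_near. Qed.

Lemma smooth_antiderivative psi a b : a <= b -> smooth psi ->
  (forall x, x \notin `[a, b] -> psi x = 0) ->
  \int[mu]_(t in `[a, b]) psi t = 0 ->
  exists2 phi, smooth phi /\ (forall x, x \notin `[a, b] -> phi x = 0) &
    derive1 phi = psi.
Proof.
move=> ab sp p0 ip0; have [phi [sphi dphi phia phib]] := smooth_primitive ab sp p0.
exists phi => //; split => // x.
by rewrite in_itv/= negb_and -!ltNge => /orP[/phia//|/phib ->].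
Qed.

Lemma integrable_bmfM a b h g : mu.-integrable `[a, b] (EFin \o h) ->
  bmf a b g -> mu.-integrable `[a, b] (EFin \o (fun x => h x * g x)).
Proof.
move=> ih [mg [M gM]].
have bg : [bounded g x | x in `[a, b]%classic].
  exists M; split; first exact: num_real.
  by move=> N MN x /= xab; rewrite (le_trans (gM _ xab))// ltW.
by apply: eq_integrable (integrableMl _ ih mg bg) => // x _ /=; rewrite EFinM.
Qed.

Lemma segI_dominated_pt (fn : nat -> R -> R) f g a b :
  (forall n, measurable_fun `[a, b] (fn n)) ->
  mu.-integrable `[a, b] (EFin \o g) ->
  (forall n x, x \in `[a, b] -> `|fn n x| <= g x) ->
  (forall x, x \in `[a, b] -> fn n x @[n --> \oo] --> f x) ->
  \int[mu]_(t in `[a, b]) fn n t @[n --> \oo] --> \int[mu]_(t in `[a, b]) f t.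
Proof.
move=> mfn ig fng cv.
have mf : measurable_fun `[a, b] f.
  by apply: measurable_fun_cvg mfn _ => // x xab; exact: cv.
have h1 n : measurable_fun `[a, b] (fun x => (fn n x)%:E).
  exact/measurable_EFinP.
have h2 : measurable_fun `[a, b] (EFin \o f) by exact/measurable_EFinP.
have h3 : {ae mu, forall x, `[a, b]%classic x ->
    (fn n x)%:E @[n --> \oo] --> (EFin \o f) x}.
  by apply: aeW => x xab; apply: cvg_EFin; [exact: nearW|exact: cv].
have h5 : {ae mu, forall x n, `[a, b]%classic x -> (`|(fn n x)%:E| <= (EFin \o g) x)%E}.
  by apply: aeW => x n xab; rewrite lee_fin; apply: fng.
have [i1 _ cvI] := @dominated_convergence _ _ _ mu _ (measurable_itv _) _ _ _ h1 h2 h3 ig h5.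
by apply: fine_cvg; rewrite fineK//; exact: integrable_fin_num.
Qed.

(** The indefinite integral of [h] vanishes identically, and [h] is its derivative at every Lebesgue
    point. *)
Lemma ae_eq0_of_segI h a b : mu.-integrable `[a, b] (EFin \o h) ->
  (forall x, x \in `[a, b] -> \int[mu]_(t in `[a, x]) h t = 0) ->
  {ae mu, forall x, a < x < b -> h x = 0}.
Proof.
move=> ih h0.
have := lebesgue_differentiation (integrable_locally (measurable_itv _) ih).
apply: ae_imp => x lx /andP[ax xb].
have ir : mu.-integrable `[a, b] (EFin \o (h \_ `[a, b])).
  by apply: eq_integrable ih => // t tab /=; rewrite patchT.
have [dG G'] := @FTC1_lebesgue_pt R (h \_ `[a, b]) (BLeft a) x b xb ir ax lx.
have hx : (h \_ `[a, b]) x = h x by rewrite patchT// inE/= in_itv/= !ltW.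
rewrite -hx -G'; apply: is_derive1E.
apply: near_eq_is_derive (is_derive_cst (0 : R) x (1 : R)).
near=> y.
have ay : a < y by near: y; exact: lt_nbhsr.
have yb : y < b by near: y; exact: lt_nbhsl.
rewrite -(h0 y) ?in_itv/= ?(ltW ay) ?(ltW yb)//.
apply: eq_segI => t; rewrite in_itv/= => /andP[at_ ty].
by rewrite patchT// inE/= in_itv/= at_ (le_trans ty)// ltW.
Unshelve. all: by end_near. Qed.

Lemma locally_integrable_segment I h a b : locally_integrable I h ->
  `[a, b]%classic `<=` I -> mu.-integrable `[a, b] (EFin \o h).
Proof.
move=> [mh oI ih] abI; apply/integrableP; split.
  apply/measurable_EFinP; apply: measurable_funS mh => //; exact: open_measurable.
exact: ih abI (@segment_compact R a b).
Qed.

Lemma segment_bump I x : open I -> I x -> exists a b psi, [/\ a <= b,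
  `[a, b]%classic `<=` I, smooth psi, forall x, x \notin `[a, b] -> psi x = 0
  & \int[mu]_(t in `[a, b]) psi t = 1].
Proof.
move=> oI Ix; have [e e0 eI] := open_itv_around oI Ix.
pose p := bump 1 (x - e) (x + e).
have ee : x - e < x + e by lra.
have sp : smooth p by exact: smooth_bump.
have p0 y : y \notin `[x - e, x + e] -> p y = 0.
  move=> h; apply: bump_out => //; apply: contra h; exact: subset_itv_oo_cc.
pose J := \int[mu]_(t in `[x - e, x + e]) p t.
have J0 : 0 < J.
  (* The mass of [p] is positive because [p] is bounded below by some [d] > 0 on the middle half of
     its support. *)
  have cp : {within `[x - e / 2, x + e / 2], continuous p}.
    by apply: continuous_subspaceT; exact: smooth_continuous.
  have [y|d d0 pd] := prim_gt0_lb cp.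
    by rewrite in_itv/= => /andP[y1 y2]; apply: bump_gt0; rewrite // in_itv/=; lra.
  have bp := smooth_bmf _ _ sp.
  have p_ge0 y : 0 <= p y by exact: bump_ge0.
  have h1 : x - e <= x - e / 2 by lra.
  have h2 : x - e / 2 <= x + e by lra.
  have h3 : x - e / 2 <= x + e / 2 by lra.
  have h4 : x + e / 2 <= x + e by lra.
  rewrite /J (segI_chasles h1 h2 (bp _ _)) (segI_chasles h3 h4 (bp _ _)).
  rewrite ltr_wpDl ?segI_ge0// ltr_wpDr ?segI_ge0//.
  apply: (@lt_le_trans _ _ (d * e)); first exact: mulr_gt0.
  have -> : d * e = \int[mu]_(t in `[x - e / 2, x + e / 2]) d.
    by rewrite segI_cst; [congr (_ * _)|]; lra.
  apply: segI_le => //; exact: bmf_cst.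
exists (x - e), (x + e), (fun x => J^-1 * p x); split => //.
- exact: ltW.
- exact: smoothZ.
- by move=> y /p0 ->; rewrite mulr0.
- by rewrite segIZ ?mulVf ?gt_eqF//; exact: smooth_bmf.
Qed.
End test_functions.

(** * The du Bois-Reymond lemma *)

Section du_Bois_Reymond.
Context {R : realType}.
Implicit Types (I : set R) (f g h phi psi : R -> R) (a b x : R).
Notation mu := (@lebesgue_measure R).

Lemma segI_ocy h a b y : mu.-integrable `[a, b] (EFin \o h) -> y \in `[a, b] ->
  \int[mu]_(t in `[a, b]) (h t * \1_`]a, y[ t) = \int[mu]_(t in `[a, y]) h t.
Proof.
rewrite in_itv/= => ih /andP[ay yb].
have mh : measurable_fun `[a, b] h by apply/measurable_EFinP; case/integrableP: ih.
transitivity (\int[mu]_(t in `]a, y[) h t).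
  rewrite [LHS]Rintegral_mkcond [RHS]Rintegral_mkcond; congr (Rintegral _ _ _).
  apply/funext => t; rewrite !patchE indicE.
  have [tay|tay] := boolP (t \in `]a, y[%classic); last by rewrite mulr0 if_same.
  rewrite mulr1 ifT//; apply/mem_set; move/set_mem : tay => /=.
  by rewrite !in_itv/= => /andP[/ltW-> /ltW ty]; exact: le_trans yb.
rewrite /Rintegral -(@integral_itv_bndoo _ _ _ _ true false)//.
apply/measurable_EFinP; apply: measurable_funS mh => //.
by move=> t /=; rewrite !in_itv/= => /andP[/ltW-> /ltW/le_trans]; apply.
Qed.

(** Fix a bump [p] of unit mass and let [c] be the integral of [h p]. Subtracting from a bump its
    mass times [p] leaves a function of zero mass, hence the derivative of a test function; so
    [h - c] is orthogonal to all bumps. Sharpening bumps into indicators makes the indefinite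
    integral of [h - c] vanish. As [p] is chosen first, one constant serves all segments. *)
Lemma du_Bois_Reymond I h x0 : open I -> is_interval I -> I x0 ->
  locally_integrable I h ->
  (forall phi, test_function I phi -> \int[mu]_(x in I) (h x * derive1 phi x) = 0) ->
  exists c, forall a b, `[a, b]%classic `<=` I ->
    {ae mu, forall x, a < x < b -> h x = c}.
Proof.
move=> oI iI Ix0 lh hphi.
have [a0 [b0 [p [ab0 ab0I sp p0 ip]]]] := segment_bump oI Ix0.
pose c := \int[mu]_(t in `[a0, b0]) (h t * p t).
exists c => a b abI.
have [ba|ab] := leP b a.
  by apply: aeW => x /andP[ax /(lt_trans ax)]; rewrite ltNge ba.
(* A segment of I containing both the given one and the support of [p]. *)
pose A := Num.min a a0; pose B := Num.max b b0.
have Ia : I a by apply: abI; rewrite /= in_itv/= lexx ltW.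
have Ib : I b by apply: abI; rewrite /= in_itv/= lexx ltW.
have Ia0 : I a0 by apply: ab0I; rewrite /= in_itv/= lexx.
have Ib0 : I b0 by apply: ab0I; rewrite /= in_itv/= lexx andbT.
have IA : I A by rewrite /A; case: leP.
have IB : I B by rewrite /B; case: leP.
have ABI := itv_subset iI IA IB.
have Aa : A <= a by rewrite ge_min lexx.
have Aa0 : A <= a0 by rewrite ge_min lexx orbT.
have bB : b <= B by rewrite le_max lexx.
have bB0 : b0 <= B by rewrite le_max lexx orbT.
have AB : A <= B by rewrite (le_trans Aa)// (le_trans (ltW ab)).
have ih := locally_integrable_segment lh ABI.
have sub0 : `[a0, b0]%classic `<=` `[A, B]%classic.
  by apply: subset_itvScc; rewrite bnd_simp.
have ipAB : \int[mu]_(t in `[A, B]) p t = 1.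
  rewrite -ip; apply: Rintegral_support => // t _ tab; apply: p0.
  exact/negP.
have icAB : \int[mu]_(t in `[A, B]) (h t * p t) = c.
  apply: Rintegral_support => // t _ tab; rewrite p0 ?mulr0//.
  exact/negP.
have bp := smooth_bmf A B sp.
have bumpI n y : A <= y -> y <= B ->
    \int[mu]_(t in `[A, B]) ((h t - c) * bump n.+1%:R A y t) = 0.
  move=> Ay yB; set psi := bump _ _ _.
  have spsi : smooth psi by exact: smooth_bump.
  have bpsi := smooth_bmf A B spsi.
  pose k := \int[mu]_(t in `[A, B]) psi t.
  pose th t := psi t + - k * p t.
  have sth : smooth th by apply: smoothD => //; exact: smoothZ.
  have th0 t : t \notin `[A, B] -> th t = 0.
    move=> tAB; rewrite /th p0; last by apply: contra tAB; exact: sub0.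
    rewrite mulr0 addr0 /psi bump_out//; apply: contra tAB.
    by rewrite !in_itv/= => /andP[/ltW-> /ltW/le_trans]; apply.
  have ith : \int[mu]_(t in `[A, B]) th t = 0.
    rewrite segID//; last by apply: bmfM => //; exact: bmf_cst.
    by rewrite segIZ// ipAB mulr1 subrr.
  have [phi [sphi phi0] dphi] := smooth_antiderivative AB sth th0 ith.
  have := hphi phi (supported_test_function sphi phi0 ABI).
  rewrite dphi (Rintegral_segment mu ABI); last first.
    by move=> t tAB; rewrite th0 ?mulr0.
  have i1 := integrable_bmfM ih bpsi.
  have i2 := integrable_bmfM ih bp.
  have -> : \int[mu]_(t in `[A, B]) (h t * th t) =
      \int[mu]_(t in `[A, B]) (h t * psi t - k * (h t * p t)).
    by apply: eq_segI => t _; rewrite /th; ring.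
  rewrite RintegralB//; last first.
    by apply: eq_integrable (integrableZl _ k i2) => // t _ /=; rewrite EFinM.
  rewrite RintegralZl// icAB => kc.
  rewrite -[RHS]kc.
  have -> : \int[mu]_(t in `[A, B]) ((h t - c) * psi t) =
      \int[mu]_(t in `[A, B]) (h t * psi t - c * psi t).
    by apply: eq_segI => t _; ring.
  rewrite RintegralB//; last by apply: bmf_integrable; apply: bmfM => //; exact: bmf_cst.
  by rewrite segIZ// (mulrC k).
have ihc : mu.-integrable `[A, B] (EFin \o (fun t => h t - c)).
  have H := @integrableB _ _ _ mu _ (measurable_itv `[A, B]) _ _ ih
    (bmf_integrable (bmf_cst A B c)).
  by apply: eq_integrable H => // t _ /=; rewrite EFinB.
have : {ae mu, forall x, A < x < B -> h x - c = 0}.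
  apply: ae_eq0_of_segI => // y yAB.
  rewrite -(segI_ocy ihc yAB).
  have cv : \int[mu]_(t in `[A, B]) ((h t - c) * bump n.+1%:R A y t) @[n --> \oo] -->
      \int[mu]_(t in `[A, B]) ((h t - c) * \1_`]A, y[ t).
    apply: (@segI_dominated_pt _ _ _ (fun t => `|h t - c|)).
    - move=> n; have bb : bmf A B (bump n.+1%:R A y) by apply: smooth_bmf; exact: smooth_bump.
      by have := integrable_bmfM ihc bb => /integrableP[/measurable_EFinP].
    - exact: integrable_norm.
    - move=> n x _; rewrite normrM ler_piMr// ger0_norm ?bump_ge0//.
      exact: bump_le1.
    - by move=> x _; apply: cvgM; [exact: cvg_cst|exact: bump_cvg].
  have cst0 : \int[mu]_(t in `[A, B]) ((h t - c) * bump n.+1%:R A y t) @[n --> \oo] --> (0 : R).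
    move: yAB; rewrite in_itv/= => /andP[Ay yB].
    by apply: cvg_near_cst; near=> n; exact: bumpI.
  exact: (cvg_unique _ cv cst0).
apply: ae_imp => x H /andP[ax xb]; apply/eqP; rewrite -subr_eq0; apply/eqP/H.
by rewrite (le_lt_trans Aa)//= (lt_le_trans xb).
Unshelve. all: by end_near. Qed.

End du_Bois_Reymond.

(** * Fubini's theorem for bounded functions and finite measures *)

Section finite_fubini.
Context {R : realType}.
Notation T := (measurableTypeR R).
Variables m1 m2 : {finite_measure set T -> \bar R}.
Variables (F : T * T -> R) (M : R).
Hypothesis mF : measurable_fun setT F.
Hypothesis FM : forall z, `|F z| <= M.

Let F1 x : measurable_fun [set: T] (fun y => F (x, y)).
Proof. by apply: measurableT_comp => //; exact: measurable_pair1. Qed.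

Let F2 y : measurable_fun [set: T] (fun x => F (x, y)).
Proof. by apply: measurableT_comp => //; exact: measurable_pair2. Qed.

Let i1 x : m2.-integrable setT (EFin \o (fun y => F (x, y))).
Proof.
apply: measurable_bounded_integrable => //.
  by rewrite -ge0_fin_numE// fin_num_measure.
exists M; split; first exact: num_real.
by move=> N MN y _ /=; rewrite (le_trans (FM _))// ltW.
Qed.

Let i2 y : m1.-integrable setT (EFin \o (fun x => F (x, y))).
Proof.
apply: measurable_bounded_integrable => //.
  by rewrite -ge0_fin_numE// fin_num_measure.
exists M; split; first exact: num_real.
by move=> N MN x _ /=; rewrite (le_trans (FM _))// ltW.
Qed.

Let iF : (m1 \x m2)%E.-integrable setT (EFin \o F).
Proof.
apply/integrable12ltyP; first exact/measurable_EFinP.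
have M0 : 0 <= M by rewrite (le_trans (normr_ge0 _) (FM point)).
apply: (@le_lt_trans _ _ (\int[m1]_x (M%:E * m2 setT))%E).
  apply: ge0_le_integral => //.
  - by move=> x _; apply: integral_ge0 => y _.
  - apply: (@measurable_fun_fubini_tonelli_F _ _ _ _ _ m2 (abse \o (EFin \o F))) => [|z]; last exact: abse_ge0.
    by apply: measurableT_comp => //; exact/measurable_EFinP.
  - move=> x _; rewrite -integral_cst//; apply: ge0_le_integral => //.
    + by apply: measurableT_comp => //; exact/measurable_EFinP.
    + by move=> y _; rewrite lee_fin.
rewrite integral_cst//= -ge0_fin_numE; last by rewrite !mule_ge0.
by rewrite !fin_numM// fin_num_measure.
Qed.

Lemma finite_Fubini :
  \int[m1]_x (\int[m2]_y F (x, y)) = \int[m2]_y (\int[m1]_x F (x, y)).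
Proof.
rewrite /Rintegral; congr fine.
transitivity (\int[m1]_x (\int[m2]_y (F (x, y))%:E))%E.
  apply: eq_integral => x _; rewrite fineK//.
  by apply: (@integrable_fin_num _ _ _ m2); [|exact: i1].
rewrite (Fubini iF); apply: eq_integral => y _; rewrite fineK//.
by apply: (@integrable_fin_num _ _ _ m1); [|exact: i2].
Qed.

Lemma measurable_finite_Fubini :
  measurable_fun [set: T] (fun y => \int[m1]_x F (x, y)).
Proof.
by rewrite /Rintegral; apply: measurableT_comp => //; exact: (measurable_fubini_G iF).
Qed.

End finite_fubini.

(** * Integration against a measure on a segment *)

Section measure_segment.
Context {R : realType}.
Notation T := (measurableTypeR R).
Notation mu := (@lebesgue_measure R).
Implicit Types (s : {measure set T -> \bar R}) (D : set T) (a b x y : R).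

(** A Radon measure is finite only locally; replacing it by its restriction to [D] makes
    [finite_Fubini] applicable. *)
Lemma Rintegral_mfrestr s D (mD : measurable D) (sD : (s D < +oo)%E) (f : T -> R) :
  \int[s]_(x in D) f x = \int[mfrestr mD sD]_x (f \_ D) x.
Proof.
rewrite -Rintegral_mkcond; congr fine; apply: eq_measure_integral => A mA AD.
by rewrite /= /mfrestr /mrestr setIidl.
Qed.

Lemma finite_bounded_integrable s D (f : T -> R) (M : R) : measurable D ->
  (s D < +oo)%E -> measurable_fun D f -> (forall x, D x -> `|f x| <= M) ->
  s.-integrable D (EFin \o f).
Proof.
move=> mD sD mf fM; apply: measurable_bounded_integrable => //.
exists M; split; first exact: num_real.
by move=> N MN x /= xab; rewrite (le_trans (fM _ xab))// ltW.
Qed.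

Lemma measurable_le_indic d' (S : measurableType d') (f g : S -> T) :
  measurable_fun setT f -> measurable_fun setT g ->
  measurable_fun setT (fun z => \1_[set z | f z <= g z] z : R).
Proof.
move=> mf mg; apply: measurable_indic.
have := measurable_fun_ler mf mg => /(_ measurableT [set true] I).
by rewrite setTI.
Qed.

Lemma mu_fin a b : (mu `[a, b]%classic < +oo)%E.
Proof. by rewrite lebesgue_measure_itv/=; case: ifP => _ //; rewrite -EFinB ltry. Qed.

Section parts.
Variables (s : {measure set T -> \bar R}) (a b : R) (k : R -> R) (K : R).
Hypothesis sab : (s `]a, b]%classic < +oo)%E.
Hypothesis mk : measurable_fun (`]a, b]%classic : set T) k.
Hypothesis kK : forall x, x \in `]a, b] -> `|k x| <= K.

Let kt : T -> R := k \_ `]a, b].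
Let m1 : {finite_measure set T -> \bar R} :=
  @mfrestr _ T R `]a, b]%classic s (measurable_itv `]a, b]) sab.
Let m2 : {finite_measure set T -> \bar R} :=
  @mfrestr _ T R `[a, b]%classic mu (measurable_itv `[a, b]) (mu_fin a b).

Let mkt : measurable_fun [set: T] kt.
Proof. by apply/(measurable_restrictT _ _).1. Qed.

Let ktK x : `|kt x| <= `|K|.
Proof.
rewrite /kt patchE; case: ifPn => [/set_mem/kK H|_]; last by rewrite normr0.
by rewrite (le_trans H)// ler_norm.
Qed.

Let HE x : x \in `[a, b] ->
  \int[s]_(y in `]a, x]) k y = \int[m1]_y (kt y * \1_[set z : T * T | z.1 <= z.2] (y, x)).
Proof.
rewrite in_itv/= => /andP[ax xb].
have -> : `]a, x]%classic = `]a, b]%classic `&` [set y | y <= x].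
  apply/seteqP; split=> y /=; rewrite !in_itv/=; last by move=> [/andP[-> _] ->].
  by move=> /andP[-> yx]; split=> //; exact: le_trans yx xb.
rewrite Rintegral_mkcondr Rintegral_mfrestr; congr (Rintegral _ _ _).
apply/funext => y; rewrite /kt !patchE indicE.
case: ifPn => ya; last by rewrite mul0r.
have -> : ((y, x) \in [set z : T * T | z.1 <= z.2]) = (y \in [set y | y <= x]).
  by apply/idP/idP => /set_mem h; exact/mem_set.
by case: (y \in _); rewrite ?mulr1 ?mulr0.
Qed.

(** Measurability in [x] comes from Fubini's theorem, once the integral is written as a section
    integral of [k] times the indicator of y <= x. *)
Lemma bmf_mass : bmf a b (fun x => \int[s]_(y in `]a, x]) k y).
Proof.
apply: (@eq_bmf _ _ _
  (fun x => \int[m1]_y (kt y * \1_[set z : T * T | z.1 <= z.2] (y, x)))).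
  by move=> x /HE.
split.
  apply: measurable_funTS.
  apply: (@measurable_finite_Fubini _ m1 m2
    (fun z => kt z.1 * \1_[set z : T * T | z.1 <= z.2] z) `|K|).
    apply: measurable_funM; first exact: measurableT_comp.
    exact: (@measurable_le_indic _ _ fst snd measurable_fst measurable_snd).
  move=> z; rewrite normrM -[leRHS]mulr1 ler_pM// indicE.
  by case: (_ \in _); rewrite ?normr1 ?normr0.
exists (`|K| * fine (m1 setT)) => x xab.
have bd y : `|kt y * \1_[set z : T * T | z.1 <= z.2] (y, x)| <= `|K|.
  rewrite normrM -[leRHS]mulr1 ler_pM// indicE.
  by case: (_ \in _); rewrite ?normr1 ?normr0.
have mm : measurable_fun [set: T] (fun y => kt y * \1_[set z : T * T | z.1 <= z.2] (y, x)).
  apply: measurable_funM => //.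
  apply: (@measurable_le_indic _ _ (fun y => y) (cst x)) => //.
have m1oo : (m1 setT < +oo)%E by rewrite -ge0_fin_numE// fin_num_measure.
have im := finite_bounded_integrable measurableT m1oo mm (fun y _ => bd y).
rewrite (le_trans (le_normr_Rintegral measurableT im))//.
rewrite -Rintegral_cst//; apply: le_Rintegral => //.
- exact: integrable_norm.
- by apply: (@finite_bounded_integrable _ _ _ `|K|) => // y _; rewrite normr_id.
Qed.

(* Integration by parts against a measure: Fubini on the triangle
   [a < y <= x <= b] for [k y * f x]. *)
Lemma prim_parts_measure F f : prim a b F f -> F b = 0 ->
  \int[s]_(y in `]a, b]) (F y * k y) =
  - \int[mu]_(x in `[a, b]) (f x * \int[s]_(y in `]a, x]) k y).
Proof.
move=> PF Fb0; have [mf [L fL]] := prim_bmf_deriv PF.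
have [ba|ab] := leP b a.
  have -> : `]a, b]%classic = set0 by rewrite set_itv_ge// bnd_simp -leNgt.
  rewrite Rintegral_set0; move: ba; rewrite le_eqVlt => /predU1P[->|ba].
    by rewrite set_itv1 Rintegral_set1 oppr0.
  by rewrite set_itv_ge ?Rintegral_set0 ?oppr0// bnd_simp -ltNge.
pose ft : T -> R := f \_ `[a, b].
have mft : measurable_fun [set: T] ft by apply/(measurable_restrictT _ _).1.
have ftL x : `|ft x| <= `|L|.
  rewrite /ft patchE; case: ifPn => [/set_mem/fL H|_]; last by rewrite normr0.
  by rewrite (le_trans H)// ler_norm.
pose G (z : T * T) : R := (kt z.1 * \1_[set z : T * T | z.1 <= z.2] z) * ft z.2.
have mG : measurable_fun setT G.
  apply: measurable_funM; last exact: measurableT_comp.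
  apply: measurable_funM; first exact: measurableT_comp.
  exact: (@measurable_le_indic _ _ fst snd measurable_fst measurable_snd).
have bG z : `|G z| <= `|K| * `|L|.
  rewrite normrM ler_pM// normrM -[leRHS]mulr1 ler_pM// indicE.
  by case: (_ \in _); rewrite ?normr1 ?normr0.
have FubG := @finite_Fubini _ m1 m2 G _ mG bG.
have -> : \int[mu]_(x in `[a, b]) (f x * \int[s]_(y in `]a, x]) k y) =
          \int[m2]_x \int[m1]_y G (y, x).
  rewrite (Rintegral_mfrestr (measurable_itv `[a, b]) (mu_fin a b)).
  congr (Rintegral _ _ _); apply/funext => x; rewrite patchE.
  case: ifPn => xab; last first.
    rewrite /G /ft/= patchE (negbTE xab).
    transitivity (\int[m1]_y (0 : R)); last by apply: eq_Rintegral => y _; rewrite mulr0.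
    by rewrite Rintegral_cst// mul0r.
  have xab' : x \in `[a, b] by move/set_mem : xab.
  rewrite HE// /G /= /ft patchE xab.
  have bd y : `|kt y * \1_[set z : T * T | z.1 <= z.2] (y, x)| <= `|K|.
    rewrite normrM -[leRHS]mulr1 ler_pM// indicE.
    by case: (_ \in _); rewrite ?normr1 ?normr0.
  have mm : measurable_fun [set: T] (fun y => kt y * \1_[set z : T * T | z.1 <= z.2] (y, x)).
    apply: measurable_funM => //.
    exact: (@measurable_le_indic _ _ (fun y => y) (cst x)).
  have m1oo : (m1 setT < +oo)%E by rewrite -ge0_fin_numE// fin_num_measure.
  have im := finite_bounded_integrable measurableT m1oo mm (fun y _ => bd y).
  by rewrite mulrC RintegralZr.
rewrite -FubG (Rintegral_mfrestr (measurable_itv `]a, b]) sab).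
have -> : \int[m1]_x (\int[m2]_y G (x, y)) = \int[m1]_x (- ((fun y => F y * k y) \_ `]a, b]) x).
  apply: eq_Rintegral => y _; rewrite patchE.
  transitivity (\int[m2]_x (((fun x => kt y * \1_[set z | y <= z] x * f x) \_ `[a, b]) x)).
    apply: eq_Rintegral => x _; rewrite /G /ft/= !patchE !indicE.
    case: ifPn => _; last by rewrite mulr0.
    by [].
  rewrite -(Rintegral_mfrestr (measurable_itv `[a, b]) (mu_fin a b)).
  case: ifPn => ya; last first.
    rewrite -[point]/(0 : R) oppr0 /kt; transitivity (\int[mu]_(x in `[a, b]) (0 : R)).
      by apply: eq_segI => x _; rewrite patchE (negbTE ya) !mul0r.
    by rewrite segI_cst ?mul0r// ltW.
  have /andP[ay yb] : a < y <= b by move/set_mem : ya => /=; rewrite in_itv.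
  transitivity (\int[mu]_(x in `[y, b]) (kt y * f x)).
    rewrite [LHS]Rintegral_mkcond [RHS]Rintegral_mkcond.
    congr (Rintegral _ _ _); apply/funext => x; rewrite !patchE indicE.
    have [xyb|xyb] := boolP (x \in `[y, b]%classic).
      move/set_mem : xyb => /=; rewrite in_itv/= => /andP[yx xb].
      rewrite ifT; last by apply/mem_set; rewrite /= in_itv/= xb (le_trans (ltW ay)).
      by rewrite (_ : x \in _ = true) ?mulr1//; apply/mem_set.
    case: ifPn => // /set_mem/=; rewrite in_itv/= => /andP[ax xb].
    rewrite (_ : x \in _ = false) ?mulr0 ?mul0r//; apply/negbTE/negP => /set_mem/= yx.
    by move/negP : xyb; apply; apply/mem_set; rewrite /= in_itv/= yx.
  rewrite segIZ; last exact: (bmf_itv (prim_bmf_deriv PF) (ltW ay) (lexx _)).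
  (* The inner integral of [f] over [y, b] is F b - F y, that is - F y. *)
  have [_ /(_ y b (ltW ay) yb (lexx _)) <-] := PF.
  by rewrite Fb0 sub0r /kt patchE ya mulrN mulrC.
have [N N0 FN] := bmf_bound (prim_bmf PF).
have iFk : m1.-integrable setT (EFin \o ((fun y => F y * k y) \_ `]a, b])).
  apply: (@finite_bounded_integrable _ _ _ (N * `|K|)) => //.
  - by rewrite -ge0_fin_numE// fin_num_measure.
  - apply/(measurable_restrictT _ _).1 => //; apply: measurable_funM => //.
    have [mF _] := prim_bmf PF; apply: measurable_funS mF => //.
    exact: subset_itv_oc_cc.
  - move=> y _; rewrite patchE; case: ifPn => [/set_mem yab|_].
      rewrite normrM ler_pM//; first by apply: FN; exact: subset_itv_oc_cc.
      by rewrite (le_trans (kK _)) ?ler_norm.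
    by rewrite normr0 mulr_ge0.
rewrite -[LHS]opprK; congr (- _); rewrite -mulN1r -RintegralZl//.
by apply: eq_Rintegral => y _; rewrite mulN1r.
Qed.

End parts.

(* Layer-cake: [p + M] is the integral of the indicators of its superlevel
   sets, on which the two signed measures agree. *)
Lemma eq_signed_integral s1 s2 D (g1 g2 p : R -> R) (K M : R) :
  measurable D -> (s1 D < +oo)%E -> (s2 D < +oo)%E ->
  measurable_fun D g1 -> measurable_fun D g2 -> measurable_fun D p ->
  (forall x, D x -> `|g1 x| <= K) -> (forall x, D x -> `|g2 x| <= K) ->
  (forall x, D x -> `|p x| <= M) ->
  (forall A, measurable A -> A `<=` D ->
    \int[s1]_(x in A) g1 x = \int[s2]_(x in A) g2 x) ->
  \int[s1]_(x in D) (p x * g1 x) = \int[s2]_(x in D) (p x * g2 x).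
Proof.
move=> mD s1D s2D mg1 mg2 mp g1K g2K pM s12.
(* On [D] the function [p + M] takes its values in [0, 2 M], which is therefore the range of the
   levels. *)
pose m2 : {finite_measure set T -> \bar R} :=
    @mfrestr _ T R `[0, 2 * M]%classic mu (measurable_itv `[0, 2 * M]) (mu_fin 0 (2 * M)).
pose pt : T -> R := fun x => (p \_ D) x + M.
have mpt : measurable_fun [set: T] pt.
  by apply: measurable_funD => //; apply/(measurable_restrictT _ _).1.
have cake (s : {measure set T -> \bar R}) (sD : (s D < +oo)%E) (g : R -> R) :
    measurable_fun D g -> (forall x, D x -> `|g x| <= K) ->
    \int[s]_(x in D) (p x * g x) =
    \int[mu]_(t in `[0, 2 * M]) (\int[s]_(x in D `&` [set x | t <= pt x]) g x) -
    M * \int[s]_(x in D) g x.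
  move=> mg gK; pose m1 : {finite_measure set T -> \bar R} := mfrestr mD sD; pose gt : T -> R := g \_ D.
  have ig := finite_bounded_integrable mD sD mg gK.
  have mgt : measurable_fun [set: T] gt by apply/(measurable_restrictT _ _).1.
  have gtK x : `|gt x| <= `|K|.
    rewrite /gt patchE; case: ifPn => [/set_mem/gK H|_]; last by rewrite normr0.
    by rewrite (le_trans H)// ler_norm.
  pose G (z : T * T) : R :=
    gt z.1 * \1_[set z : T * T | z.2 <= pt z.1] z * \1_`[0, 2 * M] z.2.
  have mG : measurable_fun setT G.
    apply: measurable_funM; last first.
      by apply: measurableT_comp => //; exact: measurable_indic.
    apply: measurable_funM; first exact: measurableT_comp.
    by apply: (@measurable_le_indic _ _ snd (pt \o fst)) => //; exact: measurableT_comp.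
  have bG z : `|G z| <= `|K|.
    rewrite !normrM -[leRHS]mulr1 ler_pM//; last first.
      by rewrite indicE; case: (_ \in _); rewrite ?normr1 ?normr0.
    rewrite -[leRHS]mulr1 ler_pM// indicE.
    by case: (_ \in _); rewrite ?normr1 ?normr0.
  have FubG := @finite_Fubini _ m1 m2 G _ mG bG.
  have -> : \int[mu]_(t in `[0, 2 * M]) (\int[s]_(x in D `&` [set x | t <= pt x]) g x) =
      \int[m2]_t (\int[m1]_x G (x, t)).
    rewrite (Rintegral_mfrestr (measurable_itv `[0, 2 * M]) (mu_fin 0 (2 * M))).
    apply: eq_Rintegral => t _; rewrite patchE; case: ifPn => tM; last first.
      transitivity (\int[m1]_x (0 : R)); first by rewrite Rintegral_cst// mul0r.
      by apply: eq_Rintegral => x _; rewrite /G/= [\1_`[_, _] _]indicE (negbTE tM) mulr0.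
    rewrite Rintegral_mkcondr (Rintegral_mfrestr mD sD).
    apply: eq_Rintegral => x _; rewrite /G /gt/= !patchE !indicE tM mulr1.
    case: ifPn => _; last by rewrite mul0r.
    have -> : ((x, t) \in [set z : T * T | z.2 <= pt z.1]) = (x \in [set x | t <= pt x]).
      by apply/idP/idP => /set_mem h; exact/mem_set.
    by case: ifPn; rewrite ?mulr1 ?mulr0.
  rewrite -FubG.
  have ipg : s.-integrable D (EFin \o (fun x => (p x + M) * g x)).
    apply: (@finite_bounded_integrable _ _ _ ((M + `|M|) * K)) => //.
      by apply: measurable_funM => //; exact: measurable_funD.
    move=> x Dx; rewrite normrM ler_pM ?gK//.
    by rewrite (le_trans (ler_normD _ _))// lerD2r pM.
  have -> : \int[m1]_x (\int[m2]_y G (x, y)) = \int[s]_(x in D) ((p x + M) * g x).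
    rewrite (Rintegral_mfrestr mD sD); apply: eq_Rintegral => x _.
    rewrite patchE; case: ifPn => xD; last first.
      transitivity (\int[m2]_y (0 : R)); last by rewrite Rintegral_cst ?mul0r.
      by apply: eq_Rintegral => y _; rewrite /G /gt/= patchE (negbTE xD) !mul0r.
    have Dx : D x by exact/set_mem.
    have ptE : pt x = p x + M by rewrite /pt patchE xD.
    have := pM _ Dx; rewrite ler_norml => /andP[pM1 pM2].
    transitivity (\int[m2]_y (((fun y => gt x * \1_[set z | z <= pt x] y) \_ `[0, 2 * M]) y)).
      apply: eq_Rintegral => y _; rewrite /G /= !patchE !indicE.
      case: ifPn => yM; last by rewrite mulr0.
      by rewrite mulr1.
    rewrite -(Rintegral_mfrestr (measurable_itv `[0, 2 * M]) (mu_fin 0 (2 * M))).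
    transitivity (\int[mu]_(y in `[0, pt x]) gt x).
      rewrite [LHS]Rintegral_mkcond [RHS]Rintegral_mkcond.
      congr (Rintegral _ _ _); apply/funext => y; rewrite !patchE indicE.
      have [yb|yb] := boolP (y \in `[0, pt x]%classic).
        move/set_mem : yb => /=; rewrite in_itv/= => /andP[y0 yp].
        rewrite ifT; last by apply/mem_set; rewrite /= in_itv/= y0 (le_trans yp)// ptE; lra.
        by rewrite (_ : y \in _ = true) ?mulr1//; apply/mem_set.
      case: ifPn => // /set_mem/=; rewrite in_itv/= => /andP[y0 yM].
      rewrite (_ : y \in _ = false) ?mulr0//; apply/negbTE/negP => /set_mem/= yx.
      by move/negP : yb; apply; apply/mem_set; rewrite /= in_itv/= y0.
    rewrite segI_cst; last by rewrite ptE; lra.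
    by rewrite subr0 ptE /gt patchE xD mulrC.
  have -> : \int[s]_(x in D) ((p x + M) * g x) =
      \int[s]_(x in D) (p x * g x + M * g x).
    by apply: eq_Rintegral => x _; rewrite mulrDl.
  rewrite RintegralD//; last 2 first.
  - apply: (@finite_bounded_integrable _ _ _ (M * K)) => //; first exact: measurable_funM.
    by move=> x Dx; rewrite normrM ler_pM ?gK ?pM.
  - apply: (@finite_bounded_integrable _ _ _ (`|M| * K)) => //; first exact: measurable_funM.
    by move=> x Dx; rewrite normrM ler_pM ?gK ?pM.
  by rewrite RintegralZl// addrK.
rewrite (cake s1)// (cake s2)//; congr (_ - M * _); last exact: s12.
apply: eq_Rintegral => t _; apply: s12; last exact: subIsetl.
apply: measurableI => //.
have := measurable_fun_ler (@measurable_cst _ _ T R setT t) mpt => /(_ measurableT [set true] I).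
by rewrite setTI.
Qed.

End measure_segment.

(** * Locally Lipschitz functions on an open interval, and their weak derivatives *)

Section primitives_on_interval.
Context {R : realType}.
Notation T := (measurableTypeR R).
Notation mu := (@lebesgue_measure R).
Implicit Types (I : set R) (f g F G k : R -> R) (a b x y : R).
Implicit Types (s : {measure set T -> \bar R}).

Definition bmfI I f := forall a b, I a -> I b -> bmf a b f.

Definition primI I F f := forall a b, I a -> I b -> prim a b F f.

Lemma primI_bmfI I F f : primI I F f -> bmfI I F.
Proof. by move=> PF a b Ia Ib; exact: prim_bmf (PF a b Ia Ib). Qed.

Lemma primI_deriv I F f : primI I F f -> bmfI I f.
Proof. by move=> PF a b Ia Ib; exact: prim_bmf_deriv (PF a b Ia Ib). Qed.

Lemma primIM I F f G g : primI I F f -> primI I G g ->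
  primI I (fun x => F x * G x) (fun x => f x * G x + F x * g x).
Proof. by move=> PF PG a b Ia Ib; apply: primM; [exact: PF|exact: PG]. Qed.

Lemma primID I F f G g : primI I F f -> primI I G g ->
  primI I (fun x => F x + G x) (fun x => f x + g x).
Proof. by move=> PF PG a b Ia Ib; apply: primD; [exact: PF|exact: PG]. Qed.

Lemma primIZ I F f (c : R) : primI I F f ->
  primI I (fun x => c * F x) (fun x => c * f x).
Proof. by move=> PF a b Ia Ib; apply: primZ; exact: PF. Qed.

Lemma primI_cst I (c : R) : primI I (cst c) (cst 0).
Proof. by move=> a b _ _; exact: prim_cst. Qed.

Lemma bmfID I f g : bmfI I f -> bmfI I g -> bmfI I (fun x => f x + g x).
Proof. by move=> bf bg a b Ia Ib; apply: bmfD; [exact: bf|exact: bg]. Qed.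

Lemma bmfIM I f g : bmfI I f -> bmfI I g -> bmfI I (fun x => f x * g x).
Proof. by move=> bf bg a b Ia Ib; apply: bmfM; [exact: bf|exact: bg]. Qed.

Lemma bmfIN I f : bmfI I f -> bmfI I (fun x => - f x).
Proof. by move=> bf a b Ia Ib; apply: bmfN; exact: bf. Qed.

Lemma bmfIB I f g : bmfI I f -> bmfI I g -> bmfI I (fun x => f x - g x).
Proof. by move=> bf bg; apply: bmfID => //; exact: bmfIN. Qed.

Lemma eq_bmfI I f g : is_interval I -> (forall x, I x -> f x = g x) ->
  bmfI I f -> bmfI I g.
Proof.
move=> iI fg bf a b Ia Ib; apply: eq_bmf (bf a b Ia Ib) => x xab.
by apply: fg; exact: (itv_subset iI Ia Ib).
Qed.

Lemma eq_primI I F f G g : is_interval I -> (forall x, I x -> F x = G x) ->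
  (forall x, I x -> f x = g x) -> primI I F f -> primI I G g.
Proof.
move=> iI FG fg PF a b Ia Ib; apply: eq_prim (PF a b Ia Ib) => x xab.
  by apply: FG; exact: (itv_subset iI Ia Ib).
by apply: fg; exact: (itv_subset iI Ia Ib).
Qed.

Lemma within_continuous_segment I f a b : is_interval I ->
  {within I, continuous f} -> I a -> I b -> {within `[a, b], continuous f}.
Proof. by move=> iI cf Ia Ib; apply: continuous_subspaceW cf; exact: itv_subset. Qed.

Lemma continuous_bmfI I f : is_interval I -> {within I, continuous f} -> bmfI I f.
Proof.
move=> iI cf a b Ia Ib; apply: within_continuous_bmf.
exact: within_continuous_segment cf Ia Ib.
Qed.

Lemma bmfI_V I f : is_interval I -> {within I, continuous f} ->
  (forall x, I x -> 0 < f x) -> bmfI I (fun x => (f x)^-1).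
Proof.
move=> iI cf f0 a b Ia Ib; apply: bmfV; first exact: within_continuous_segment cf Ia Ib.
by move=> x /(itv_subset iI Ia Ib); exact: f0.
Qed.

Lemma primI_V I F f : is_interval I -> primI I F f -> (forall x, I x -> 0 < F x) ->
  primI I (fun x => (F x)^-1) (fun x => - f x / F x ^+ 2).
Proof.
move=> iI PF F0 a b Ia Ib; apply: primV; first exact: PF.
by move=> x /(itv_subset iI Ia Ib); exact: F0.
Qed.

Lemma open_bigger I x : open I -> I x -> exists2 y, x < y & I y.
Proof.
move=> oI Ix; have [e e0 eI] := open_itv_around oI Ix.
by exists (x + e); [rewrite ltrDl|apply: eI; rewrite /= in_itv/=; lra].
Qed.

Lemma open_smaller I x : open I -> I x -> exists2 y, y < x & I y.
Proof.
move=> oI Ix; have [e e0 eI] := open_itv_around oI Ix.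
by exists (x - e); [rewrite gtrBl|apply: eI; rewrite /= in_itv/=; lra].
Qed.

Lemma primI_continuous I F f : open I -> primI I F f -> {within I, continuous F}.
Proof.
move=> oI PF; rewrite continuous_open_subspace// => x /set_mem Ix.
have [a ax Ia] := open_smaller oI Ix; have [b xb Ib] := open_bigger oI Ix.
apply: (@within_continuous_continuous _ _ _ a b); first exact: lt_trans xb.
  exact: prim_continuous (PF a b Ia Ib).
by rewrite in_itv/= ax.
Qed.

Lemma within_open_continuous I f x : open I -> {within I, continuous f} -> I x ->
  {for x, continuous f}.
Proof. by move=> oI; rewrite continuous_open_subspace// => cf Ix; apply: cf; exact: mem_set. Qed.

Lemma bmfI_measurable I f : open I -> is_interval I -> bmfI I f ->
  measurable_fun (I : set T) f.
Proof.
move=> oI iI bf.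
have [->|/set0P[x0 Ix0]] := eqVneq I set0; first exact: measurable_fun_set0.
(* The interval is covered by the countably many segments with rational endpoints in I. *)
pose E (i : nat) : set T := if unpickle i is Some pq then
  let p := ratr (pq : rat * rat).1 in let q := ratr pq.2 in
  if `[< I p /\ I q >] then `[p, q]%classic else set0 else set0.
have IE : \bigcup_i E i = I.
  apply/seteqP; split=> [x [i _]|x Ix].
    rewrite /E; case: unpickle => [[p q]/=|//].
    by case: asboolP => [[Ip Iq]|//]; exact: itv_subset.
  have [a ax Ia] := open_smaller oI Ix; have [b xb Ib] := open_bigger oI Ix.
  have [p] := rat_in_itvoo ax; rewrite in_itv/= => /andP[ap px].
  have [q] := rat_in_itvoo xb; rewrite in_itv/= => /andP[xq qb].
  exists (pickle (p, q)); [exact: Logic.I|rewrite /E pickleK; cbn zeta].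
  rewrite asboolT; first by rewrite /= in_itv/= !ltW.
  by split; [apply: (iI a x)|apply: (iI x b)] => //; rewrite !ltW.
have mE i : measurable (E i).
  rewrite /E; case: (unpickle i) => [pq|]; last exact: measurable0.
  by cbn zeta; case: ifP => _; [exact: measurable_itv|exact: measurable0].
rewrite -IE; apply/(measurable_fun_bigcup f mE) => i; rewrite /E.
case: (unpickle i) => [pq|]; last exact: measurable_fun_set0.
cbn zeta; case: asboolP => [[Ip Iq]|_]; last exact: measurable_fun_set0.
by have [] := bf _ _ Ip Iq.
Qed.

Lemma bmfI_locally_integrable I x0 f : open I -> is_interval I -> I x0 ->
  bmfI I f -> locally_integrable I f.
Proof.
move=> oI iI Ix0 bf; split=> //; first exact: bmfI_measurable.
move=> K KI cK; have [a [b [axb abI Kab]]] := compact_subset_segment oI iI cK KI Ix0.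
have Ia : I a by apply: abI; rewrite /= in_itv/= lexx; lra.
have Ib : I b by apply: abI; rewrite /= in_itv/= lexx; lra.
have /integrableP[_] : mu.-integrable K (EFin \o f).
  apply: (@integrableS _ _ _ mu `[a, b]%classic) => //.
  - exact: compact_measurable.
  - by move=> t /Kab; exact: subset_itv_oo_cc.
  - exact: bmf_integrable (bf _ _ Ia Ib).
by [].
Qed.

(** The oriented integral: according to the order of [x0] and [x], one of the two terms is over an
    empty set or a point and vanishes. *)
Definition integral_from x0 f x :=
  \int[mu]_(t in `[x0, x]) f t - \int[mu]_(t in `[x, x0]) f t.

Lemma segI_rev f x y : y <= x -> \int[mu]_(t in `[x, y]) f t = 0.
Proof.
rewrite le_eqVlt => /predU1P[->|yx]; first by rewrite set_itv1 Rintegral_set1.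
by rewrite set_itv_ge ?Rintegral_set0// bnd_simp -ltNge.
Qed.

Lemma integral_from_base x0 f : integral_from x0 f x0 = 0.
Proof. by rewrite /integral_from subrr. Qed.

Lemma primI_integral_from I x0 f : is_interval I -> I x0 -> bmfI I f ->
  primI I (integral_from x0 f) f.
Proof.
move=> iI Ix0 bf a b Ia Ib; split; first exact: bf.
move=> x y ax xy yb.
have Ix : I x by apply: (iI a b) => //; rewrite ax (le_trans xy).
have Iy : I y by apply: (iI a b) => //; rewrite yb (le_trans ax).
rewrite /integral_from; have [x0x|xx0] := leP x0 x.
  rewrite (segI_rev _ x0x) (segI_rev _ (le_trans x0x xy)) !subr0.
  by rewrite (segI_chasles x0x xy (bf _ _ Ix0 Iy)) addrC addKr.
have [x0y|yx0] := leP x0 y.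
  rewrite (segI_rev _ (ltW xx0)) (segI_rev _ x0y) subr0 sub0r opprK.
  by rewrite (segI_chasles (ltW xx0) x0y (bf _ _ Ix Iy)) addrC.
rewrite (segI_rev _ (ltW yx0)) (segI_rev _ (ltW xx0)).
by rewrite (segI_chasles xy (ltW yx0) (bf _ _ Ix Ix0)); ring.
Qed.

(** The indefinite integral of [h] is that of [c], and by continuity its derivative at [x] is
    [h x]. *)
Lemma ae_eq_continuous h a b (c : R) x : {within `[a, b], continuous h} ->
  {ae mu, forall t, a < t < b -> h t = c} -> a < x < b -> h x = c.
Proof.
move=> ch hc /andP[ax xb].
have bh := within_continuous_bmf ch.
have hx : {for x, continuous h}.
  apply: within_continuous_continuous ch _; first exact: lt_trans xb.
  by rewrite in_itv/= ax.
have [d d'] := @continuous_FTC1_closed R h a x b xb (bmf_integrable bh) ax hx.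
rewrite -d'; apply: is_derive1E.
have dl : is_derive x 1 (fun y => c * (y - a)) c.
  have dx : is_derive x 1 (fun y : R => y - a) 1.
    apply: is_derive_eq (is_deriveD1 (is_derive_id x (1:R)) (is_derive_cst (- a) x (1:R))) _.
    by rewrite addr0.
  apply: is_derive_eq (is_deriveM1 (is_derive_cst c x (1:R)) dx) _.
  by rewrite mul0r add0r mulr1.
apply: near_eq_is_derive dl; near=> y.
have ay : a < y by near: y; exact: lt_nbhsr.
have yb : y < b by near: y; exact: lt_nbhsl.
rewrite -segI_cst; last exact: ltW.
apply: ae_eq_segI; [exact: bmf_cst|exact: bmf_itv bh (lexx _) (ltW yb)|].
by apply: ae_imp hc => t H /andP[at_ ty]; rewrite H// at_ (lt_trans ty).
Unshelve. all: by end_near. Qed.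

Lemma integral_by_parts a b F f G g : a <= b -> prim a b F f -> prim a b G g ->
  G a = 0 -> G b = 0 ->
  \int[mu]_(t in `[a, b]) (F t * g t) = - \int[mu]_(t in `[a, b]) (f t * G t).
Proof.
move=> ab PF PG Ga Gb; have PM := primM PF PG.
have := prim_ftc ab PM; rewrite Ga Gb !mulr0 subrr => /eqP.
rewrite segID; last 2 first.
- by apply: bmfM; [exact: prim_bmf_deriv PF|exact: prim_bmf PG].
- by apply: bmfM; [exact: prim_bmf PF|exact: prim_bmf_deriv PG].
by rewrite addrC addr_eq0 => /eqP.
Qed.

(** The difference of [u] and the integral of [du] has zero distributional derivative; by
    [du_Bois_Reymond] it is almost everywhere constant, and by continuity everywhere. *)
Lemma weak_derivative_primI I x0 u du : open I -> is_interval I -> I x0 ->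
  {within I, continuous u} -> bmfI I du -> weak_derivative I u du ->
  primI I u du.
Proof.
move=> oI iI Ix0 cu bdu [lu ldu wd].
pose P := integral_from x0 du.
have PP := primI_integral_from iI Ix0 bdu.
have cP : {within I, continuous P} := primI_continuous oI PP.
have lP := bmfI_locally_integrable oI iI Ix0 (primI_bmfI PP).
have lh : locally_integrable I (fun x => u x - P x) by exact: locally_integrableB.
have [|c hc] := du_Bois_Reymond oI iI Ix0 lh.
  move=> phi tphi; have sphi : smooth phi by case: tphi.
  have [a [b [axb abI p0]]] := test_function_support oI iI Ix0 tphi.
  have Ia : I a by apply: abI; rewrite /= in_itv/= lexx; lra.
  have Ib : I b by apply: abI; rewrite /= in_itv/= lexx; lra.
  have ab : a <= b by lra.
  have pa : phi a = 0 by apply: (p0 a _).1; rewrite in_itv/= ltxx.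
  have pb : phi b = 0 by apply: (p0 b _).1; rewrite in_itv/= ltxx andbF.
  have p0' x : x \notin `[a, b] -> phi x = 0 /\ derive1 phi x = 0.
    by move=> xab; apply: p0; apply: contra xab; exact: subset_itv_oo_cc.
  have Pphi := smooth_prim a b sphi.
  have := wd phi tphi.
  rewrite (Rintegral_segment mu abI); last by move=> x /p0'[_ ->]; rewrite mulr0.
  rewrite (Rintegral_segment mu abI); last by move=> x /p0'[-> _]; rewrite mulr0.
  rewrite -(integral_by_parts ab (PP a b Ia Ib) Pphi pa pb) => E.
  rewrite (Rintegral_segment mu abI); last by move=> x /p0'[_ ->]; rewrite mulr0.
  have bu := continuous_bmfI iI cu Ia Ib.
  have bphi := prim_bmf_deriv Pphi.
  have bP := primI_bmfI PP Ia Ib.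
  transitivity (\int[mu]_(t in `[a, b]) (u t * derive1 phi t - P t * derive1 phi t)).
    by apply: eq_segI => t _; rewrite mulrBl.
  by rewrite segIB ?E ?subrr//; exact: bmfM.
have uP x : I x -> P x + c = u x.
  move=> Ix; have [a ax Ia] := open_smaller oI Ix; have [b xb Ib] := open_bigger oI Ix.
  suff /eqP : u x - P x = c by rewrite subr_eq addrC => /eqP.
  apply: (@ae_eq_continuous (fun t => u t - P t) a b c x); last by rewrite ax.
    move=> t; apply: continuousB; [exact: (within_continuous_segment iI cu Ia Ib)|].
    exact: (within_continuous_segment iI cP Ia Ib).
  by apply: hc; exact: itv_subset.
have duE x : I x -> du x + 0 = du x by rewrite addr0.
exact: (@eq_primI I (fun x => P x + c) (fun x => du x + 0) u du iI uP duE
  (primID PP (primI_cst c))).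
Qed.

End primitives_on_interval.

(** * Changing an integrand on a null set *)

Section ae_integral.
Context d (T : measurableType d) (R : realType) (m : {measure set T -> \bar R}).
Implicit Types (D N : set T).

Import HBNNSimple.

(* No measurability is assumed: the classical derivative of a Lipschitz function
   is only known almost everywhere, and Lebesgue measure on the Borel sets is not
   complete. *)
Let ge0_negligible_le_integral (f g : T -> \bar R) N :
  (forall x, 0 <= f x)%E -> (forall x, 0 <= g x)%E -> measurable N -> m N = 0%E ->
  (forall x, ~ N x -> f x = g x) -> (\int[m]_x f x <= \int[m]_x g x)%E.
Proof.
move=> f0 g0 mN mN0 fg; rewrite !ge0_integralTE//.
apply: ub_ereal_sup => _ [h hf <-].
have mNC : measurable (~` N) by exact: measurableC.
(* A simple function below [f], once set to 0 on [N], lies below [g] and keeps its integral. *)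
have -> : sintegral m h = sintegral m (proj_nnsfun h mNC).
  rewrite -!integralT_nnsfun; apply: ge0_ae_eq_integral => //=.
  - exact/measurable_EFinP.
  - by apply/measurable_EFinP; exact: (measurable_funPT (proj_nnsfun h mNC)).
  - by move=> x _; rewrite lee_fin.
  - by move=> x _; rewrite lee_fin /= mulr_ge0.
  - exists N; split => // x /= /not_implyP[_ hx].
    apply: contrapT => Nx; apply: hx.
    by rewrite /= mindicE mem_set// mulr1.
apply: ereal_sup_ubound; exists (proj_nnsfun h mNC) => //= x.
rewrite mindicE; have [xN|xN] := boolP (x \in ~` N).
  by rewrite mulr1 -fg//; exact/set_mem.
by rewrite mulr0.
Qed.

Let ge0_negligible_eq_integral (f g : T -> \bar R) N :
  (forall x, 0 <= f x)%E -> (forall x, 0 <= g x)%E -> measurable N -> m N = 0%E ->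
  (forall x, ~ N x -> f x = g x) -> (\int[m]_x f x = \int[m]_x g x)%E.
Proof.
move=> f0 g0 mN mN0 fg; apply/eqP; rewrite eq_le.
by rewrite (ge0_negligible_le_integral f0 g0 mN mN0)//
  (ge0_negligible_le_integral g0 f0 mN mN0)// => x /fg.
Qed.

Lemma negligible_eq_Rintegral (f g : T -> R) D N : measurable N -> m N = 0%E ->
  (forall x, D x -> ~ N x -> f x = g x) ->
  \int[m]_(x in D) f x = \int[m]_(x in D) g x.
Proof.
move=> mN mN0 fg; rewrite [LHS]Rintegral_mkcond [RHS]Rintegral_mkcond; congr fine.
have fgN x : ~ N x -> (f \_ D) x = (g \_ D) x.
  by move=> Nx; rewrite !patchE; case: ifPn => // /set_mem Dx; exact: fg.
rewrite integralE [RHS]integralE; congr (_ - _)%E;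
  apply: (ge0_negligible_eq_integral _ _ mN mN0) => x //.
- by move=> /fgN E; rewrite !funeposE/= E.
- by move=> /fgN E; rewrite !funenegE/= E.
Qed.

End ae_integral.

(** * Distribution functions of signed Radon measures and integration by parts *)

Section mass.
Context {R : realType}.
Notation T := (measurableTypeR R).
Notation mu := (@lebesgue_measure R).
Variables (I : set R) (s : {measure set T -> \bar R}) (k : R -> R) (x0 : R).
Hypotheses (iI : is_interval I) (Ix0 : I x0).
Hypothesis s_fin : forall K : set R, compact K -> K `<=` I -> (s K < +oo)%E.
Hypothesis bk : bmfI I k.
Implicit Types (a b x y : R).

Lemma mass_finite a b : I a -> I b -> (s `]a, b]%classic < +oo)%E.
Proof.
move=> Ia Ib; apply: le_lt_trans (s_fin (@segment_compact R a b) (itv_subset iI Ia Ib)).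
by rewrite le_measure ?inE//; exact: subset_itv_oc_cc.
Qed.

Lemma mass_integrable a b f : I a -> I b -> bmf a b f ->
  s.-integrable `]a, b] (EFin \o f).
Proof.
move=> Ia Ib [mf [M fM]]; apply: (@finite_bounded_integrable _ _ _ _ M) => //.
- exact: mass_finite.
- by apply: measurable_funS mf => //; exact: subset_itv_oc_cc.
- by move=> x xab; apply: fM; exact: subset_itv_oc_cc.
Qed.

(** The analogue of [integral_from] for a measure that may have atoms: half-open intervals keep it
    additive, each atom being counted once. *)
Definition mass_from x :=
  \int[s]_(y in `]x0, x]) k y - \int[s]_(y in `]x, x0]) k y.

Lemma mass_chasles a b c : I a -> I c -> a <= b -> b <= c ->
  \int[s]_(y in `]a, c]) k y =
  \int[s]_(y in `]a, b]) k y + \int[s]_(y in `]b, c]) k y.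
Proof.
move=> Ia Ic ab bc.
have E : `]a, c]%classic = `]a, b]%classic `|` `]b, c]%classic.
  apply/seteqP; split=> x; rewrite /= !in_itv/=.
    by move=> /andP[-> ->]; case: (leP x b) => _; [left|right].
  by move=> [/andP[-> xb]|/andP[bx ->]]; rewrite ?(le_trans xb)// (le_lt_trans ab).
rewrite E Rintegral_setU// -?E; first exact: mass_integrable (bk Ia Ic).
apply/disj_setPS => x [/=]; rewrite !in_itv/= => /andP[_ xb] /andP[].
by rewrite ltNge xb.
Qed.

Lemma mass_fromB a x : I a -> I x -> a <= x ->
  mass_from x - mass_from a = \int[s]_(y in `]a, x]) k y.
Proof.
move=> Ia Ix ax; have rev y z : z <= y -> \int[s]_(t in `]y, z]) k t = 0.
  by move=> zy; rewrite set_itv_ge ?Rintegral_set0// bnd_simp -leNgt.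
rewrite /mass_from; have [x0a|ax0] := leP x0 a.
  rewrite (rev _ _ x0a) (rev _ _ (le_trans x0a ax)) !subr0.
  by rewrite (mass_chasles Ix0 Ix x0a ax) addrC addKr.
have [x0x|xx0] := leP x0 x.
  rewrite (rev _ _ (ltW ax0)) (rev _ _ x0x) subr0 sub0r opprK.
  by rewrite (mass_chasles Ia Ix (ltW ax0) x0x) addrC.
rewrite (rev _ _ (ltW ax0)) (rev _ _ (ltW xx0)).
by rewrite (mass_chasles Ia Ix0 ax (ltW xx0)); ring.
Qed.

Let kM a b : I a -> I b -> exists K, forall x, x \in `]a, b] -> `|k x| <= K.
Proof.
move=> Ia Ib; have [_ [K kK]] := bk Ia Ib; exists K => x xab.
by apply: kK; exact: subset_itv_oc_cc.
Qed.

Let mk a b : I a -> I b -> measurable_fun (`]a, b]%classic : set T) k.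
Proof.
move=> Ia Ib; have [m_ _] := bk Ia Ib; apply: measurable_funS m_ => //.
exact: subset_itv_oc_cc.
Qed.

Lemma mass_fromE a b x : I a -> I b -> x \in `[a, b] ->
  mass_from x = \int[s]_(y in `]a, x]) k y + mass_from a.
Proof.
rewrite in_itv/= => Ia Ib /andP[ax xb]; rewrite -mass_fromB ?subrK//.
by apply: (iI Ia Ib); rewrite ax.
Qed.

Lemma bmfI_mass_from : bmfI I mass_from.
Proof.
move=> a b Ia Ib; have [K kK] := kM Ia Ib.
have := bmfD (bmf_mass (mass_finite Ia Ib) (mk Ia Ib) kK) (bmf_cst a b (mass_from a)).
by apply: eq_bmf => x xab; rewrite (mass_fromE Ia Ib xab).
Qed.

(** On [a, b] the function [mass_from] differs from the mass of ]a, x] by a constant, which the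
    integral of [f], equal to F b - F a = 0, does not see. *)
Lemma parts_mass a b F f : a <= b -> I a -> I b -> prim a b F f ->
  F a = 0 -> F b = 0 ->
  \int[s]_(y in `]a, b]) (F y * k y) = - \int[mu]_(x in `[a, b]) (f x * mass_from x).
Proof.
move=> ab Ia Ib PF Fa Fb; have [K kK] := kM Ia Ib.
have fin := mass_finite Ia Ib; have m_ := mk Ia Ib.
rewrite (prim_parts_measure fin m_ kK PF Fb); congr (- _).
have bf := prim_bmf_deriv PF; have bH := bmf_mass fin m_ kK.
have -> : \int[mu]_(x in `[a, b]) (f x * mass_from x) =
    \int[mu]_(x in `[a, b]) (f x * \int[s]_(y in `]a, x]) k y + mass_from a * f x).
  by apply: eq_segI => x xab; rewrite (mass_fromE Ia Ib xab) mulrDr (mulrC (mass_from a)).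
rewrite segID; [|exact: bmfM|by apply: bmfM => //; exact: bmf_cst].
by rewrite segIZ// (prim_ftc ab PF) Fa Fb subrr mulr0 addr0.
Qed.

Lemma parts_massI a b F f : a <= b -> I a -> I b -> prim a b F f ->
  (forall x, x \notin `]a, b[ -> F x = 0) ->
  \int[s]_(y in I) (F y * k y) = - \int[mu]_(x in `[a, b]) (f x * mass_from x).
Proof.
move=> ab Ia Ib PF F0; rewrite -(parts_mass ab Ia Ib PF); last 2 first.
- by apply: F0; rewrite in_itv/= ltxx.
- by apply: F0; rewrite in_itv/= ltxx andbF.
apply: Rintegral_support => [x xab|x Ix xab].
  by apply: (itv_subset iI Ia Ib); exact: subset_itv_oc_cc.
rewrite F0 ?mul0r//; apply/negP => xab'; apply: xab; exact: subset_itv_oo_oc.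
Qed.

End mass.

(** * The quadratic form rewritten without the measure *)

Section energy.
Context {R : realType}.
Notation T := (measurableTypeR R).
Notation mu := (@lebesgue_measure R).
Variables (I : set R) (m w dw : R -> R) (nu : signed_radon I) (x0 : R).
Hypotheses (oI : open I) (iI : is_interval I) (Ix0 : I x0).
Hypotheses (cm : {within I, continuous m}) (m_gt0 : forall x, I x -> 0 < m x).
Hypotheses (w_gt0 : forall x, I x -> 0 < w x) (Pw : primI I w dw).
Implicit Types (a b x y : R).

Lemma bmfI_sgn : bmfI I (sgn nu).
Proof.
move=> a b Ia Ib; split.
  apply: measurable_funS (@sgn_measurable _ _ nu); first exact: open_measurable.
  exact: itv_subset.
exists 1 => x xab; have Ix := itv_subset iI Ia Ib xab.
by have [->|->] := @sgn_pm1 _ _ nu x Ix; rewrite ?normrN normr1.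
Qed.

Definition massN := mass_from (tv nu) (fun x => m x * sgn nu x) x0.

Lemma bmfI_density : bmfI I (fun x => m x * sgn nu x).
Proof. by apply: bmfIM; [exact: continuous_bmfI|exact: bmfI_sgn]. Qed.

Lemma bmfI_massN : bmfI I massN.
Proof. exact: bmfI_mass_from iI Ix0 (@tv_finite _ _ nu) bmfI_density. Qed.

Lemma bmfI_wV : bmfI I (fun x => (w x)^-1).
Proof. by apply: bmfI_V => //; exact: primI_continuous Pw. Qed.

(** The derivative is a separate argument, so that the form applies to a Lipschitz function with any
    version of its derivative. *)
Definition quad a b (f f' : R -> R) : R :=
  \int[mu]_(t in `[a, b]) (f' t ^+ 2 * (w t)^-1 + 2 * (f t * f' t) * massN t).

Lemma integral_L0 a b f : a < b -> I a -> I b -> smooth f ->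
  (forall x, x \notin `]a, b[ -> f x = 0) ->
  \int[mu]_(x in I) (L0 m w f x * f x * m x) =
  - \int[mu]_(t in `[a, b]) (derive1 f t ^+ 2 * (w t)^-1).
Proof.
move=> ab Ia Ib sf f0; have abI := itv_subset iI Ia Ib.
have Pf := smooth_prim a b sf.
have Pf' := smooth_prim a b (smooth_derive1 sf).
have w0 x : x \in `[a, b] -> 0 < w x by move=> /abI; exact: w_gt0.
have PV := primV (Pw Ia Ib) w0.
have PF := primM PV Pf'.
have fa : f a = 0 by apply: f0; rewrite in_itv/= ltxx.
have fb : f b = 0 by apply: f0; rewrite in_itv/= ltxx andbF.
have := integral_by_parts (ltW ab) PF Pf fa fb => E.
transitivity (- \int[mu]_(t in `[a, b]) ((w t)^-1 * derive1 f t * derive1 f t)); last first.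
  by congr (- _); apply: eq_segI => t _; rewrite expr2; ring.
rewrite E opprK (Rintegral_segment mu abI); last first.
  by move=> x xab; rewrite f0 ?mulr0 ?mul0r//; apply: contra xab; exact: subset_itv_oo_cc.
(* Off the null set [N] the function [w] has derivative [dw], so the outer [derive1] in [L0] is
   given by the product rule; at the endpoints [f] vanishes. *)
have [N [mN N0 sN]] := prim_ae_derive (Pw Ia Ib).
apply: (@negligible_eq_Rintegral _ _ _ mu _ _ _ N) => // x xab Nx.
have [xo|/f0 ->] := boolP (x \in `]a, b[); last by rewrite !mulr0 mul0r.
have dwx : is_derive x 1 w (dw x).
  apply: contrapT => nd; apply: Nx; apply: sN => /= H; apply: nd; apply: H.
  by move: xo; rewrite in_itv.
have wx : w x != 0 by rewrite gt_eqF// w0.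
have mx : m x != 0 by rewrite gt_eqF// (m_gt0 (abI _ xab)).
have := is_deriveM1 (is_deriveV1 wx dwx) (smooth_is_derive x (smooth_derive1 sf)).
move=> /is_derive1E D; rewrite /L0 D.
have cancel_m p q : (m x)^-1 * p * q * m x = p * q by field.
exact: cancel_m.
Qed.

(** The measure term is integrated by parts with F = f^2 and F' = 2 f f', which trades [nu] for the
    locally bounded function [massN]. *)
Lemma energyE a b f : a < b -> I a -> I b -> smooth f ->
  (forall x, x \notin `]a, b[ -> f x = 0) ->
  \int[mu]_(x in I) (L0 m w f x * f x * m x)
    + signed_integral nu I (fun x => f x ^+ 2 * m x) = - quad a b f (derive1 f).
Proof.
move=> ab Ia Ib sf f0; rewrite (integral_L0 ab Ia Ib sf f0).
have Pf := smooth_prim a b sf.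
have Pff := primM Pf Pf.
have ff0 x : x \notin `]a, b[ -> f x * f x = 0 by move=> /f0->; rewrite mul0r.
have := parts_massI iI Ix0 (@tv_finite _ _ nu) bmfI_density (ltW ab) Ia Ib Pff ff0.
rewrite /signed_integral => E.
have -> : \int[tv nu]_(x in I) (f x ^+ 2 * m x * sgn nu x) =
    \int[tv nu]_(x in I) (f x * f x * (m x * sgn nu x)).
  by apply: eq_Rintegral => x _; rewrite expr2 mulrA.
rewrite E -opprD; congr (- _); rewrite /quad -/massN segID.
- by congr (_ + _); apply: eq_segI => t _; ring.
- apply: bmfM; last exact: bmfI_wV.
  by have bf1 := prim_bmf_deriv Pf; exact: (bmfM bf1 bf1).
- apply: bmfM; last exact: bmfI_massN.
  apply: bmfM; first exact: bmf_cst.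
  by apply: bmfM; [exact: prim_bmf Pf|exact: prim_bmf_deriv Pf].
Qed.

End energy.

(** * A positive solution makes the form nonpositive *)

Section positive_solution_form.
Context {R : realType}.
Notation T := (measurableTypeR R).
Notation mu := (@lebesgue_measure R).
Variables (I : set R) (m w dw : R -> R) (nu : signed_radon I) (x0 : R).
Hypotheses (oI : open I) (iI : is_interval I) (Ix0 : I x0).
Hypotheses (cm : {within I, continuous m}) (m_gt0 : forall x, I x -> 0 < m x).
Hypotheses (w_gt0 : forall x, I x -> 0 < w x) (Pw : primI I w dw).
Implicit Types (a b x y : R).

Lemma segment_endpoints a b x : a < x < b -> `[a, b]%classic `<=` I -> I a /\ I b.
Proof.
move=> /andP[ax xb] abI; have ab := ltW (lt_trans ax xb).
by split; apply: abI; rewrite /= in_itv/= lexx ab.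
Qed.

(* A function whose distributional derivative is a measure is, up to a constant,
   almost everywhere the distribution function of that measure. *)
Lemma measure_derivative_ae (rho : signed_radon I) g : measure_derivative g rho ->
  exists c, forall a b, `[a, b]%classic `<=` I ->
    {ae mu, forall x, a < x < b -> g x = mass_from (tv rho) (sgn rho) x0 x + c}.
Proof.
move=> [lg gphi]; set M := mass_from _ _ _.
have bs := bmfI_sgn rho oI iI.
have bM : bmfI I M := bmfI_mass_from iI Ix0 (@tv_finite _ _ rho) bs.
have lM := bmfI_locally_integrable oI iI Ix0 bM.
have lh : locally_integrable I (fun x => g x - M x) by exact: locally_integrableB.
have [|c hc] := du_Bois_Reymond oI iI Ix0 lh; last first.
  exists c => a b abI; apply: ae_imp (hc a b abI) => x H /H/eqP.
  by rewrite subr_eq addrC => /eqP.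
move=> phi tphi; have sphi : smooth phi by case: tphi.
have [a [b [axb abI p0]]] := test_function_support oI iI Ix0 tphi.
have [Ia Ib] := segment_endpoints axb abI.
have ab : a <= b by lra.
have p0' x : x \notin `[a, b] -> derive1 phi x = 0.
  by move=> xab; apply: (p0 _ _).2; apply: contra xab; exact: subset_itv_oo_cc.
have Pphi := smooth_prim a b sphi.
have := gphi phi tphi; rewrite /signed_integral.
rewrite (parts_massI iI Ix0 (@tv_finite _ _ rho) bs ab Ia Ib Pphi (fun x h => (p0 x h).1)).
rewrite opprK !(Rintegral_segment mu abI); last 2 first.
- by move=> x /p0' ->; rewrite mulr0.
- by move=> x /p0' ->; rewrite mulr0.
move=> E.
have bphi := prim_bmf_deriv Pphi.
transitivity (\int[mu]_(t in `[a, b]) (g t * derive1 phi t - derive1 phi t * M t)).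
  by apply: eq_segI => t _; rewrite mulrBl (mulrC (M t)).
rewrite RintegralB//; first by rewrite E subrr.
- exact: integrable_bmfM (locally_integrable_segment lg abI) bphi.
- by apply: bmf_integrable; apply: bmfM => //; exact: bM.
Qed.

(** Lets the merely locally integrable [du] given by [L_null] be replaced by a locally bounded
    version, to which [weak_derivative_primI] applies. *)
Lemma weak_derivative_ae u du du1 : weak_derivative I u du -> bmfI I du1 ->
  (forall a b, `[a, b]%classic `<=` I ->
    {ae mu, forall x, a < x < b -> du x = du1 x}) ->
  weak_derivative I u du1.
Proof.
move=> [lu ldu wd] b1 ae1; split => //.
  exact: bmfI_locally_integrable oI iI Ix0 b1.
move=> phi tphi; rewrite wd//; congr (- _).
have [a [b [axb abI p0]]] := test_function_support oI iI Ix0 tphi.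
have p0' x : x \notin `[a, b] -> phi x = 0.
  by move=> xab; apply: (p0 _ _).1; apply: contra xab; exact: subset_itv_oo_cc.
rewrite !(Rintegral_segment mu abI); last 2 first.
- by move=> x /p0' ->; rewrite mulr0.
- by move=> x /p0' ->; rewrite mulr0.
have [N [mN N0 sN]] := ae1 a b abI.
apply: (@negligible_eq_Rintegral _ _ _ mu _ _ _ N) => // x xab Nx.
have [xo|/p0[-> _]] := boolP (x \in `]a, b[); last by rewrite !mulr0.
congr (_ * _); apply: contrapT => nd; apply: Nx; apply: sN => /= H.
by apply: nd; apply: H; move: xo; rewrite in_itv.
Qed.

(* Jacobi's substitution: testing the equation with [f ^ 2 / u] turns the
   quadratic form into the integral of [- (f' - f u' / u) ^ 2 / w]. *)
Lemma positive_solution_form (u f : R -> R) : {within I, continuous u} ->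
  (forall x, I x -> 0 < u x) -> L_null m w nu u -> test_function I f ->
  \int[mu]_(x in I) (L0 m w f x * f x * m x)
  + signed_integral nu I (fun x => f x ^+ 2 * m x) <= 0.
Proof.
move=> cu u_gt0 [du [rho [wdu mdu Lu]]] tf.
have [c hc] := measure_derivative_ae mdu; set M := mass_from _ _ _ in hc.
have bs := bmfI_sgn rho oI iI.
have bM : bmfI I M := bmfI_mass_from iI Ix0 (@tv_finite _ _ rho) bs.
(* A locally bounded version of u' / w, defined everywhere; it may jump at the atoms of [rho]. *)
pose v x := M x + c.
have bv : bmfI I v by move=> a b Ia Ib; apply: bmfD; [exact: bM|exact: bmf_cst].
have bw := primI_bmfI Pw.
have wdu1 : weak_derivative I u (fun x => w x * v x).
  apply: (weak_derivative_ae wdu); first exact: bmfIM.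
  move=> a b abI; apply: ae_imp (hc a b abI) => x H axb.
  have Ix : I x by apply: abI; rewrite /= in_itv/=; case/andP: axb => /ltW-> /ltW->.
  by rewrite /v -H// mulVKf// gt_eqF// w_gt0.
have Pu := weak_derivative_primI oI iI Ix0 cu (bmfIM bw bv) wdu1.
have sf : smooth f by case: tf.
have [a [b [axb abI p0]]] := test_function_support oI iI Ix0 tf.
have [Ia Ib] := segment_endpoints axb abI.
have ab : a < b by lra.
have f0 x : x \notin `]a, b[ -> f x = 0 by move=> /p0[].
have u0 x : x \in `[a, b] -> 0 < u x by move=> /abI; exact: u_gt0.
have w0 x : x \in `[a, b] -> 0 < w x by move=> /abI; exact: w_gt0.
have m0 x : x \in `[a, b] -> 0 < m x by move=> /abI; exact: m_gt0.
have Pf := smooth_prim a b sf.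
have Pff := primM Pf Pf.
have PuV := primV (Pu a b Ia Ib) u0.
have PF := primM Pff PuV.
have fa : f a = 0 by apply: f0; rewrite in_itv/= ltxx.
have fb : f b = 0 by apply: f0; rewrite in_itv/= ltxx andbF.
have bm := continuous_bmfI iI cm Ia Ib.
have bmV := bmfI_V iI cm m_gt0 Ia Ib.
have bsr := bs a b Ia Ib; have bsn := bmfI_sgn nu oI iI Ia Ib.
have bu := prim_bmf (Pu a b Ia Ib); have buV := prim_bmf PuV.
have bff := prim_bmf Pff.
have oc x : `]a, b]%classic x -> x \in `[a, b] by exact: subset_itv_oc_cc.
have moc h : bmf a b h -> measurable_fun (`]a, b]%classic : set T) h.
  by move=> [mh _]; apply: measurable_funS mh => // x /oc.
have fin_nu := mass_finite iI (@tv_finite _ _ nu) Ia Ib.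
have fin_rho := mass_finite iI (@tv_finite _ _ rho) Ia Ib.
(* The equation says that [g1] against [tv nu] and [g2] against [tv rho] are the same measure. The
   factor [p] is such that p g1 = f^2 m sgn nu and p g2 = - (f^2 / u) sgn rho. *)
pose g1 x := u x * sgn nu x; pose g2 x := -1 * ((m x)^-1 * sgn rho x).
pose p x := f x * f x * (m x * (u x)^-1).
have b1 : bmf a b g1 by exact: bmfM.
have b2' : bmf a b (fun x => (m x)^-1 * sgn rho x) by exact: bmfM.
have b2 : bmf a b g2 by apply: bmfM => //; exact: bmf_cst.
have bp : bmf a b p by apply: bmfM => //; exact: bmfM.
have [K1 K10 g1K] := bmf_bound b1; have [K2 K20 g2K] := bmf_bound b2.
have [K3 K30 pK] := bmf_bound bp.
have nuE : signed_integral nu I (fun x => f x ^+ 2 * m x) =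
    \int[mu]_(x in `[a, b]) (((derive1 f x * f x + f x * derive1 f x) * (u x)^-1 +
      f x * f x * (- (w x * v x) / u x ^+ 2)) * M x).
  have -> : signed_integral nu I (fun x => f x ^+ 2 * m x) =
      \int[tv nu]_(x in `]a, b]) (p x * g1 x).
    rewrite /signed_integral (@Rintegral_support R _ T (tv nu) `]a, b]%classic I).
    - apply: eq_Rintegral => x /set_mem/oc/u0 ux; rewrite /p /g1.
      by field; rewrite gt_eqF.
    - by move=> x /oc/abI.
    - move=> x _ xab; rewrite f0 ?expr0n ?mul0r//; apply/negP => xab'.
      by apply: xab; exact: subset_itv_oo_oc.
  rewrite (@eq_signed_integral _ (tv nu) (tv rho) _ g1 g2 p (K1 + K2) K3) => //.
  - rewrite -[RHS]opprK -(parts_mass iI Ix0 (@tv_finite _ _ rho) bs (ltW ab) Ia Ib PF).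
    + rewrite -mulN1r -RintegralZl//; last first.
        by apply: (mass_integrable iI (@tv_finite _ _ rho) Ia Ib); apply: bmfM => //; exact: prim_bmf PF.
      apply: eq_Rintegral => x /set_mem/oc xab; rewrite /p /g2.
      by field; rewrite !gt_eqF ?m0 ?u0.
    + by rewrite fa mul0r mul0r.
    + by rewrite fb mul0r mul0r.
  - exact: moc.
  - exact: moc.
  - exact: moc.
  - by move=> x /oc/g1K H; rewrite (le_trans H)// lerDl.
  - by move=> x /oc/g2K H; rewrite (le_trans H)// lerDr.
  - by move=> x /oc/pK.
  - move=> A mA Aab.
    have AK : A `<=` `[a, b]%classic by move=> x /Aab/oc.
    have := Lu A `[a, b]%classic mA (@segment_compact R a b) AK abI.
    rewrite /signed_integral addrC => /eqP; rewrite addr_eq0 => /eqP ->.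
    rewrite -mulN1r -RintegralZl//.
    apply: (@integrableS _ _ _ (tv rho) `]a, b]%classic) => //.
    exact: (mass_integrable iI (@tv_finite _ _ rho) Ia Ib b2').
rewrite nuE (integral_L0 iI m_gt0 w_gt0 Pw ab Ia Ib sf f0).
set dF := (fun x => _ + f x * f x * (- (w x * v x) / u x ^+ 2)) in PF.
have bdF : bmf a b dF := prim_bmf_deriv PF.
(* Replacing [M] by [v = M + c] is free: [dF] is the derivative of f^2 / u, which vanishes at both
   ends. *)
have -> : \int[mu]_(x in `[a, b]) (((derive1 f x * f x + f x * derive1 f x) * (u x)^-1 +
    f x * f x * (- (w x * v x) / u x ^+ 2)) * M x) =
    \int[mu]_(x in `[a, b]) (dF x * v x).
  transitivity (\int[mu]_(x in `[a, b]) (dF x * v x - c * dF x)).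
    by apply: eq_segI => x _; rewrite /dF /v; ring.
  rewrite segIB; [|exact: (bmfM bdF (bv _ _ Ia Ib))|by apply: bmfM => //; exact: bmf_cst].
  by rewrite segIZ// (prim_ftc (ltW ab) PF) fa fb !mul0r subrr mulr0 subr0.
rewrite addrC subr_le0; apply: segI_le.
- exact: (bmfM bdF (bv _ _ Ia Ib)).
- apply: bmfM; last exact: (bmfI_wV oI iI w_gt0 Pw Ia Ib).
  by have bf1 := prim_bmf_deriv Pf; exact: (bmfM bf1 bf1).
move=> x xab; rewrite -subr_ge0 /dF.
have wx := w0 x xab; have ux := u0 x xab.
have -> : derive1 f x ^+ 2 * (w x)^-1 - ((derive1 f x * f x + f x * derive1 f x) * (u x)^-1 +
    f x * f x * (- (w x * v x) / u x ^+ 2)) * v x =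
    (derive1 f x - f x * (w x * v x) / u x) ^+ 2 / w x.
  by field; rewrite !gt_eqF.
by rewrite divr_ge0 ?sqr_ge0// ltW.
Qed.

End positive_solution_form.

(** * Mollification of Lipschitz functions *)

Section mollification.
Context {R : realType}.
Notation T := (measurableTypeR R).
Notation mu := (@lebesgue_measure R).
Implicit Types (a b c x y r : R) (F f h k : R -> R).

Definition conv a b F k x : R := \int[mu]_(y in `[a, b]) (F y * k (x - y)).

Lemma smooth_reflect k x : smooth k -> smooth (fun y => k (x - y)).
Proof.
move=> sk; have -> : (fun y => k (x - y)) = (fun y => k (-1 * y + x)).
  by apply/funext => y; rewrite mulN1r addrC.
exact: smooth_affine.
Qed.

Lemma is_derive_reflect k x y : smooth k ->
  is_derive y 1 (fun y => k (x - y)) (- derive1 k (x - y)).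
Proof.
move=> sk; have -> : (fun y => k (x - y)) = (fun y => k (-1 * y + x)).
  by apply/funext => z; rewrite mulN1r addrC.
apply: is_derive_eq (is_derive_affine (sk 0%N _)) _.
by rewrite mulN1r mulN1r addrC.
Qed.

Lemma prim_reflect a b k x : smooth k ->
  prim a b (fun y => k (x - y)) (fun y => - derive1 k (x - y)).
Proof.
move=> sk; apply: prim_C1 => [y _|]; first exact: is_derive_reflect.
apply: continuous_subspaceT => y; apply: cvgN.
have sk' : smooth (fun y => derive1 k (x - y)).
  by apply: smooth_reflect; exact: smooth_derive1.
exact: (smooth_continuous sk' (x:=y)).
Qed.

Lemma is_derive_conv a b F k x : bmf a b F -> smooth k ->
  is_derive x 1 (conv a b F k) (conv a b F (derive1 k) x).
Proof.
move=> bF sk; have [M M0 FM] := bmf_bound bF.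
(* This segment contains z - y for all z within distance 1 of [x] and all y in [a, b], so [K]
   dominates when differentiating under the integral. *)
have [K K0 kK] := bmf_bound (smooth_bmf (x - 1 - b) (x + 1 - a) (smooth_derive1 sk)).
have xI : `]x - 1, x + 1[%classic x by rewrite /= in_itv/=; lra.
have dk (z y : R) : is_derive z 1 (fun z => F y * k (z - y)) (F y * derive1 k (z - y)).
  have H : is_derive z 1 (fun z => k (z - y)) (derive1 k (z - y)).
    have -> : (fun z => k (z - y)) = (fun z => k (1 * z + - y)).
      by apply/funext => u; rewrite mul1r.
    by apply: is_derive_eq (is_derive_affine (sk 0%N _)) _; rewrite !mul1r.
  apply: is_derive_eq (is_deriveM1 (is_derive_cst (F y) z (1:R)) H) _.
  by rewrite mul0r add0r.
have i (z : R) : mu.-integrable `[a, b] (EFin \o (fun y => F y * k (z - y))).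
  apply: bmf_integrable; apply: bmfM => //; apply: smooth_bmf.
  exact: smooth_reflect.
have d1 (z y : R) : `]x - 1, x + 1[%classic z -> `[a, b]%classic y ->
    derivable (fun z => F y * k (z - y)) z 1 by move=> _ _; have [] := dk z y.
have ub (z y : R) : `]x - 1, x + 1[%classic z -> `[a, b]%classic y ->
    `|partial1of2 (fun z y => F y * k (z - y)) z y| <= M * K.
  rewrite /partial1of2 (is_derive1E (dk z y)) /= !in_itv/= => zx yab.
  rewrite normrM ler_pM//; first by apply: FM; rewrite in_itv.
  by apply: kK; rewrite in_itv/=; move/andP : yab; move/andP : zx => []; lra.
have MK (y : T) : 0 <= (cst (M * K) : T -> R) y by rewrite mulr_ge0.
have iMK : mu.-integrable `[a, b] (EFin \o (cst (M * K) : T -> R)).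
  exact: (bmf_integrable (bmf_cst a b (M * K))).
have D := @derivable_under_integral R _ T mu (fun z y => F y * k (z - y))
  `[a, b]%classic (measurable_itv _) x (x - 1) (x + 1) xI (fun z _ => i z) d1
  (cst (M * K)) MK iMK ub.
have E := @differentiation_under_integral R _ T mu (fun z y => F y * k (z - y))
  `[a, b]%classic (measurable_itv _) x (x - 1) (x + 1) xI (fun z _ => i z) d1
  (cst (M * K)) MK iMK ub.
have := derivable_is_derive D; rewrite E.
have -> : \int[mu]_(y in `[a, b]) (partial1of2 (fun z y => F y * k (z - y)) ^~ y) x =
    conv a b F (derive1 k) x.
  by apply: eq_segI => y _; rewrite /partial1of2 (is_derive1E (dk x y)).
by [].
Qed.

Lemma smooth_conv a b F k : bmf a b F -> smooth k -> smooth (conv a b F k).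
Proof.
move=> bF sk; apply/smoothP => n; elim: n k sk => [//|n ih] k sk /=.
have d x := is_derive_conv x bF sk.
split=> [x|]; first by have [] := d x.
have -> : derive1 (conv a b F k) = conv a b F (derive1 k).
  by apply/funext => x; exact: is_derive1E.
by apply: ih; exact: smooth_derive1.
Qed.

(** The kernel is one-sided, supported in ]0, 1[, so that convolution enlarges supports only to the
    right. Its antiderivative [H], rising from 0 to 1, encodes the unit mass. *)
Lemma smooth_unit_kernel : exists (eta H : R -> R) (C : R), [/\
  smooth eta /\ smooth H, derive1 H = eta,
  forall x, x \notin `]0, 1[ -> eta x = 0 /\ derive1 eta x = 0,
  (forall x, x <= 0 -> H x = 0) /\ (forall x, 1 <= x -> H x = 1)
  & forall x, `|eta x| <= C /\ `|derive1 eta x| <= C].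
Proof.
have o01 : open (`]0, 1[%classic : set R) by exact: itv_open.
have h01 : `]0, 1[%classic (2^-1 : R) by rewrite /= in_itv/=; lra.
have [a [b [eta [ab ab01 seta e0 ie]]]] := segment_bump o01 h01.
have /andP[a0 a1] : 0 < a < 1 by have := ab01 a; rewrite /= !in_itv/= lexx ab => /(_ isT).
have /andP[b0 b1] : 0 < b < 1 by have := ab01 b; rewrite /= !in_itv/= lexx ab => /(_ isT).
have [H [sH dH Ha Hb]] := smooth_primitive ab seta e0.
have out x : x \notin `]0, 1[ -> eta x = 0 /\ derive1 eta x = 0.
  rewrite in_itv/= negb_and -!leNgt => x01.
  have nz : \forall y \near x, 0 = eta y.
    case/orP : x01 => [x0|x1].
      have xa : x < a by exact: le_lt_trans x0 a0.
      near=> y; rewrite e0// in_itv/= negb_and -!ltNge; apply/orP; left.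
      by near: y; exact: lt_nbhsl.
    have bx : b < x by exact: lt_le_trans b1 x1.
    near=> y; rewrite e0// in_itv/= negb_and -!ltNge; apply/orP; right.
    by near: y; exact: lt_nbhsr.
  split; first by rewrite -(nbhs_singleton nz).
  by apply: is_derive1E; apply: near_eq_is_derive nz _; exact: is_derive_cst.
have [M M0 eM] := bmf_bound (smooth_bmf 0 1 seta).
have [N N0 eN] := bmf_bound (smooth_bmf 0 1 (smooth_derive1 seta)).
exists eta, H, (M + N); split => //.
- split=> x hx; first by rewrite Ha// (le_lt_trans hx).
  by rewrite Hb ?ie// (lt_le_trans b1).
- move=> x; have [x01|/out[-> ->]] := boolP (x \in `]0, 1[); last first.
    by rewrite normr0 addr_ge0.
  have x01' := subset_itv_oo_cc x01.
  by rewrite (le_trans (eM _ x01')) ?lerDl// (le_trans (eN _ x01')) ?lerDr.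
Unshelve. all: by end_near. Qed.

(* [F] is mollified over the larger segment [P, S] so that the support
   [x - 1/r, x] of the kernel at [x] never meets the endpoints. *)
Lemma mollifier (A B b : R) F f : A < b -> b < B ->
  prim (A - 2) (B + 2) F f -> (forall x, x \notin `[A, b] -> F x = 0) ->
  exists (Fn : nat -> R -> R) (L : R), [/\
    forall n, smooth (Fn n),
    forall n x, x \notin `]A, B[ -> Fn n x = 0,
    forall n x, x \in `[A, B] -> `|derive1 (Fn n) x| <= L &
    {ae mu, forall x, A < x < B -> derive1 (Fn n) x @[n --> \oo] --> f x}].
Proof.
move=> Ab bB PF F0; have [eta [H [C [[seta sH] dH eta0 [H0 H1] etaC]]]] := smooth_unit_kernel.
set P := A - 2 in PF; set S := B + 2 in PF.
have C0 : 0 <= C by rewrite (le_trans (normr_ge0 _) (etaC 0).1).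
have bF := prim_bmf PF; have bf := prim_bmf_deriv PF.
have [L L0 fL] := bmf_bound bf.
(* With [r n] >= [c], the kernel width 1 / r is at most 1, which keeps it inside [P, S], and at most
   B - b, which keeps the mollified function supported in [A, B]. *)
pose c := Num.max 1 (B - b)^-1.
have c1 : 1 <= c by rewrite le_max lexx.
have cB : (B - b)^-1 <= c by rewrite le_max lexx orbT.
pose r n : R := n.+1%:R * c.
have rc n : c <= r n by rewrite /r ler_peMl ?(le_trans ler01)// ler1n.
have r1 n : 1 <= r n by exact: le_trans (rc n).
have r0 n : 0 < r n by exact: lt_le_trans (r1 n).
have rV1 n : (r n)^-1 <= 1 by rewrite invf_le1.
have rB n : (r n)^-1 <= B - b.
  by rewrite -[leRHS]invrK lef_pV2 ?posrE ?invr_gt0 ?subr_gt0// (le_trans cB).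
pose k n z := r n * eta (r n * z).
have sk n : smooth (k n).
  apply: smoothZ; have -> : (fun z => eta (r n * z)) = (fun z => eta (r n * z + 0)).
    by apply/funext => z; rewrite addr0.
  exact: smooth_affine.
have dk n z : derive1 (k n) z = r n ^+ 2 * derive1 eta (r n * z).
  apply: is_derive1E.
  have d := is_derive_affine (d := 0) (seta 0%N (r n * z + 0)).
  have := is_deriveM1 (is_derive_cst (r n) z (1:R)) d.
  rewrite mul0r add0r addr0 mulrA -expr2.
  by under eq_fun do rewrite addr0.
have kout n z : z \notin `]0, (r n)^-1[ -> k n z = 0 /\ derive1 (k n) z = 0.
  move=> zr; rewrite dk /k; have [|-> ->] := eta0 (r n * z); last by rewrite !mulr0.
  apply: contra zr; rewrite !in_itv/= pmulr_rgt0// => /andP[-> rz].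
  by rewrite -[(r n)^-1]mul1r ltr_pdivlMr// mulrC.
have kC n z : `|k n z| <= r n * C /\ `|derive1 (k n) z| <= r n ^+ 2 * C.
  have [e1 e2] := etaC (r n * z); have rn := ltW (r0 n).
  split; first by rewrite /k normrM (ger0_norm rn) ler_wpM2l.
  rewrite dk normrM (ger0_norm (x := r n ^+ 2)) ?exprn_ge0//.
  by rewrite ler_wpM2l// exprn_ge0.
have sk' n x : smooth (fun y => k n (x - y)) := @smooth_reflect _ x (sk n).
have skd' n x : smooth (fun y => derive1 (k n) (x - y)) :=
  @smooth_reflect _ x (smooth_derive1 (sk n)).
pose Fn n := conv P S F (k n).
have dFn n x : derive1 (Fn n) x = conv P S F (derive1 (k n)) x.
  exact: (is_derive1E (is_derive_conv x bF (sk n))).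
have loc n x g : x \in `[A, B] -> (forall y, y \notin `[x - (r n)^-1, x] -> g y = 0) ->
    \int[mu]_(y in `[P, S]) g y = \int[mu]_(y in `[x - (r n)^-1, x]) g y.
  rewrite in_itv/= => /andP[Ax xB] g0; apply: (Rintegral_segment mu) => //.
  apply: subset_itvScc; rewrite bnd_simp /P /S; last by lra.
  by have := rV1 n; lra.
have locz n x y : y \notin `[x - (r n)^-1, x] -> x - y \notin `]0, (r n)^-1[.
  apply: contra; rewrite !in_itv/= => /andP[h1 h2].
  by apply/andP; split; lra.
have PSle : P <= S by rewrite /P /S; lra.
have xr n x : x - (r n)^-1 <= x by rewrite gerBl invr_ge0 ltW.
exists Fn, (L * C); split.
- by move=> n; exact: (smooth_conv bF (sk n)).
- move=> n x xAB; rewrite /Fn /conv; transitivity (\int[mu]_(y in `[P, S]) (0 : R)); last first.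
    by rewrite segI_cst// mul0r.
  apply: eq_segI => y _; have [yAb|/F0->] := boolP (y \in `[A, b]); last by rewrite mul0r.
  have [|-> _] := kout n (x - y); last by rewrite mulr0.
  apply: contra xAB; move: yAb; rewrite !in_itv/= => /andP[Ay yb] /andP[h1 h2].
  by have := rB n => rBn; apply/andP; split; lra.
- move=> n x xAB; rewrite dFn.
  have FP : F P = 0.
    by apply: F0; rewrite in_itv/= negb_and -!ltNge; apply/orP; left; rewrite /P; lra.
  have FS : F S = 0.
    by apply: F0; rewrite in_itv/= negb_and -!ltNge; apply/orP; right; rewrite /S; lra.
  (* The derivative moves from the kernel to [F]: then |f| <= L and |k n| <= r C on an interval of
     length 1 / r give the bound L C. *)
  have := integral_by_parts PSle (prim_reflect P S x (sk n)) PF FP FS => E.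
  have -> : conv P S F (derive1 (k n)) x = \int[mu]_(y in `[P, S]) (k n (x - y) * f y).
    rewrite E -segIN; first by apply: eq_segI => y _; rewrite mulNr opprK mulrC.
    exact: (bmfM (bmfN (smooth_bmf _ _ (skd' n x))) bF).
  have g0 y : y \notin `[x - (r n)^-1, x] -> k n (x - y) * f y = 0.
    by move=> /locz/kout[-> _]; rewrite mul0r.
  rewrite (loc n x _ xAB g0).
  rewrite (@le_trans _ _ (r n * C * L * (x - (x - (r n)^-1))))//.
    apply: segI_norm_le => //.
      apply: bmfM; first exact: (smooth_bmf _ _ (sk' n x)).
      move: xAB; rewrite in_itv/= => /andP[Ax xB]; apply: bmf_itv bf _ _; rewrite /P /S; last lra.
      by have := rV1 n; lra.
    move=> y; rewrite in_itv/= => /andP[y1 y2]; rewrite normrM ler_pM ?(kC n _).1//.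
    apply: fL; move: xAB; rewrite !in_itv/= /P /S => /andP[Ax xB]; have := rV1 n.
    by move=> ?; apply/andP; split; lra.
  have -> : r n * C * L * (x - (x - (r n)^-1)) = L * C by field; rewrite gt_eqF.
  by [].
apply: ae_imp (prim_ae_derive PF) => x dF /andP[Ax xB].
have {dF} dF : is_derive x 1 F (f x).
  by apply: dF; rewrite /P /S; apply/andP; split; lra.
have xAB : x \in `[A, B] by rewrite in_itv/= !ltW.
(* The moments of orders 0 and 1 of the differentiated kernel about [x] are 0 and 1. Hence
   [derive1 (Fn n) x - f x] depends only on the first-order Taylor remainder of [F] at [x]. *)
have id1 n : \int[mu]_(y in `[P, S]) derive1 (k n) (x - y) = 0.
  have := prim_ftc PSle (primN (prim_reflect P S x (sk n))).
  under eq_segI => y _ do rewrite opprK.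
  move=> ->.
  have [|-> _] := kout n (x - S).
    by rewrite in_itv/= negb_and -!leNgt; apply/orP; left; rewrite /S; lra.
  have [|-> _] := kout n (x - P); last by rewrite subrr.
  rewrite in_itv/= negb_and -!leNgt; apply/orP; right.
  by rewrite (le_trans (rV1 n))// /P; lra.
have id2 n : \int[mu]_(y in `[P, S]) ((y - x) * derive1 (k n) (x - y)) = 1.
  pose G y := - ((y - x) * k n (x - y) + H (r n * (x - y))).
  have dG y : is_derive y 1 G ((y - x) * derive1 (k n) (x - y)).
    have dy : is_derive y 1 (fun y : R => y - x) 1.
      apply: is_derive_eq (is_deriveD1 (is_derive_id y (1:R)) (is_derive_cst (- x) y (1:R))) _.
      by rewrite addr0.
    have dH' : is_derive y 1 (fun y => H (r n * (x - y))) (- k n (x - y)).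
      have -> : (fun y => H (r n * (x - y))) = (fun y => H (- r n * y + r n * x)).
        by apply/funext => z; congr H; ring.
      apply: is_derive_eq (is_derive_affine (sH 0%N _)) _.
      rewrite dH /k mulNr; congr (- (_ * eta _)); ring.
    have D := is_deriveD1 (is_deriveM1 dy (is_derive_reflect x y (sk n))) dH'.
    apply: is_derive_eq (is_deriveN D) _; ring.
  have PG : prim P S G (fun y => (y - x) * derive1 (k n) (x - y)).
    apply: (prim_C1 (fun y _ => dG y)).
    apply: continuous_subspaceT => y; apply: cvgM.
      by apply: cvgB; [exact: cvg_id|exact: cvg_cst].
    exact: (smooth_continuous (skd' n x) (x:=y)).
  rewrite (prim_ftc PSle PG) /G.
  have [|-> _] := kout n (x - S).
    by rewrite in_itv/= negb_and -!leNgt; apply/orP; left; rewrite /S; lra.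
  have xP : (r n)^-1 <= x - P by rewrite (le_trans (rV1 n))// /P; lra.
  have [|-> _] := kout n (x - P).
    by rewrite in_itv/= negb_and -!leNgt xP orbT.
  rewrite H0; last by rewrite mulr_ge0_le0 ?(ltW (r0 n))//; rewrite /S; lra.
  rewrite H1; last by rewrite mulrC -ler_pdivrMr// mul1r.
  by rewrite !mulr0 !add0r oppr0 sub0r opprK.
apply/cvgrPdist_le => e e0.
(* The remainder is at most e' / r, the differentiated kernel at most r^2 C, and the interval has
   length 1 / r: the product is e' C <= e. *)
have e'0 : 0 < e / (C + 1) by rewrite divr_gt0// ltr_wpDl.
set e' := e / (C + 1) in e'0.
have : \forall y \near x, `|F y - F x - f x * (y - x)| <= e' * `|y - x|.
  have /cvgrPdist_le/(_ e' e'0) := is_derive_cvg dF.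
  rewrite near_withinE /= => nh.
  have : \forall y \near x, (fun t : R => t != 0 -> `|f x - t^-1 * (F (t + x) - F x)| <= e') (y - x).
    have cx : (fun y : R => y - x) y @[y --> x] --> (0 : R).
      by rewrite -(subrr x); apply: cvgB; [exact: cvg_id|exact: cvg_cst].
    exact: (cx _ nh).
  apply: filterS => y; have [->|yx] := eqVneq y x.
    by rewrite !subrr mulr0 subrr !normr0 mulr0.
  have yx0 : y - x != 0 by rewrite subr_eq0.
  move=> /(_ yx0); rewrite subrK => h.
  have -> : F y - F x - f x * (y - x) = - (f x - (y - x)^-1 * (F y - F x)) * (y - x).
    by field.
  by rewrite normrM normrN ler_wpM2r.
move=> /nbhs_ballP[d /= d0 nd].
have [N N0] : exists N : nat, d^-1 < N%:R.
  exists (Num.truncn d^-1).+1; have := truncnS_gt d^-1; by [].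
near=> n; rewrite dFn /conv.
have rd : (r n)^-1 < d.
  rewrite -[ltRHS]invrK ltf_pV2 ?posrE ?invr_gt0// (lt_le_trans N0)//.
  apply: (@le_trans _ _ n.+1%:R); last by rewrite /r ler_peMr.
  by rewrite ler_nat ltnW// ltnS; near: n; exact: nbhs_infty_ge.
have bk : bmf P S (fun y => derive1 (k n) (x - y)).
  exact: (smooth_bmf _ _ (skd' n x)).
have byx : bmf P S (fun y : R => y - x) by apply: bmfB; [exact: prim_bmf (prim_id P S)|exact: bmf_cst].
have -> : f x - \int[mu]_(y in `[P, S]) (F y * derive1 (k n) (x - y)) =
    - \int[mu]_(y in `[P, S]) ((F y - F x - f x * (y - x)) * derive1 (k n) (x - y)).
  have -> : \int[mu]_(y in `[P, S]) ((F y - F x - f x * (y - x)) * derive1 (k n) (x - y)) =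
      \int[mu]_(y in `[P, S]) (F y * derive1 (k n) (x - y) -
        (F x * derive1 (k n) (x - y) + f x * ((y - x) * derive1 (k n) (x - y)))).
    by apply: eq_segI => y _; ring.
  have b1 : bmf P S (fun y => F x * derive1 (k n) (x - y)) by apply: bmfM => //; exact: bmf_cst.
  have b2 : bmf P S (fun y => (y - x) * derive1 (k n) (x - y)) by exact: bmfM.
  have b3 : bmf P S (fun y => f x * ((y - x) * derive1 (k n) (x - y))).
    by apply: bmfM => //; exact: bmf_cst.
  rewrite segIB; [|exact: bmfM|exact: bmfD].
  by rewrite segID// !segIZ// id1 id2 mulr0 add0r mulr1 opprB.
rewrite normrN.
have g0 y : y \notin `[x - (r n)^-1, x] ->
    (F y - F x - f x * (y - x)) * derive1 (k n) (x - y) = 0.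
  by move=> /locz/kout[_ ->]; rewrite mulr0.
rewrite (loc n x _ xAB g0).
apply: (@le_trans _ _ (e' * (r n)^-1 * (r n ^+ 2 * C) * (x - (x - (r n)^-1)))).
  apply: segI_norm_le => //.
    apply: (@bmf_itv _ P S); last 2 first.
    - by have := rV1 n; rewrite /P; lra.
    - by rewrite /S; lra.
    apply: bmfM => //; apply: bmfB; first by apply: bmfB => //; exact: bmf_cst.
    by apply: bmfM => //; exact: bmf_cst.
  move=> y; rewrite in_itv/= => /andP[y1 y2]; rewrite normrM ler_pM ?(kC n _).2//.
  have yx : `|y - x| <= (r n)^-1 by rewrite ler0_norm ?subr_le0//; lra.
  apply: (le_trans (nd y _)); first by rewrite /ball/= distrC (le_lt_trans yx).
  by rewrite ler_wpM2l// ltW.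
have -> : e' * (r n)^-1 * (r n ^+ 2 * C) * (x - (x - (r n)^-1)) = e * (C / (C + 1)).
  by rewrite /e'; field; rewrite !gt_eqF//= ltr_wpDl.
by rewrite ler_piMr ?(ltW e0)// ler_pdivrMr ?ltr_wpDl// mul1r lerDl.
Unshelve. all: by end_near. Qed.

End mollification.

(** * Nonnegativity of the form on compactly supported Lipschitz functions *)

Section quad_extension.
Context {R : realType}.
Notation T := (measurableTypeR R).
Notation mu := (@lebesgue_measure R).
Variables (I : set R) (m w dw : R -> R) (nu : signed_radon I) (x0 : R).
Hypotheses (oI : open I) (iI : is_interval I) (Ix0 : I x0).
Hypotheses (cm : {within I, continuous m}) (m_gt0 : forall x, I x -> 0 < m x).
Hypotheses (w_gt0 : forall x, I x -> 0 < w x) (Pw : primI I w dw).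
Hypothesis form_le0 : forall f : R -> R, test_function I f ->
  \int[mu]_(x in I) (L0 m w f x * f x * m x)
  + signed_integral nu I (fun x => f x ^+ 2 * m x) <= 0.
Implicit Types (A B b x : R) (F f : R -> R).

(** The form is nonnegative on the mollifications of [F] and passes to the limit by dominated
    convergence: their derivatives are bounded and converge almost everywhere, and so, integrating
    from [A], do the functions themselves. The gap between [b] and [B] leaves room for the mollified
    support. *)
Lemma quad_ge0 A b B F f : A < b -> b < B -> I A -> I B ->
  prim (A - 2) (B + 2) F f -> (forall x, x \notin `]A, b[ -> F x = 0) ->
  0 <= quad m w nu x0 A B F f.
Proof.
move=> Ab bB IA IB PF F0; have AB := lt_trans Ab bB.
have F0' x : x \notin `[A, b] -> F x = 0.
  by move=> xAb; apply: F0; apply: contra xAb; exact: subset_itv_oo_cc.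
have [Fn [L [sFn Fn0 dFnL dFn]]] := mollifier Ab bB PF F0'.
have ABI := itv_subset iI IA IB.
have Qn n : 0 <= quad m w nu x0 A B (Fn n) (derive1 (Fn n)).
  rewrite -oppr_le0 -(energyE nu oI iI Ix0 cm m_gt0 w_gt0 Pw AB IA IB (sFn n) (Fn0 n)).
  apply/form_le0/(supported_test_function (sFn n) _ ABI) => x xAB.
  by apply: Fn0; apply: contra xAB; exact: subset_itv_oo_cc.
have PF' : prim A B F f by apply: prim_sub PF _ _; lra.
have PFn n := smooth_prim A B (sFn n).
have FnA n : Fn n A = 0 by apply: Fn0; rewrite in_itv/= ltxx.
have FA : F A = 0 by apply: F0; rewrite in_itv/= ltxx.
have L0 : 0 <= L.
  by have /(le_trans (normr_ge0 _)) : `|derive1 (Fn 0%N) A| <= L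
    by apply: dFnL; rewrite in_itv/= lexx ltW.
have cvFn x : x \in `[A, B] -> Fn n x @[n --> \oo] --> F x.
  rewrite in_itv/= => /andP[Ax xB].
  have Px n : prim A x (Fn n) (derive1 (Fn n)) := prim_sub (PFn n) (lexx _) xB.
  have PFx := prim_sub PF' (lexx _) xB.
  have -> : F x = \int[mu]_(t in `[A, x]) f t by rewrite (prim_ftc Ax PFx) FA subr0.
  have -> : Fn ^~ x = fun n => \int[mu]_(t in `[A, x]) derive1 (Fn n) t.
    by apply/funext => n; rewrite (prim_ftc Ax (Px n)) FnA subr0.
  apply: (@segI_dominated _ _ _ _ _ L).
  - exact: prim_bmf_deriv PFx.
  - by move=> n; have [[]] := Px n.
  - move=> n t; rewrite in_itv/= => /andP[At tx]; apply: dFnL.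
    by rewrite in_itv/= At (le_trans tx).
  - apply: ae_imp dFn => t H /andP[At tx]; apply: H.
    by rewrite At (lt_le_trans tx).
have FnL n x : x \in `[A, B] -> `|Fn n x| <= L * (B - A).
  rewrite in_itv/= => /andP[Ax xB].
  have Px : prim A x (Fn n) (derive1 (Fn n)) := prim_sub (PFn n) (lexx _) xB.
  have -> : Fn n x = \int[mu]_(t in `[A, x]) derive1 (Fn n) t.
    by rewrite (prim_ftc Ax Px) FnA subr0.
  apply: (@le_trans _ _ (L * (x - A))); last by rewrite ler_wpM2l// lerD2r.
  apply: segI_norm_le => //; first exact: prim_bmf_deriv Px.
  move=> t; rewrite in_itv/= => /andP[At tx]; apply: dFnL.
  by rewrite in_itv/= At (le_trans tx).
have bwV := bmfI_wV oI iI w_gt0 Pw IA IB.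
have bN := bmfI_massN nu oI iI Ix0 cm IA IB.
have [W W0 wW] := bmf_bound bwV; have [K K0 NK] := bmf_bound bN.
have bq F1 f1 : bmf A B F1 -> bmf A B f1 ->
    bmf A B (fun t => f1 t ^+ 2 * (w t)^-1 + 2 * (F1 t * f1 t) * massN m nu x0 t).
  move=> bF1 bf1; apply: bmfD.
    by apply: bmfM => //; exact: (bmfM bf1 bf1).
  by apply: bmfM => //; apply: bmfM; [exact: bmf_cst|exact: bmfM].
have cvQ : quad m w nu x0 A B (Fn n) (derive1 (Fn n)) @[n --> \oo] -->
    quad m w nu x0 A B F f.
  apply: (@segI_dominated _ _ _ _ _ (L ^+ 2 * W + 2 * (L * (B - A) * L) * K)).
  - exact: bq (prim_bmf PF') (prim_bmf_deriv PF').
  - by move=> n; have [] := bq _ _ (prim_bmf (PFn n)) (prim_bmf_deriv (PFn n)).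
  - move=> n x xAB; rewrite (le_trans (ler_normD _ _))// lerD//.
      rewrite normrM ler_pM//; last exact: wW.
      by rewrite normrX lerXn2r ?nnegrE// dFnL.
    rewrite normrM ler_pM//; last exact: NK.
    rewrite normrM ger0_norm// ler_wpM2l// normrM ler_pM//; first exact: FnL.
    exact: dFnL.
  - apply: ae_imp dFn => x H axb; have xAB : x \in `[A, B].
      by case/andP: axb => Ax xB; rewrite in_itv/= !ltW.
    have {}H := H axb.
    apply: cvgD; apply: cvgM; last exact: cvg_cst.
    - rewrite expr2; under eq_fun do rewrite expr2.
      exact: cvgM.
    - exact: cvg_cst.
    - by apply: cvgM; [exact: cvg_cst|apply: cvgM => //; exact: cvFn].
by apply: (limr_ge_near (cvgP _ cvQ)) => // || (rewrite -(cvg_lim _ cvQ)//; apply: limr_ge; [exact: (cvgP _ cvQ)|exact: nearW]).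
Qed.

End quad_extension.

(** * A Volterra equation with bounded coefficients *)

Section linear_system.
Context {R : realType}.
Notation mu := (@lebesgue_measure R).
Variables (I : set R) (N w : R -> R) (x0 : R).
Hypotheses (oI : open I) (iI : is_interval I) (Ix0 : I x0).
Hypotheses (bN : bmfI I N) (bw : bmfI I w).
Implicit Types (a b c x y l : R) (f g h u v z : R -> R) (n : nat).

(** The Volterra operator with kernel (N y - N x) w y. The kernel depends on [x]; splitting it into
    two indefinite integrals makes [T v] visibly locally bounded and measurable. *)
Let T v x := integral_from x0 (fun y => N y * (w y * v y)) x -
  N x * integral_from x0 (fun y => w y * v y) x.

Let bwv v : bmfI I v -> bmfI I (fun y => w y * v y).
Proof. exact: bmfIM. Qed.

Let bNwv v : bmfI I v -> bmfI I (fun y => N y * (w y * v y)).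
Proof. by move=> bv; apply: bmfIM => //; exact: bwv. Qed.

Let P1 v (bv : bmfI I v) := primI_integral_from iI Ix0 (bwv bv).
Let P2 v (bv : bmfI I v) := primI_integral_from iI Ix0 (bNwv bv).

Let bT v : bmfI I v -> bmfI I (T v).
Proof.
move=> bv; apply: bmfIB; first exact: primI_bmfI (P2 bv).
by apply: bmfIM => //; exact: primI_bmfI (P1 bv).
Qed.

Let T_right v x : bmfI I v -> I x -> x0 <= x ->
  T v x = \int[mu]_(y in `[x0, x]) ((N y - N x) * w y * v y).
Proof.
move=> bv Ix xx; rewrite /T /integral_from !(segI_rev _ xx) !subr0.
have b1 := bwv bv Ix0 Ix; have b2 := bNwv bv Ix0 Ix.
rewrite -segIZ// -segIB//; last by apply: bmfM => //; exact: bmf_cst.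
by apply: eq_segI => y _; ring.
Qed.

Let T_left v x : bmfI I v -> I x -> x <= x0 ->
  T v x = - \int[mu]_(y in `[x, x0]) ((N y - N x) * w y * v y).
Proof.
move=> bv Ix xx; rewrite /T /integral_from !(segI_rev _ xx) !sub0r.
have b1 := bwv bv Ix Ix0; have b2 := bNwv bv Ix Ix0.
rewrite mulrN opprK addrC -opprB; congr (- _).
rewrite -segIZ// -segIB//; last by apply: bmfM => //; exact: bmf_cst.
by apply: eq_segI => y _; ring.
Qed.

Let bkern v x i j : bmfI I v -> I i -> I j ->
  bmf i j (fun y => (N y - N x) * w y * v y).
Proof.
move=> bv Ii Ij; apply: bmfM; last exact: bv.
apply: bmfM; last exact: bw.
by apply: bmfB; [exact: bN|exact: bmf_cst].
Qed.

Let TD f g x : bmfI I f -> bmfI I g -> I x ->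
  T (fun y => f y + g y) x = T f x + T g x.
Proof.
move=> bf bg Ix; have bfg := bmfID bf bg.
have [xx|/ltW xx] := leP x0 x.
  rewrite !T_right// -segID; [|exact: bkern..].
  by apply: eq_segI => y _; ring.
rewrite !T_left// -opprD -segID; [|exact: bkern..].
by congr (- _); apply: eq_segI => y _; ring.
Qed.

Let E l x := expR (l * `|x - x0|).

Let is_derive_exp l c x : is_derive x 1 (fun y => expR (l * (y - c))) (l * expR (l * (x - c))).
Proof.
have dy : is_derive x 1 (fun y : R => l * (y - c)) l.
  have d1 : is_derive x 1 (fun y : R => y - c) 1.
    apply: is_derive_eq (is_deriveD1 (is_derive_id x (1:R)) (is_derive_cst (- c) x (1:R))) _.
    by rewrite addr0.
  apply: is_derive_eq (is_deriveM1 (is_derive_cst l x (1:R)) d1) _.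
  by rewrite mul0r add0r mulr1.
rewrite mulrC.
exact: (@is_derive1_comp R expR (fun y => l * (y - c)) x _ _ (is_derive_expR _) dy).
Qed.

Let segI_exp l c x y : l != 0 -> x <= y ->
  \int[mu]_(t in `[x, y]) expR (l * (t - c)) =
  (expR (l * (y - c)) - expR (l * (x - c))) / l.
Proof.
move=> l0 xy.
have cE : continuous (fun t : R => expR (l * (t - c))).
  by move=> t; have [] := is_derive_exp l c t => d _;
    apply: differentiable_continuous; exact/derivable1_diffP.
have PE : prim x y (fun t => l^-1 * expR (l * (t - c))) (fun t => expR (l * (t - c))).
  apply: prim_C1; last exact: continuous_subspaceT.
  move=> t _; apply: is_derive_eq (is_deriveM1 (is_derive_cst l^-1 t (1:R)) (is_derive_exp l c t)) _.
  by rewrite mul0r add0r mulKf.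
by rewrite (prim_ftc xy PE) -mulrBr mulrC.
Qed.

(* Exponentially weighted sup norms make the Volterra operator [T] a
   contraction. *)
Let T_bound a b K l C v x : I a -> I b -> a <= x0 <= b -> 0 < l -> 0 <= C ->
  bmfI I v ->
  (forall x y, x \in `[a, b] -> y \in `[a, b] -> `|(N y - N x) * w y| <= K) ->
  (forall y, y \in `[a, b] -> `|v y| <= C * E l y) ->
  x \in `[a, b] -> `|T v x| <= K * C / l * E l x.
Proof.
move=> Ia Ib /andP[ax0 x0b] l0 C0 bv KK vC xab.
have K0 : 0 <= K by rewrite (le_trans _ (KK x x xab xab)).
have Ix : I x by exact: itv_subset xab.
have ln0 : l != 0 by rewrite gt_eqF.
move: (xab); rewrite in_itv/= => /andP[ax xb].
have [xx|/ltW xx] := leP x0 x.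
  have EE y : y \in `[x0, x] -> E l y = expR (l * (y - x0)).
    by rewrite in_itv/= => /andP[h _]; rewrite /E ger0_norm// subr_ge0.
  have bE : bmf x0 x (fun y => K * C * expR (l * (y - x0))).
    apply: bmfM; first exact: bmf_cst.
    apply: within_continuous_bmf; apply: continuous_subspaceT => y.
    exact: is_derive_cont (is_derive_exp l x0 y).
  rewrite T_right// (le_trans (segI_norm (bkern x bv Ix0 Ix)))//.
  apply: (@le_trans _ _ (\int[mu]_(y in `[x0, x]) (K * C * expR (l * (y - x0))))).
    apply: segI_le => //; first exact: bmf_norm (bkern x bv Ix0 Ix).
    move=> y yx; have yab : y \in `[a, b].
      by move: yx; rewrite !in_itv/= => /andP[h1 h2]; rewrite (le_trans ax0)//= (le_trans h2).
    by rewrite normrM -mulrA -EE// ler_pM ?KK ?vC.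
  rewrite segIZ; last first.
    apply: within_continuous_bmf; apply: continuous_subspaceT => y.
    exact: is_derive_cont (is_derive_exp l x0 y).
  rewrite segI_exp// -EE ?in_itv/= ?xx ?lexx// mulrA mulrAC ler_wpM2l//.
    by rewrite !mulr_ge0// invr_ge0 ltW.
  by rewrite gerBl expR_ge0.
have EE y : y \in `[x, x0] -> E l y = expR (- l * (y - x0)).
  by rewrite in_itv/= => /andP[_ h]; rewrite /E ler0_norm ?subr_le0// mulrN mulNr.
have bE1 : bmf x x0 (fun y => expR (- l * (y - x0))).
  apply: within_continuous_bmf; apply: continuous_subspaceT => y.
  exact: is_derive_cont (is_derive_exp (- l) x0 y).
rewrite T_left// normrN (le_trans (segI_norm (bkern x bv Ix Ix0)))//.
apply: (@le_trans _ _ (\int[mu]_(y in `[x, x0]) (K * C * expR (- l * (y - x0))))).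
  apply: segI_le; first exact: bmf_norm (bkern x bv Ix Ix0).
    by apply: bmfM => //; exact: bmf_cst.
  move=> y yx; have yab : y \in `[a, b].
    by move: yx; rewrite !in_itv/= => /andP[h1 h2]; rewrite (le_trans ax)//= (le_trans h2).
  by rewrite normrM -mulrA -EE// ler_pM ?KK ?vC.
rewrite segIZ// segI_exp ?oppr_eq0// -(EE x) ?in_itv/= ?xx ?lexx//.
rewrite subrr mulr0 expR0 invrN mulrN -mulNr opprB mulrA mulrAC ler_wpM2l//.
  by rewrite !mulr_ge0// invr_ge0 ltW.
by rewrite gerBl.
Qed.

Variable h : R -> R.
Hypothesis bh : bmfI I h.

(** The terms of the Neumann series for v = h + T v; [V] collects its partial sums. *)
Let d n := iter n T h.
Let V n x := \sum_(i < n) d i x.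

Let bd n : bmfI I (d n).
Proof. by elim: n => [//|n ih]; rewrite /d iterS; exact: bT. Qed.

Let bV n : bmfI I (V n).
Proof.
elim: n => [|n ih] a b Ia Ib.
  by apply: eq_bmf (bmf_cst a b 0) => x _; rewrite /V big_ord0.
have := bmfD (ih a b Ia Ib) (bd n Ia Ib).
by apply: eq_bmf => x _; rewrite /V big_ord_recr.
Qed.

Let VS n x : I x -> V n.+1 x = h x + T (V n) x.
Proof.
elim: n x => [|n ih] x Ix.
  rewrite /V big_ord_recr big_ord0 /= add0r.
  have -> : T (fun x => \sum_(i < 0) d i x) x = 0.
    have V0 : (fun x => \sum_(i < 0) d i x) = cst 0 by apply/funext => y; rewrite big_ord0.
    rewrite V0 /T /integral_from.
    have z0 i j (g : R -> R) : (forall y, g y = 0) -> \int[mu]_(y in `[i, j]) g y = 0.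
      move=> g0; have [ij|ji] := leP i j; last by rewrite segI_rev// ltW.
      transitivity (\int[mu]_(y in `[i, j]) (0 : R)); first by apply: eq_segI => y _.
      by rewrite segI_cst// mul0r.
    by rewrite !z0 ?(subrr, mulr0)// => y; rewrite /= !mulr0.
  by rewrite addr0.
have -> : V n.+2 x = V n.+1 x + T (d n) x by rewrite /V big_ord_recr.
rewrite ih// -addrA -TD//.
congr (_ + _); rewrite /T /integral_from.
have VE : V n.+1 = fun y => V n y + d n y.
  by apply/funext => y; rewrite /V big_ord_recr.
by rewrite VE.
Qed.

Let good_bound a b : I a -> I b -> a <= x0 <= b ->
  exists C : R, 0 <= C /\ forall n x, x \in `[a, b] -> `|d n x| <= C * 2^-1 ^+ n.
Proof.
move=> Ia Ib ab; have [H H0 hH] := bmf_bound (bh Ia Ib).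
have [M M0 NM] := bmf_bound (bN Ia Ib); have [W W0 wW] := bmf_bound (bw Ia Ib).
pose K := (M + M) * W; have K0 : 0 <= K by rewrite mulr_ge0// addr_ge0.
have KK x y : x \in `[a, b] -> y \in `[a, b] -> `|(N y - N x) * w y| <= K.
  move=> xab yab; rewrite normrM ler_pM ?wW//.
  by rewrite (le_trans (ler_normB _ _))// lerD ?NM.
(* With this weight K / l <= 1 / 2, so each application of [T] halves the weighted norm. *)
pose l := 2 * K + 1; have l0 : 0 < l by rewrite /l; lra.
have dn n x : x \in `[a, b] -> `|d n x| <= H * 2^-1 ^+ n * E l x.
  elim: n x => [|n ih] x xab.
    rewrite expr0 mulr1 (le_trans (hH x xab))// ler_peMr//.
    by rewrite -expR0 ler_expR mulr_ge0// ltW.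
  have C0 : 0 <= H * 2^-1 ^+ n by rewrite mulr_ge0// exprn_ge0// invr_ge0.
  rewrite /d iterS (le_trans (T_bound Ia Ib ab l0 C0 (bd n) KK ih xab))//.
  rewrite ler_wpM2r ?expR_ge0//.
  have -> : K * (H * 2^-1 ^+ n) / l = (H * 2^-1 ^+ n) * (K / l) by ring.
  rewrite exprSr (mulrA H) ler_wpM2l//.
  by rewrite ler_pdivrMr// /l; lra.
exists (H * expR (l * (b - a))); split; first by rewrite mulr_ge0 ?expR_ge0.
move=> n x xab; rewrite (le_trans (dn n x xab))// mulrAC.
rewrite ler_wpM2r ?exprn_ge0 ?invr_ge0// ler_wpM2l// ler_expR ler_wpM2l ?(ltW l0)//.
move: xab ab; rewrite in_itv/= => /andP[ax xb] /andP[ax0 x0b].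
by rewrite ler_norml; apply/andP; split; lra.
Qed.

Let sum_half n : \sum_(i < n) (2^-1 : R) ^+ i = 2 - 2 * 2^-1 ^+ n.
Proof.
elim: n => [|n ih]; first by rewrite big_ord0 expr0; ring.
by rewrite big_ord_recr/= ih exprSr; field.
Qed.

Let around x : I x -> exists a b, [/\ I a, I b, a <= x0 <= b & x \in `[a, b]].
Proof.
move=> Ix; exists (Num.min x0 x), (Num.max x0 x); split.
- by case: leP.
- by case: leP.
- by rewrite ge_min le_max lexx.
- by rewrite in_itv/= ge_min le_max lexx !orbT.
Qed.

Let cvg_V x : I x -> cvgn (V ^~ x).
Proof.
move=> Ix; have [a [b [Ia Ib ab xab]]] := around Ix.
have [C [C0 dC]] := good_bound Ia Ib ab.
have -> : V ^~ x = series (fun i => d i x).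
  by apply/funext => n; rewrite /V /series /= big_mkord.
apply: normed_cvg; apply: (@series_le_cvg _ _ (fun n => C * 2^-1 ^+ n)).
- by move=> n; exact: normr_ge0.
- by move=> n; rewrite mulr_ge0// exprn_ge0// invr_ge0.
- by move=> n; exact: dC.
- apply: (@is_cvg_geometric_series R C 2^-1).
  by rewrite ger0_norm ?invr_ge0// invf_lt1// ltr1n.
Qed.

Let V_bound a b : I a -> I b -> a <= x0 <= b ->
  exists C : R, forall n x, x \in `[a, b] -> `|V n x| <= C.
Proof.
move=> Ia Ib ab; have [C [C0 dC]] := good_bound Ia Ib ab.
exists (C * 2) => n x xab; rewrite /V (le_trans (ler_norm_sum _ _ _))//.
apply: (@le_trans _ _ (\sum_(i < n) C * 2^-1 ^+ i)).
  by apply: ler_sum => i _; exact: dC.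
rewrite -mulr_sumr ler_wpM2l// sum_half gerBl mulr_ge0// exprn_ge0// invr_ge0//.
Qed.

Let v x := limn (V ^~ x).

Let bv : bmfI I v.
Proof.
move=> a b Ia Ib.
pose a' := Num.min x0 a; pose b' := Num.max x0 b.
have Ia' : I a' by rewrite /a'; case: leP.
have Ib' : I b' by rewrite /b'; case: leP.
apply: (@bmf_itv _ a' b'); last 2 first.
- by rewrite ge_min lexx orbT.
- by rewrite le_max lexx orbT.
have ab' : a' <= x0 <= b' by rewrite ge_min le_max lexx.
have [C VC] := V_bound Ia' Ib' ab'; split.
  apply: (@measurable_fun_cvg _ _ _ _ V) => //.
  - by move=> n; have [] := bV n Ia' Ib'.
  - move=> x xab; have Ix : I x by exact: itv_subset xab.
    exact: cvg_V.
exists C => x xab; have Ix : I x by exact: itv_subset xab.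
have cn : `|V n x| @[n --> \oo] --> `|v x| by apply: cvg_norm; exact: cvg_V.
rewrite -(cvg_lim _ cn)//; apply: limr_le; first exact: (cvgP _ cn).
by apply: nearW => n; exact: VC.
Qed.

(** The partial sums satisfy V (n + 1) = h + T (V n); they converge pointwise and are bounded on
    segments, so both sides pass to the limit. *)
Lemma volterra : exists v, bmfI I v /\ forall x, I x ->
  v x = h x + (integral_from x0 (fun y => N y * (w y * v y)) x -
               N x * integral_from x0 (fun y => w y * v y) x).
Proof.
exists v; split=> // x Ix; rewrite -/(T v x).
have c1 : V n.+1 x @[n --> \oo] --> v x.
  by have := cvg_V Ix; rewrite -(cvg_shiftS (V ^~ x)).
have cTV : T (V n) x @[n --> \oo] --> T v x.
  have dom i j : I i -> I j -> i <= j -> (x0 \in `[i, j]) ->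
      \int[mu]_(y in `[i, j]) ((N y - N x) * w y * V n y) @[n --> \oo] -->
      \int[mu]_(y in `[i, j]) ((N y - N x) * w y * v y).
    move=> Ii Ij ij; rewrite in_itv/= => x0ij.
    have [C VC] := V_bound Ii Ij x0ij.
    have bk : bmf i j (fun y => (N y - N x) * w y).
      by apply: bmfM; [apply: bmfB; [exact: bN|exact: bmf_cst]|exact: bw].
    have [K K0 kK] := bmf_bound bk.
    apply: (@segI_dominated _ _ _ _ _ (K * C)).
    - exact: bkern.
    - by move=> n; have [] := bkern x (bV n) Ii Ij.
    - by move=> n y yij; rewrite normrM ler_pM ?kK ?VC.
    - apply: aeW => y /andP[iy yj]; apply: cvgM; first exact: cvg_cst.
      by apply: cvg_V; apply: (iI Ii Ij); rewrite !ltW.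
  have [xx|/ltW xx] := leP x0 x.
    rewrite T_right//; under eq_fun do rewrite T_right//.
    by apply: dom => //; rewrite in_itv/= lexx xx.
  rewrite T_left//; under eq_fun do rewrite T_left//.
  by apply: cvgN; apply: dom => //; rewrite in_itv/= lexx xx.
have c2 : V n.+1 x @[n --> \oo] --> h x + T v x.
  have -> : (fun n => V n.+1 x) = (fun n => h x + T (V n) x).
    by apply/funext => n; exact: VS.
  by apply: cvgD => //; exact: cvg_cst.
exact: (cvg_unique _ c1 c2).
Qed.

End linear_system.

(** * The first-order system equivalent to L u = 0 *)

Section quasi_solutions.
Context {R : realType}.
Variables (I : set R) (N w : R -> R) (x0 : R).
Hypotheses (oI : open I) (iI : is_interval I) (Ix0 : I x0).
Hypotheses (bN : bmfI I N) (bw : bmfI I w).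

(* With [z = u' / w + N u], where [dN = m dnu], the equation [L u = 0] becomes a
   linear system whose coefficients are locally bounded functions. *)
Definition quasi_solution (u z : R -> R) :=
  primI I u (fun x => w x * (z x - N x * u x)) /\
  primI I z (fun x => N x * (w x * (z x - N x * u x))).

(** The unknown v = z - N u satisfies a Volterra equation with forcing be - al N; [u] and [z] are
    then recovered by integrating w v and N w v. *)
Lemma quasi_solution_exists (al be : R) :
  exists u z, [/\ quasi_solution u z, u x0 = al & z x0 = be].
Proof.
have bh : bmfI I (fun x => be - al * N x).
  move=> a b Ia Ib; apply: bmfB; first exact: bmf_cst.
  by apply: bmfM; [exact: bmf_cst|exact: bN].
have [v [bv vE]] := volterra iI Ix0 bN bw bh.
pose u x := integral_from x0 (fun y => w y * v y) x + al.
pose z x := integral_from x0 (fun y => N y * (w y * v y)) x + be.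
have vE' x : I x -> v x = z x - N x * u x by move=> /vE ->; rewrite /z /u; ring.
have bwv : bmfI I (fun y => w y * v y) by exact: bmfIM.
have bNwv : bmfI I (fun y => N y * (w y * v y)) by exact: bmfIM.
exists u, z; split; last 2 first.
- by rewrite /u integral_from_base add0r.
- by rewrite /z integral_from_base add0r.
split.
  have := primID (primI_integral_from iI Ix0 bwv) (primI_cst al).
  by apply: eq_primI => // x Ix; rewrite /= addr0 vE'.
have := primID (primI_integral_from iI Ix0 bNwv) (primI_cst be).
by apply: eq_primI => // x Ix; rewrite /= addr0 vE'.
Qed.

Lemma quasi_solution_linear (u1 z1 u2 z2 : R -> R) (c : R) :
  quasi_solution u1 z1 -> quasi_solution u2 z2 ->
  quasi_solution (fun x => u1 x + c * u2 x) (fun x => z1 x + c * z2 x).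
Proof.
move=> [Pu1 Pz1] [Pu2 Pz2]; split.
  have := primID Pu1 (primIZ c Pu2).
  by apply: eq_primI => // x Ix; ring.
have := primID Pz1 (primIZ c Pz2).
by apply: eq_primI => // x Ix; ring.
Qed.

(** With v_i = z_i - N u_i, the derivative of the Wronskian reduces to w (v1 v2 - v2 v1) = 0. *)
Lemma wronskian_constant (u1 z1 u2 z2 : R -> R) x :
  quasi_solution u1 z1 -> quasi_solution u2 z2 -> I x ->
  u1 x * z2 x - z1 x * u2 x = u1 x0 * z2 x0 - z1 x0 * u2 x0.
Proof.
move=> [Pu1 Pz1] [Pu2 Pz2] Ix.
have PW : primI I (fun x => u1 x * z2 x + -1 * (z1 x * u2 x)) (cst 0).
  have := primID (primIM Pu1 Pz2) (primIZ (-1) (primIM Pz1 Pu2)).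
  by apply: eq_primI => // y Iy /=; ring.
have eqW a b : I a -> I b -> a <= b ->
    u1 b * z2 b + -1 * (z1 b * u2 b) = u1 a * z2 a + -1 * (z1 a * u2 a).
  move=> Ia Ib ab; have := prim_ftc ab (PW a b Ia Ib).
  by rewrite segI_cst// mul0r => /esym/eqP; rewrite subr_eq0 => /eqP.
rewrite -![- (_ * _)]mulN1r; have [h|/ltW h] := leP x0 x; first exact: eqW.
by rewrite (eqW _ _ Ix Ix0 h).
Qed.

End quasi_solutions.

(** * Disconjugacy and the construction of a positive solution *)

Section nonoscillation.
Context {R : realType}.
Notation T := (measurableTypeR R).
Notation mu := (@lebesgue_measure R).
Variables (I : set R) (m w dw : R -> R) (nu : signed_radon I) (x0 : R).
Hypotheses (oI : open I) (iI : is_interval I) (Ix0 : I x0).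
Hypotheses (cm : {within I, continuous m}) (m_gt0 : forall x, I x -> 0 < m x).
Hypotheses (w_gt0 : forall x, I x -> 0 < w x) (Pw : primI I w dw).
Hypothesis form_le0 : forall f : R -> R, test_function I f ->
  \int[mu]_(x in I) (L0 m w f x * f x * m x)
  + signed_integral nu I (fun x => f x ^+ 2 * m x) <= 0.
Implicit Types (a b x y t : R) (u z f g : R -> R).

Let N := massN m nu x0.
Let bN : bmfI I N := bmfI_massN nu oI iI Ix0 cm.
Let bw : bmfI I w := primI_bmfI Pw.
Let qsol u z := quasi_solution I N w u z.

Lemma ge0_quadratic_linear0 (l q : R) :
  (forall e, 0 <= 2 * e * l + e ^+ 2 * q) -> l = 0.
Proof.
move=> H; apply: contrapT => /eqP l0.
have q1 : 0 < `|q| + 1 by rewrite ltr_wpDl.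
have := H (- l / (`|q| + 1)); rewrite leNgt => /negP; apply.
have l2 : 0 < l ^+ 2 by rewrite exprn_even_gt0.
have -> : 2 * (- l / (`|q| + 1)) * l + (- l / (`|q| + 1)) ^+ 2 * q =
    l ^+ 2 / (`|q| + 1) ^+ 2 * (q - 2 * (`|q| + 1)).
  by field; rewrite gt_eqF.
rewrite pmulr_rlt0; first by have := ler_norm q; lra.
by rewrite divr_gt0// exprn_gt0.
Qed.

(* The truncation of [u] to [a, b] has zero energy, hence minimizes the form; its
   first variation in the direction [g] is [z b * g b]. *)
Lemma zeros_conormal u z a b : qsol u z -> I a -> I b -> a < b ->
  u a = 0 -> u b = 0 -> z b = 0.
Proof.
move=> [Pu Pz] Ia Ib ab ua ub; have ab' := ltW ab.
have [A Aa IA] := open_smaller oI Ia; have [B bB IB] := open_bigger oI Ib.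
pose c := (b + B) / 2; have bc : b < c by rewrite /c; lra.
have cB : c < B by rewrite /c; lra.
have Aab : A <= a by exact: ltW.
have AB : A <= B by lra.
pose v x := z x - N x * u x.
pose f := u \o clamp a b; pose f' := (fun x => w x * v x) \_ `[a, b].
pose g := bump 1 a c; have sg : smooth g by exact: smooth_bump.
pose g' := derive1 g.
have Pf : prim (A - 2) (B + 2) f f' by apply: (prim_clamp ab' _ _ (Pu a b Ia Ib)); lra.
have Pg : prim (A - 2) (B + 2) g g' := smooth_prim _ _ sg.
have f0 x : x \notin `]a, b[ -> f x = 0.
  rewrite in_itv/= negb_and -!leNgt => /orP[xa|bx].
    by rewrite /f/= (clamp_le ab' xa).
  by rewrite /f/= (clamp_ge ab' bx).
have f'0 x : x \notin `[a, b] -> f' x = 0.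
  by move=> xab; rewrite /f' patchE ifF//; apply/negbTE; rewrite notin_setE/=; exact/negP.
have f'E x : x \in `[a, b] -> f' x = w x * v x.
  by move=> xab; rewrite /f' patchE ifT//; exact: mem_set.
have fE x : x \in `[a, b] -> f x = u x by move=> xab; rewrite /f/= clamp_id.
have sub x : x \notin `[a, b] -> x \notin `]a, b[ by apply: contra; exact: subset_itv_oo_cc.
have quadE e : 0 <= quad m w nu x0 A B (fun x => f x + e * g x) (fun x => f' x + e * g' x).
  apply: (@quad_ge0 _ _ _ _ _ nu _ oI iI Ix0 cm m_gt0 w_gt0 Pw form_le0 A c) => //.
  - by lra.
  - exact: primD Pf (primZ e Pg).
  - move=> x xAc; rewrite f0; last first.
      by apply: contra xAc; rewrite !in_itv/= => /andP[ax xb]; apply/andP; split; lra.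
    rewrite /g bump_out ?mulr0 ?addr0//; apply: contra xAc; rewrite !in_itv/=.
    by move=> /andP[ax ->]; rewrite (lt_trans Aa).
have subAB : prim A B f f' by apply: (prim_sub Pf); lra.
have Pg' : prim A B g g' by apply: (prim_sub Pg); lra.
have bf := prim_bmf subAB; have bf' := prim_bmf_deriv subAB.
have bg := prim_bmf Pg'; have bg' := prim_bmf_deriv Pg'.
have bV := bmfI_wV oI iI w_gt0 Pw IA IB.
have bNAB := bN IA IB.
pose i1 x := f' x * f' x * (w x)^-1 + 2 * (f x * f' x) * N x.
pose i2 x := f' x * g' x * (w x)^-1 + (f x * g' x + f' x * g x) * N x.
pose i3 x := g' x * g' x * (w x)^-1 + 2 * (g x * g' x) * N x.
have b2 : bmf A B (cst (2 : R)) by exact: bmf_cst.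
have b1 : bmf A B i1.
  by apply: bmfD; apply: bmfM => //; apply: bmfM => //; apply: bmfM.
have b2' : bmf A B i2.
  by apply: bmfD; apply: bmfM => //; [apply: bmfM|apply: bmfD; apply: bmfM].
have b3 : bmf A B i3.
  by apply: bmfD; apply: bmfM => //; apply: bmfM => //; apply: bmfM.
have E e : quad m w nu x0 A B (fun x => f x + e * g x) (fun x => f' x + e * g' x) =
    \int[mu]_(x in `[A, B]) i1 x + 2 * e * \int[mu]_(x in `[A, B]) i2 x +
    e ^+ 2 * \int[mu]_(x in `[A, B]) i3 x.
  have be2 : bmf A B (fun x => 2 * e * i2 x) by apply: bmfM => //; exact: bmf_cst.
  have be3 : bmf A B (fun x => e ^+ 2 * i3 x) by apply: bmfM => //; exact: bmf_cst.
  rewrite -!segIZ// -!segID//; last exact: bmfD.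
  by apply: eq_segI => x _; rewrite /i1 /i2 /i3 -/N; ring.
have abAB : `[a, b]%classic `<=` `[A, B]%classic.
  by apply: subset_itvScc; rewrite bnd_simp; lra.
have wne x : x \in `[a, b] -> w x != 0.
  by move=> /(itv_subset iI Ia Ib) Ix; rewrite gt_eqF// w_gt0.
(* On [a, b] the integrand is the derivative of u z, and [u] vanishes at both ends. *)
have I1 : \int[mu]_(x in `[A, B]) i1 x = 0.
  rewrite (Rintegral_segment mu abAB); last first.
    by move=> x xab; rewrite /i1 f'0// f0 ?sub// !(mul0r, mulr0) addr0.
  have := prim_ftc ab' (primM (Pu a b Ia Ib) (Pz a b Ia Ib)).
  rewrite ua ub !mul0r subrr => <-; apply: eq_segI => x xab.
  have wx := wne x xab.
  by rewrite /i1 f'E// fE// /v; field.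
(* On [a, b] the integrand is the derivative of g z, and [g] vanishes at [a]. *)
have I2 : \int[mu]_(x in `[A, B]) i2 x = g b * z b.
  rewrite (Rintegral_segment mu abAB); last first.
    by move=> x xab; rewrite /i2 f'0// f0 ?sub// !(mul0r, addr0).
  have Pgab : prim a b g g' by apply: (prim_sub Pg); lra.
  have := prim_ftc ab' (primM Pgab (Pz a b Ia Ib)).
  have -> : g a = 0 by rewrite /g bump_out// in_itv/= ltxx.
  rewrite mul0r subr0 => <-; apply: eq_segI => x xab.
  have wx := wne x xab.
  by rewrite /i2 f'E// fE// /v; field.
have L : \int[mu]_(x in `[A, B]) i2 x = 0.
  apply: (@ge0_quadratic_linear0 _ (\int[mu]_(x in `[A, B]) i3 x)) => e.
  by have := quadE e; rewrite E I1 add0r.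
have gb : 0 < g b by rewrite bump_gt0// in_itv/= ab.
by move: L; rewrite I2 => /eqP; rewrite mulf_eq0 gt_eqF//= => /eqP.
Qed.

Lemma zero_between u a b : {within I, continuous u} -> I a -> I b -> a < b ->
  u a < 0 < u b \/ u b < 0 < u a -> exists c, [/\ a < c, c < b, I c & u c = 0].
Proof.
move=> cu Ia Ib ab uab.
have cab := within_continuous_segment iI cu Ia Ib.
have [|c cab' uc] := @IVT R u a b 0 (ltW ab) cab.
  by rewrite ge_min le_max; case: uab => /andP[/ltW-> /ltW->]; rewrite ?orbT.
have Ic := itv_subset iI Ia Ib cab'.
move: cab'; rewrite in_itv/= !le_eqVlt => /andP[/predU1P[ac|ac] /predU1P[cb|cb]].
- by move: ab; rewrite ac cb ltxx.
- by move: uab; rewrite ac uc ltxx; case=> /andP[//]; rewrite ltxx.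
- by move: uab; rewrite -cb uc ltxx; case=> /andP[//]; rewrite ltxx.
- by exists c.
Qed.

Lemma quasi_solution_continuous u z : qsol u z -> {within I, continuous u}.
Proof. by move=> [Pu _]; exact: primI_continuous Pu. Qed.

(** Since [u] and [z] both vanish at [b], so do the Wronskians of [u] with the two basis solutions;
    evaluated at x0 these are [- z x0] and [u x0]. *)
Lemma disconjugate u z a b : qsol u z -> I a -> I b -> a < b ->
  u a = 0 -> u b = 0 -> u x0 = 0 /\ z x0 = 0.
Proof.
move=> S Ia Ib ab ua ub; have zb := zeros_conormal S Ia Ib ab ua ub.
have [p [zp [Sp p1 zp0]]] := quasi_solution_exists iI Ix0 bN bw 1 0.
have [q [zq [Sq q0 zq1]]] := quasi_solution_exists iI Ix0 bN bw 0 1.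
have := wronskian_constant iI Ix0 S Sp Ib.
have := wronskian_constant iI Ix0 S Sq Ib.
rewrite ub zb p1 zp0 q0 zq1 !mul0r subrr mulr1 mulr0 subr0 => <-.
by rewrite mulr0 mulr1 sub0r => /eqP; rewrite eq_sym oppr_eq0 => /eqP ->.
Qed.

(* A solution vanishing at [x0] with [z x0 = 1] has the sign of [x - x0]. *)
Lemma sign_odd_solution q zq : qsol q zq -> q x0 = 0 -> zq x0 = 1 ->
  (forall x, I x -> x0 < x -> 0 < q x) /\ (forall x, I x -> x < x0 -> q x < 0).
Proof.
move=> Sq q0 zq1; have cq := quasi_solution_continuous Sq.
have qn0 x : I x -> x != x0 -> q x != 0.
  move=> Ix xx0; apply/negP => /eqP qx.
  have z1 : zq x0 <> 0 by rewrite zq1; apply/eqP; rewrite oner_eq0.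
  case/orP : (lt_total xx0) => h.
    by have [_ /z1] := disconjugate Sq Ix Ix0 h qx q0.
  by have [_ /z1] := disconjugate Sq Ix0 Ix h q0 qx.
have [a ax Ia] := open_smaller oI Ix0; have [b xb Ib] := open_bigger oI Ix0.
case: (Sq) => Pq Pz.
have [K K0 NK] := bmf_bound (bN Ia Ib).
have [L L0 qL] := prim_lipschitz (Pq a b Ia Ib).
have [M M0 zM] := prim_lipschitz (Pz a b Ia Ib).
have x0ab : x0 \in `[a, b] by rewrite in_itv/= !ltW.
(* Within distance [d] of x0 one has |zq - 1| <= M d and |N q| <= K L d, with sum at most 1; hence
   q' = w (zq - N q) >= 0 and [q] is nondecreasing there. A pointwise derivative at x0 would not do,
   as [N] may jump. *)
pose d := Num.min (Num.min (x0 - a) (b - x0)) (2 * (M + K * L + 1))^-1.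
have MKL : 0 < M + K * L + 1 by rewrite ltr_wpDl// addr_ge0// mulr_ge0.
have d0 : 0 < d by rewrite !lt_min !subr_gt0 ax xb invr_gt0 mulr_gt0.
have da : d <= x0 - a by rewrite /d !ge_min lexx.
have db : d <= b - x0 by rewrite /d !ge_min lexx orbT.
have dM : (M + K * L) * d <= 1.
  apply: (@le_trans _ _ ((2 * (M + K * L + 1)) * d)).
    by rewrite ler_wpM2r ?(ltW d0)//; lra.
  by rewrite -ler_pdivlMl ?mulr_gt0// mulr1 /d ge_min lexx orbT.
have vge0 x : x \in `[x0 - d, x0 + d] -> 0 <= w x * (zq x - N x * q x).
  rewrite in_itv/= => /andP[x1 x2].
  have xab : x \in `[a, b] by rewrite in_itv/=; apply/andP; split; lra.
  have xd : `|x - x0| <= d by rewrite ler_norml; apply/andP; split; lra.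
  rewrite mulr_ge0//; first by rewrite ltW// w_gt0//; exact: (itv_subset iI Ia Ib).
  have h1 : `|zq x - 1| <= M * d.
    by rewrite -zq1 (le_trans (zM _ _ x0ab xab))// ler_wpM2l.
  have h2 : `|N x * q x| <= K * (L * d).
    rewrite normrM ler_pM ?NK// -[q x]subr0 -[X in _ - X]q0 (le_trans (qL _ _ x0ab xab))//.
    by rewrite ler_wpM2l.
  move: h1 h2; rewrite !ler_norml => /andP[h1 _] /andP[_ h2].
  have : M * d + K * (L * d) <= 1 by rewrite (mulrA K) -mulrDl.
  lra.
have xd1 : x0 < x0 + d by rewrite ltrDl.
have xd2 : x0 - d < x0 by rewrite gtrBl.
have I1 : I (x0 + d) by apply: (itv_subset iI Ia Ib); rewrite /= in_itv/=; apply/andP; split; lra.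
have I2 : I (x0 - d) by apply: (itv_subset iI Ia Ib); rewrite /= in_itv/=; apply/andP; split; lra.
have q1 : 0 < q (x0 + d).
  have := prim_ftc (ltW xd1) (Pq _ _ Ix0 I1); rewrite q0 subr0 => E.
  rewrite lt_neqAle eq_sym qn0 ?gt_eqF//= -E; apply: segI_ge0 => x.
  by rewrite in_itv/= => /andP[h1 h2]; apply: vge0; rewrite in_itv/= h2 (le_trans (ltW xd2)).
have q2 : q (x0 - d) < 0.
  have := prim_ftc (ltW xd2) (Pq _ _ I2 Ix0); rewrite q0 sub0r => E.
  rewrite lt_neqAle qn0 ?lt_eqF//= -oppr_ge0 -E; apply: segI_ge0 => x.
  by rewrite in_itv/= => /andP[h1 h2]; apply: vge0; rewrite in_itv/= h1 (le_trans h2 (ltW xd1)).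
split=> x Ix xx.
  rewrite ltNge; apply/negP; rewrite le_eqVlt (negbTE (qn0 x Ix _)) ?gt_eqF//= => qx.
  have [h|h|h] := ltgtP x (x0 + d).
  - have [|c [xc cd Ic qc]] := zero_between cq Ix I1 h; first by left; rewrite qx.
    by move: (qn0 c Ic); rewrite qc eqxx gt_eqF ?(lt_trans xx)// => /(_ isT).
  - have [|c [xc cd Ic qc]] := zero_between cq I1 Ix h; first by right; rewrite qx.
    by move: (qn0 c Ic); rewrite qc eqxx gt_eqF ?(lt_trans xd1)// => /(_ isT).
  - by move: q1; rewrite -h ltNge (ltW qx).
rewrite ltNge; apply/negP; rewrite le_eqVlt eq_sym (negbTE (qn0 x Ix _)) ?lt_eqF//= => qx.
have [h|h|h] := ltgtP x (x0 - d).
- have [|c [xc cd Ic qc]] := zero_between cq Ix I2 h; first by right; rewrite q2.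
  by move: (qn0 c Ic); rewrite qc eqxx lt_eqF ?(lt_trans cd)// => /(_ isT).
- have [|c [xc cd Ic qc]] := zero_between cq I2 Ix h; first by left; rewrite q2.
  by move: (qn0 c Ic); rewrite qc eqxx lt_eqF ?(lt_trans cd)// => /(_ isT).
- by move: q2; rewrite -h ltNge (ltW qx).
Qed.

(* Among the solutions [p + t * q] with value 1 at [x0], those failing to be
   positive on the right (resp. left) of [x0] form a down-closed (resp.
   up-closed) set of parameters without maximum (resp. minimum); by
   disconjugacy the two sets are disjoint, so they do not cover the line. *)
Lemma positive_quasi_solution : exists u z, qsol u z /\ forall x, I x -> 0 < u x.
Proof.
have [p [zp [Sp p1 zp0]]] := quasi_solution_exists iI Ix0 bN bw 1 0.
have [q [zq [Sq q0 zq1]]] := quasi_solution_exists iI Ix0 bN bw 0 1.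
have [qr ql] := sign_odd_solution Sq q0 zq1.
pose u t x := p x + t * q x; pose z t x := zp x + t * zq x.
have S t : qsol (u t) (z t) by exact: quasi_solution_linear.
have cu t := quasi_solution_continuous (S t).
have ux0 t : u t x0 = 1 by rewrite /u p1 q0 mulr0 addr0.
have two t a b : I a -> I b -> a < b -> u t a = 0 -> u t b = 0 -> False.
  move=> Ia Ib ab ua ub; have [] := disconjugate (S t) Ia Ib ab ua ub.
  by rewrite ux0 => /eqP; rewrite oner_eq0.
pose Ar : set R := [set t | exists x, [/\ I x, x0 < x & u t x <= 0]].
pose Al : set R := [set t | exists x, [/\ I x, x < x0 & u t x <= 0]].
have Ar_down t t' : Ar t -> t' <= t -> Ar t'.
  move=> [x [Ix xx ut]] tt'; exists x; split=> //.
  by rewrite (le_trans _ ut)// /u lerD2l ler_wpM2r// ltW// qr.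
have Al_up t t' : Al t -> t <= t' -> Al t'.
  move=> [x [Ix xx ut]] tt'; exists x; split=> //.
  by rewrite (le_trans _ ut)// /u lerD2l ler_wnM2r// ltW// ql.
have zero_r t : Ar t -> exists x, [/\ I x, x0 < x & u t x = 0].
  move=> [x [Ix xx]]; rewrite le_eqVlt => /predU1P[h|h]; first by exists x.
  have [|c [xc cx Ic uc]] := zero_between (cu t) Ix0 Ix xx; last by exists c.
  by right; rewrite ux0 h ltr01.
have zero_l t : Al t -> exists x, [/\ I x, x < x0 & u t x = 0].
  move=> [x [Ix xx]]; rewrite le_eqVlt => /predU1P[h|h]; first by exists x.
  have [|c [xc cx Ic uc]] := zero_between (cu t) Ix Ix0 xx; last by exists c.
  by left; rewrite ux0 h ltr01.
have disj t : Ar t -> Al t -> False.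
  move=> /zero_r[x [Ix xx ux]] /zero_l[y [Iy yx uy]].
  by apply: (two t y x) => //; exact: lt_trans xx.
have lt_rl t t' : Ar t -> Al t' -> t < t'.
  by move=> At Bt; rewrite ltNge; apply/negP => h; apply: (disj t) => //; exact: Al_up h.
have uq0 x t : q x != 0 -> u t x = (t - - p x / q x) * q x.
  by move=> qx; rewrite /u; field.
have Ar_open t : Ar t -> exists2 t', t < t' & Ar t'.
  move=> /zero_r[x [Ix xx ux]]; have [y xy Iy] := open_bigger oI Ix.
  have xy0 := lt_trans xx xy.
  have qx := qr x Ix xx; have qy := qr y Iy xy0.
  have [uy|uy|uy] := ltgtP (u t y) 0.
  (* The solution with parameter [- p y / q y] vanishes at [y]; negativity of [u t y] says that [t]
     is smaller. *)
  - exists (- p y / q y); last first.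
      by exists y; split => //; rewrite uq0 ?gt_eqF// subrr mul0r.
    move: uy; rewrite uq0 ?gt_eqF// pmulr_llt0// subr_lt0//.
  (* Lowering [t] by [e] makes the value at [x] negative and only halves the positive value at [y];
     the resulting sign changes give two zeros, against disconjugacy. *)
  - exfalso; pose e := u t y / (2 * q y).
    have e0 : 0 < e by rewrite divr_gt0// mulr_gt0.
    have h1 : u (t - e) x < 0.
      have -> : u (t - e) x = u t x - e * q x by rewrite /u; ring.
      by rewrite ux sub0r oppr_lt0 mulr_gt0.
    have h2 : 0 < u (t - e) y.
      have -> : u (t - e) y = u t y / 2 by rewrite /e /u; field; rewrite gt_eqF.
      by rewrite divr_gt0.
    have [|c [c1 c2 Ic uc]] := zero_between (cu (t - e)) Ix0 Ix xx.
      by right; rewrite ux0 h1 ltr01.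
    have [|c' [c1' c2' Ic' uc']] := zero_between (cu (t - e)) Ix Iy xy.
      by left; rewrite h1 h2.
    by apply: (two (t - e) c c') => //; exact: lt_trans c1'.
  - by exfalso; exact: (two t x y Ix Iy xy ux uy).
have Al_open t : Al t -> exists2 t', t' < t & Al t'.
  move=> /zero_l[x [Ix xx ux]]; have [y yx Iy] := open_smaller oI Ix.
  have yx0 := lt_trans yx xx.
  have qx := ql x Ix xx; have qy := ql y Iy yx0.
  have [uy|uy|uy] := ltgtP (u t y) 0.
  - exists (- p y / q y); last first.
      by exists y; split => //; rewrite uq0 ?lt_eqF// subrr mul0r.
    by move: uy; rewrite uq0 ?lt_eqF// nmulr_llt0// subr_gt0.
  - exfalso; pose e := - u t y / (2 * q y).
    have e0 : 0 < e by rewrite /e mulNr oppr_gt0 pmulr_rlt0// invr_lt0 pmulr_rlt0.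
    have h1 : u (t + e) x < 0.
      have -> : u (t + e) x = u t x + e * q x by rewrite /u; ring.
      by rewrite ux add0r pmulr_rlt0.
    have h2 : 0 < u (t + e) y.
      have -> : u (t + e) y = u t y / 2 by rewrite /e /u; field; rewrite lt_eqF.
      by rewrite divr_gt0.
    have [|c [c1 c2 Ic uc]] := zero_between (cu (t + e)) Ix Ix0 xx.
      by left; rewrite ux0 h1 ltr01.
    have [|c' [c1' c2' Ic' uc']] := zero_between (cu (t + e)) Iy Ix yx.
      by right; rewrite h1 h2.
    by apply: (two (t + e) c' c) => //; exact: lt_trans c1.
  - by exfalso; exact: (two t y x Iy Ix yx uy ux).
have [b xb Ib] := open_bigger oI Ix0; have [a ax Ia] := open_smaller oI Ix0.
have Ar0 : Ar !=set0.
  by exists (- p b / q b); exists b; split => //; rewrite uq0 ?subrr ?mul0r// gt_eqF// qr.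
have Al0 : Al (- p a / q a).
  by exists a; split => //; rewrite uq0 ?subrr ?mul0r// lt_eqF// ql.
have hs : has_sup Ar.
  by split=> //; exists (- p a / q a) => t At; rewrite ltW//; exact: lt_rl.
(* [sup Ar] is not in [Ar], which has no maximum, nor in [Al], which lies above [Ar] and has no
   minimum. *)
exists (u (sup Ar)), (z (sup Ar)); split=> // x Ix.
rewrite ltNge; apply/negP => ule.
have [xx|xx|xx] := ltgtP x x0.
- have [|t' t'l At'] := Al_open (sup Ar); first by exists x.
  have : sup Ar <= t'.
    by apply: ge_sup => // t At; rewrite ltW//; exact: lt_rl.
  by rewrite leNgt t'l.
- have [|t' t'l At'] := Ar_open (sup Ar); first by exists x.
  have : t' <= sup Ar by apply: ub_le_sup => //; case: hs.
  by rewrite leNgt t'l.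
- by move: ule; rewrite xx ux0 ler10.
Qed.

End nonoscillation.

(** * Measures given by a density *)

Section density_measure.
Context d (T : measurableType d) (R : realType).
Variables (s : {measure set T -> \bar R}) (g : T -> \bar R).
Hypotheses (g0 : forall x, (0 <= g x)%E) (mg : measurable_fun setT g).

(** The two proofs are arguments of the set function so that the measure instance declared on it can
    find them. *)
Definition density of (forall x, (0 <= g x)%E) & measurable_fun setT g :=
  fun A : set T => (\int[s]_(x in A) g x)%E.

Let D := density g0 mg.

Let density0 : D set0 = 0%E.
Proof. by rewrite /D /density integral_set0. Qed.

Let density_ge0 A : (0 <= D A)%E.
Proof. by apply: integral_ge0 => x _; exact: g0. Qed.

Let density_sigma_additive : semi_sigma_additive D.
Proof.
move=> F mF tF mUF; rewrite /D /density ge0_integral_bigcup//.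
- by apply: is_cvg_ereal_nneg_natsum_cond => n _ _; apply: integral_ge0.
- by apply: measurable_funTS.
Qed.

HB.instance Definition _ :=
  isMeasure.Build _ _ _ D density0 density_ge0 density_sigma_additive.

Definition density_measure : {measure set T -> \bar R} := D.

End density_measure.

(** * From a positive solution of the system to L u = 0 *)

Section radon_density.
Context {R : realType}.
Notation T := (measurableTypeR R).
Notation mu := (@lebesgue_measure R).
Variables (I : set R) (m w dw u z : R -> R) (nu : signed_radon I) (x0 : R).
Hypotheses (oI : open I) (iI : is_interval I) (Ix0 : I x0).
Hypotheses (cm : {within I, continuous m}) (m_gt0 : forall x, I x -> 0 < m x).
Hypotheses (w_gt0 : forall x, I x -> 0 < w x) (Pw : primI I w dw).
Hypotheses (Suz : quasi_solution I (massN m nu x0) w u z).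
Hypotheses (u_gt0 : forall x, I x -> 0 < u x).
Implicit Types (a b x : R).

Let cu : {within I, continuous u}.
Proof. by case: Suz => Pu _; exact: primI_continuous Pu. Qed.

Let bmu : bmfI I (fun x => m x * u x).
Proof. by apply: bmfIM; exact: continuous_bmfI. Qed.

Let mI : measurable (I : set T). Proof. exact: open_measurable. Qed.

Let g : T -> \bar R := fun x => ((fun x => m x * u x) \_ I x)%:E.

Let g0 x : (0 <= g x)%E.
Proof.
rewrite /g lee_fin patchE; case: ifPn => // /set_mem Ix.
by rewrite ltW// mulr_gt0 ?m_gt0 ?u_gt0.
Qed.

Let mg : measurable_fun setT g.
Proof.
apply/measurable_EFinP/(measurable_restrictT _ _).1 => //.
exact: bmfI_measurable.
Qed.

Let D : {measure set T -> \bar R} := density_measure (tv nu) g0 mg.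

Let DE (A : set T) : A `<=` I -> D A = (\int[tv nu]_(x in A) (m x * u x)%:E)%E.
Proof.
move=> AI; apply: eq_integral => x /set_mem/AI Ix.
by rewrite /g patchE mem_set.
Qed.

Let segment_fin a b : I a -> I b -> (tv nu `[a, b]%classic < +oo)%E.
Proof.
move=> Ia Ib; apply: (@tv_finite _ _ nu); first exact: segment_compact.
exact: itv_subset.
Qed.

Let integrable_mu (A : set T) a b : measurable A -> I a -> I b ->
  A `<=` `[a, b]%classic ->
  (tv nu).-integrable A (EFin \o (fun x => m x * u x)).
Proof.
move=> mA Ia Ib Aab; have [mmu [M muM]] := bmu Ia Ib.
apply: (@integrableS _ _ _ (tv nu) `[a, b]%classic) => //.
exact: (finite_bounded_integrable (measurable_itv _) (segment_fin Ia Ib) mmu muM).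
Qed.

Let D_fin (A : set T) a b : measurable A -> I a -> I b ->
  A `<=` `[a, b]%classic -> (D A < +oo)%E.
Proof.
move=> mA Ia Ib Aab; rewrite DE; last by move=> x /Aab; exact: (itv_subset iI Ia Ib).
by apply: integrable_lty => //; exact: integrable_mu Aab.
Qed.

Let D_compact_fin (K : set R) : compact K -> K `<=` I -> (D K < +oo)%E.
Proof.
move=> cK KI; have [a [b [axb abI Kab]]] := compact_subset_segment oI iI cK KI Ix0.
have [Ia Ib] := segment_endpoints axb abI.
apply: (D_fin _ Ia Ib); first exact: compact_measurable.
by move=> x /Kab; exact: subset_itv_oo_cc.
Qed.

Let msgn : measurable_fun I ((fun x => - sgn nu x) : T -> R).
Proof. by apply: measurable_funN; exact: sgn_measurable. Qed.

Let sgnN_pm1 x : I x -> - sgn nu x = 1 \/ - sgn nu x = -1.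
Proof. by move=> /(@sgn_pm1 _ _ nu)[->|->]; [right|left; rewrite opprK]. Qed.

(** The signed measure - u m nu: positivity of m u puts it into the total variation, and the minus
    sign goes into the sign function. *)
Let rho : signed_radon I :=
  @SignedRadon R I D (fun x => - sgn nu x) D_compact_fin msgn sgnN_pm1.

(** An instance of [eq_signed_integral]: the density 1 against [D] and the density m u against
    [tv nu] agree on sets by construction. *)
Let change_of_density (A : set T) a b p : measurable A -> I a -> I b ->
  A `<=` `[a, b]%classic -> bmf a b p ->
  \int[D]_(x in A) p x = \int[tv nu]_(x in A) (p x * (m x * u x)).
Proof.
move=> mA Ia Ib Aab [mp [P pP]].
have [mmu [M muM]] := bmu Ia Ib.
transitivity (\int[D]_(x in A) (p x * 1)); first by apply: eq_Rintegral => x _; rewrite mulr1.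
have sA : (tv nu A < +oo)%E.
  apply: le_lt_trans (segment_fin Ia Ib).
  by rewrite le_measure ?inE.
apply: (@eq_signed_integral _ D (tv nu) A (cst 1) (fun x => m x * u x) p (1 + M) P) => //.
- exact: D_fin Aab.
- by apply: measurable_funS mmu.
- by apply: measurable_funS mp.
- move=> x /Aab xab; rewrite normr1 lerDl (le_trans _ (muM x xab))//.
- by move=> x /Aab/muM H; rewrite (le_trans H)// lerDr.
- by move=> x /Aab/pP.
move=> B mB BA; rewrite Rintegral_cst// mul1r DE//.
by move=> x /BA/Aab; exact: (itv_subset iI Ia Ib).
Qed.

Lemma primI_weak_derivative F f : primI I F f -> weak_derivative I F f.
Proof.
move=> PF; split.
- exact: bmfI_locally_integrable oI iI Ix0 (primI_bmfI PF).
- exact: bmfI_locally_integrable oI iI Ix0 (primI_deriv PF).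
move=> phi tphi; have sphi : smooth phi by case: tphi.
have [a [b [axb abI p0]]] := test_function_support oI iI Ix0 tphi.
have [Ia Ib] := segment_endpoints axb abI.
have ab : a <= b by lra.
have p0' x : x \notin `[a, b] -> phi x = 0 /\ derive1 phi x = 0.
  by move=> xab; apply: p0; apply: contra xab; exact: subset_itv_oo_cc.
have pa : phi a = 0 by apply: (p0 a _).1; rewrite in_itv/= ltxx.
have pb : phi b = 0 by apply: (p0 b _).1; rewrite in_itv/= ltxx andbF.
rewrite !(Rintegral_segment mu abI); last 2 first.
- by move=> x /p0'[-> _]; rewrite mulr0.
- by move=> x /p0'[_ ->]; rewrite mulr0.
exact: integral_by_parts ab (PF a b Ia Ib) (smooth_prim a b sphi) pa pb.
Qed.

(* The measure [d((1/w) du/dx)] is [- u m nu]. *)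
Lemma quasi_solution_L_null : L_null m w nu u.
Proof.
case: Suz => Pu Pz; set N := massN m nu x0 in Pu Pz.
have bN : bmfI I N := bmfI_massN nu oI iI Ix0 cm.
have bs : bmfI I (sgn nu) := bmfI_sgn nu oI iI.
exists (fun x => w x * (z x - N x * u x)), rho; split.
- exact: primI_weak_derivative.
- have vE x : I x -> z x - N x * u x = (w x)^-1 * (w x * (z x - N x * u x)).
    by move=> Ix; rewrite mulKf// gt_eqF// w_gt0.
  split.
    apply: (bmfI_locally_integrable oI iI Ix0); apply: (eq_bmfI iI vE).
    apply: bmfIB; first exact: primI_bmfI Pz.
    by apply: bmfIM => //; exact: primI_bmfI Pu.
  move=> phi tphi; have sphi : smooth phi by case: tphi.
  have [a [b [axb abI p0]]] := test_function_support oI iI Ix0 tphi.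
  have [Ia Ib] := segment_endpoints axb abI.
  have ab : a <= b by lra.
  have p0' x : x \notin `[a, b] -> phi x = 0 /\ derive1 phi x = 0.
    by move=> xab; apply: p0; apply: contra xab; exact: subset_itv_oo_cc.
  have pa : phi a = 0 by apply: (p0 a _).1; rewrite in_itv/= ltxx.
  have pb : phi b = 0 by apply: (p0 b _).1; rewrite in_itv/= ltxx andbF.
  have Pphi := smooth_prim a b sphi.
  have Pz' := Pz a b Ia Ib; have Pu' := Pu a b Ia Ib.
  have oc : `]a, b]%classic `<=` (`[a, b]%classic : set R).
    by move=> x; exact: subset_itv_oc_cc.
  have -> : signed_integral rho I phi = - \int[D]_(x in `]a, b]) (phi x * sgn nu x).
    rewrite /signed_integral (@Rintegral_support R _ T D `]a, b]%classic I).
    - have bps : bmf a b (fun x => phi x * sgn nu x).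
        by apply: bmfM; [exact: prim_bmf Pphi|exact: bs].
      have := mass_integrable iI D_compact_fin Ia Ib bps => ips.
      rewrite -[RHS]mulN1r -RintegralZl//; apply: eq_Rintegral => x _ /=; ring.
    - by move=> x /oc/abI.
    - move=> x _ xab; rewrite (p0 x _).1 ?mul0r//; apply/negP => xab'.
      by apply: xab; exact: subset_itv_oo_oc.
  rewrite opprK (@change_of_density _ a b (fun x => phi x * sgn nu x))//; last first.
    by apply: bmfM; [exact: prim_bmf Pphi|exact: bs].
  have -> : \int[tv nu]_(x in `]a, b]) (phi x * sgn nu x * (m x * u x)) =
      \int[tv nu]_(x in `]a, b]) (phi x * u x * (m x * sgn nu x)).
    by apply: eq_Rintegral => x _; ring.
  have bd := bmfI_density nu oI iI cm.
  rewrite (parts_mass iI Ix0 (@tv_finite _ _ nu) bd ab Ia Ib (primM Pphi Pu')); last 2 first.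
  - by rewrite pa mul0r.
  - by rewrite pb mul0r.
  rewrite (Rintegral_segment mu abI); last by move=> x /p0'[_ ->]; rewrite mulr0.
  rewrite -/(massN m nu x0) -/N.
  have bphi := prim_bmf Pphi; have bphi' := prim_bmf_deriv Pphi.
  have bu := prim_bmf Pu'; have bz := prim_bmf Pz'.
  have bz' := prim_bmf_deriv Pz'; have bNab := bN a b Ia Ib.
  (* Here u' / w = z - N u. The term phi' u N also occurs in (phi u)' N on the other side and
     cancels; what remains is the integration by parts for z' = N u'. *)
  transitivity (\int[mu]_(x in `[a, b]) (z x * derive1 phi x - derive1 phi x * u x * N x)).
    apply: eq_segI => x xab; rewrite -vE; first by ring.
    exact: abI.
  rewrite segIB; [|exact: bmfM|by apply: bmfM => //; exact: bmfM].
  rewrite (integral_by_parts ab Pz' Pphi pa pb) -opprD; congr (- _).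
  rewrite -segID; [|exact: bmfM|by apply: bmfM => //; exact: bmfM].
  by apply: eq_segI => x _; ring.
- move=> A K mA cK AK KI.
  have [a [b [axb abI Kab]]] := compact_subset_segment oI iI cK KI Ix0.
  have [Ia Ib] := segment_endpoints axb abI.
  have Aab : A `<=` `[a, b]%classic by move=> x /AK/Kab; exact: subset_itv_oo_cc.
  rewrite /signed_integral.
  rewrite (@change_of_density A a b (fun x => (m x)^-1 * - sgn nu x))//; last first.
    apply: bmfM; first exact: (bmfI_V iI cm m_gt0 Ia Ib).
    by apply: bmfN; exact: bs.
  have ius : (tv nu).-integrable A (EFin \o (fun x => u x * sgn nu x)).
    apply: (@integrableS _ _ _ (tv nu) `[a, b]%classic) => //.
    have [mus [M usM]] : bmf a b (fun x => u x * sgn nu x).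
      by apply: bmfM; [exact: primI_bmfI Pu _ _ Ia Ib|exact: bs].
    exact: (finite_bounded_integrable (measurable_itv _) (segment_fin Ia Ib) mus usM).
  apply/eqP; rewrite addr_eq0 -mulN1r -RintegralZl//; apply/eqP.
  apply: eq_Rintegral => x /set_mem/Aab/abI Ix.
  by have mx := m_gt0 Ix; field; rewrite gt_eqF.
Qed.

End radon_density.

(** * The equivalence *)

Local Open Scope classical_set_scope.

Theorem proposition2p7 (R : realType) (I : set R) (m w : R -> R)
    (nu : signed_radon I)
    (I_open : open I) (I_itv : is_interval I)
    (m_cont : {within I, continuous m}) (m_gt0 : forall x, I x -> 0 < m x)
    (w_cont : {within I, continuous w}) (w_gt0 : forall x, I x -> 0 < w x)
    (w_deriv : locally_bounded_derivative I w) :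
  (exists u : R -> R,
     [/\ {within I, continuous u}, forall x, I x -> 0 < u x
       & L_null m w nu u])
  <->
  (forall f : R -> R, test_function I f ->
     \int[lebesgue_measure]_(x in I) (L0 m w f x * f x * m x)
     + signed_integral nu I (fun x => f x ^+ 2 * m x) <= 0).
Proof.
(* The interval may be empty; there is then no base point, and both conditions hold since every
   integral is over the empty set. *)
have [I0|/set0P[x0 Ix0]] := eqVneq I set0.
  subst I; split=> [_ f _|_]; first by rewrite /signed_integral !Rintegral_set0 addr0.
  have l0 f : locally_integrable set0 f.
    split=> [||K K0 _]; [exact: measurable_fun_set0|exact: open0|].
    have -> : K = set0 by apply/seteqP; split.
    by rewrite integral_set0.
  exists (cst 1); split=> //; first exact: continuous_subspace0.
  exists (cst 0), nu; split.
  - by split=> // phi _; rewrite !Rintegral_set0 oppr0.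
  - by split=> // phi _; rewrite /signed_integral !Rintegral_set0 oppr0.
  - move=> A K _ _ AK K0; have -> : A = set0 by apply/seteqP; split=> // x /AK/K0.
    by rewrite /signed_integral !Rintegral_set0 addr0.
have [dw wdw dw_bounded] := w_deriv.
have bdw : bmfI I dw.
  move=> a b Ia Ib; have abI := itv_subset I_itv Ia Ib.
  split; last exact: (dw_bounded _ (@segment_compact R a b) abI).
  case: wdw => _ [mdw _ _] _.
  by apply: measurable_funS mdw => //; exact: open_measurable.
(* The distributional hypothesis on [w] becomes that [w] is locally Lipschitz with derivative
   [dw]. *)
have Pw := weak_derivative_primI I_open I_itv Ix0 w_cont bdw wdw.
split=> [[u [cu u_gt0 Lu]] f tf|form_le0].
  exact: (positive_solution_form I_open I_itv Ix0 m_cont m_gt0 w_gt0 Pw cu u_gt0 Lu tf).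
have [u [z [S u_gt0]]] := positive_quasi_solution I_open I_itv Ix0 m_cont m_gt0
  w_gt0 Pw form_le0.
exists u; split=> //; first by case: (S) => Pu _; exact: primI_continuous Pu.
exact: (quasi_solution_L_null I_open I_itv Ix0 m_cont m_gt0 w_gt0 S u_gt0).
Qed.
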